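(* Fix $k\in\mathbb N$ and $\rho=(\rho_1,\dots,\rho_k)\in(0,1)^k$, and for $0<\gamma<1$ let $$F(\gamma)=\begin{pmatrix}0&D_k(\rho)&0&0\\ D_k(\rho)^{-1}&0&0&0\\ 0&0&0&\gamma\\ 0&0&\gamma^{-1}&0\end{pmatrix}\in GL_{2k+2}(\mathbb C).$$ Then, as $\gamma\to0$, the subset of (rescaled) generators $$\tilde{\mathcal S}_{F(\gamma)}=\{\sqrt{N_{F(\gamma)}}\,u_{ij}\}_{1\le i\le k,\ 1\le j\le 2k}\subset(C(O^+_{F(\gamma)}),h_{O^+_{F(\gamma)}})$$ converges in distribution to a free family $\tilde{\mathcal S}=\{y_{ij}\}_{1\le i\le k,\ 1\le j\le 2k}$ of generalized circular elements in a non-commutative probability space $(A,\varphi)$, with left and right variances $$\varphi(y_{ij}^*y_{ij})=\rho_i^2,\qquad \varphi(y_{ij}y_{ij}^* )=\begin{cases}\rho_j^{-2}&1\le j\le k,\\ \rho_{j-k}^{2}&k+1\le j\le 2k.\end{cases}$$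
   Context: $D_k(\rho)=\mathrm{diag}(\rho_1,\dots,\rho_k)$. For $F\in GL_N(\mathbb C)$ with $F\overline F=\pm1$ ($\overline F$ the entrywise conjugate), $C(O_F^+)$ is the universal unital C$^*$-algebra generated by $u_{ij}$ ($1\le i,j\le N$) subject to: $U=[u_{ij}]$ is unitary and $U=F\overline UF^{-1}$, where $\overline U=[u_{ij}^*]$; coproduct $\Delta(u_{ij})=\sum_m u_{im}\otimes u_{mj}$. The Haar state $h_{O_F^+}$ is the unique state $h$ with $(h\otimes\iota)\Delta(a)=(\iota\otimes h)\Delta(a)=h(a)1$ for all $a$. $N_F=\mathrm{Tr}(F^*F)$. A non-commutative probability space $(A,\varphi)$ is a unital C$^*$-algebra with a state. On the full Fock space $\mathcal F(H)=\mathbb C\Omega\oplus\bigoplus_{n\ge1}H^{\otimes n}$ with vacuum state $\varphi_\Omega=\langle\Omega|\cdot\,\Omega\rangle$ and left creation operators $\ell(\xi)$, an $(\alpha,\beta)$-generalized circular element ($\alpha,\beta>0$) is a variable with the same $*$-distribution as $\alpha\ell(\xi)+\beta\ell(\eta)^*$ with $\xi,\eta$ orthonormal. The left and right variances of $x$ are $\varphi(x^*x)=\alpha^2$ and $\varphi(xx^* )=\beta^2$, and they determine the $*$-distribution of $x$. A family of variables is free if the unital $*$-subalgebras generated by the individual variables are freely independent. Convergence in distribution means convergence of all joint $*$-moments. *)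

(* Defs.v *)
From HB Require Import structures.
From mathcomp Require Import all_boot all_order all_algebra.
From mathcomp Require Import all_classical all_reals all_analysis.
From mathcomp Require Import complex.

Set Implicit Arguments.
Unset Strict Implicit.
Unset Printing Implicit Defensive.

Import Order.TTheory GRing.Theory Num.Theory numFieldNormedType.Exports.

Local Open Scope classical_set_scope.
Local Open Scope ring_scope.
Local Open Scope complex_scope.

(* Unital C*-algebras over R[i].  The norm is a separate real-valued function:
   in the library a ring whose elements carry `|x| is already a numDomainType.
   MathComp algebras are nonzero (1 != 0). *)
HB.mixin Record isCStarAlgebra (R : realType) A of GRing.Algebra R[i] A := {
  star : A -> A;
  starK : involutive star;
  starD : forall a b, star (a + b) = star a + star b;
  starZ : forall (c : R[i]) a, star (c *: a) = c^* *: star a;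
  starM : forall a b, star (a * b) = star b * star a;
  cnorm : A -> R;
  cnorm0_eq0 : forall a, cnorm a = 0 -> a = 0;
  cnormD : forall a b, cnorm (a + b) <= cnorm a + cnorm b;
  cnormZ : forall (c : R[i]) a, cnorm (c *: a) = Normc.normc c * cnorm a;
  cnormM : forall a b, cnorm (a * b) <= cnorm a * cnorm b;
  cnorm_star : forall a, cnorm (star a * a) = cnorm a ^+ 2;
  cnorm_complete : forall u : nat -> A,
    (forall e, 0 < e -> exists n0, forall m n,
       (n0 <= m)%N -> (n0 <= n)%N -> cnorm (u m - u n) < e) ->
    exists l, forall e, 0 < e -> exists n0, forall n,
       (n0 <= n)%N -> cnorm (u n - l) < e
}.

#[short(type="cstarType")]
HB.structure Definition CStarAlgebra (R : realType) :=
  {A of isCStarAlgebra R A & GRing.Algebra R[i] A}.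

Definition norm_dense (R : realType) (A : cstarType R) (S : set A) :=
  forall a e, 0 < e -> exists2 b, S b & cnorm (a - b) < e.

Definition bounded_map (R : realType) (A B : cstarType R) (L : A -> B) :=
  exists M : R, forall a, cnorm (L a) <= M * cnorm a.

Definition star_morphism (R : realType) (A B : cstarType R) (f : A -> B) :=
  forall a, f (star a) = star (f a).

Definition star_subalgebra (R : realType) (A : cstarType R) (D : set A) :=
  [/\ D 1,
      forall (c : R[i]) a b, D a -> D b -> D (c *: a + b),
      forall a b, D a -> D b -> D (a * b) &
      forall a, D a -> D (star a)].

Definition gen_star_subalgebra (R : realType) (A : cstarType R) (S : set A) :
  set A := smallest (@star_subalgebra R A) S.

(* [0 <= z] in R[i] means that z is real and nonnegative. *)
Definition is_state (R : realType) (A : cstarType R) (phi : {scalar A}) :=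
  phi 1 = 1 /\ forall a : A, 0 <= phi (star a * a).

Section FreeOrthogonal.
Variables (R : realType) (N : nat) (F : 'M[R[i]]_N).

Definition NF : R[i] := \tr ((map_mx (@conjc R) F)^T *m F).

Definition scalars_mx (A : cstarType R) (M : 'M[R[i]]_N) : 'M[A]_N :=
  map_mx (in_alg A) M.

Definition bar_mx (A : cstarType R) (U : 'M[A]_N) : 'M[A]_N := map_mx star U.

Definition OF_relations (A : cstarType R) (U : 'M[A]_N) :=
  [/\ U *m (bar_mx U)^T = 1%:M,
      (bar_mx U)^T *m U = 1%:M &
      U = scalars_mx A F *m bar_mx U *m scalars_mx A (invmx F)].

Definition is_C_OF (A : cstarType R) (U : 'M[A]_N) :=
  [/\ OF_relations U,
      norm_dense (gen_star_subalgebra [set a | exists i j, a = U i j]) &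
      forall (B : cstarType R) (V : 'M[B]_N), OF_relations V ->
        exists pi : {lrmorphism A -> B},
          star_morphism pi /\ forall i j, pi (U i j) = V i j].

End FreeOrthogonal.

(* T is a C*-completion of the algebraic tensor product of A and B, with
   i1 a = a (x) 1 and i2 b = 1 (x) b; the third clause says that A (.) B embeds
   into T.  The C*-cross-norm is left arbitrary: the minimal one is included. *)
Definition is_cstar_tensor (R : realType) (A B T : cstarType R)
    (i1 : {lrmorphism A -> T}) (i2 : {lrmorphism B -> T}) :=
  [/\ star_morphism i1 /\ star_morphism i2,
      forall a b, i1 a * i2 b = i2 b * i1 a,
      forall n (a : 'I_n -> A) (b : 'I_n -> B),
        (forall c : 'I_n -> R[i], \sum_m c m *: a m = 0 ->
                                  forall m, c m = 0) ->
        \sum_m i1 (a m) * i2 (b m) = 0 -> forall m, b m = 0 &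
      norm_dense [set x : T | exists n (a : 'I_n -> A) (b : 'I_n -> B),
                              x = \sum_m i1 (a m) * i2 (b m)]].

(* h is a state with (h (x) id) Delta a = (id (x) h) Delta a = h(a) 1, where
   hl and hr are the slice maps h (x) id and id (x) h; by density they are
   determined by boundedness and their values on elementary tensors. *)
Definition is_Haar_state (R : realType) (N : nat) (A : cstarType R)
    (U : 'M[A]_N) (h : {scalar A}) :=
  is_state h /\
  exists (T : cstarType R) (i1 i2 : {lrmorphism A -> T})
         (Delta : {lrmorphism A -> T}) (hl hr : {linear T -> A}),
    [/\ is_cstar_tensor i1 i2,
        star_morphism Delta /\
          forall i j, Delta (U i j) = \sum_m i1 (U i m) * i2 (U m j),
        bounded_map hl /\ forall a b, hl (i1 a * i2 b) = h a *: b,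
        bounded_map hr /\ forall a b, hr (i1 a * i2 b) = h b *: a &
        forall a, hl (Delta a) = h a *: 1 /\ hr (Delta a) = h a *: 1].

(* In words, the boolean [true] marks an adjoint. *)
Definition star_if (R : realType) (A : cstarType R) (b : bool) (a : A) : A :=
  if b then star a else a.

Definition moment (R : realType) (A : cstarType R) (phi : A -> R[i])
    (I : Type) (x : I -> A) (w : seq (I * bool)) : R[i] :=
  phi (\prod_(p <- w) star_if p.2 (x p.1)).

Definition free_family (R : realType) (A : cstarType R) (phi : A -> R[i])
    (I : eqType) (y : I -> A) :=
  forall s : seq (I * A),
    s != [::] ->
    sorted (fun p q => p.1 != q.1) s ->
    (forall p, p \in s -> gen_star_subalgebra [set y p.1] p.2 /\ phi p.2 = 0) ->
    phi (\prod_(p <- s) p.2) = 0.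

Section FullFock.
Variables (R : realType) (d : nat).

(* The full Fock space over C^d, in coordinates: the word [:: i1; ...; in] is
   the basis vector e_i1 (x) ... (x) e_in, and [::] is the vacuum.  Square
   summability plays no role in vacuum moments: the vectors obtained by applying
   creation and annihilation operators to the vacuum have finite support. *)
Definition fock := seq 'I_d -> R[i].

Definition vacuum : fock := fun w => (w == [::])%:R.

Definition inner (xi eta : 'cV[R[i]]_d) : R[i] :=
  \sum_i (xi i 0)^* * eta i 0.

Definition orthonormal2 (xi eta : 'cV[R[i]]_d) :=
  [/\ inner xi xi = 1, inner eta eta = 1 & inner xi eta = 0].

(* l(xi) f = xi (x) f *)
Definition creation (xi : 'cV[R[i]]_d) (f : fock) : fock :=
  fun w => if w is i :: w' then xi i 0 * f w' else 0.

(* The adjoint l(xi)^*: it kills the vacuum and sends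
   x1 (x) x2 (x) ... (x) xn to <xi | x1> x2 (x) ... (x) xn. *)
Definition annihilation (xi : 'cV[R[i]]_d) (f : fock) : fock :=
  fun w => \sum_i (xi i 0)^* * f (i :: w).

(* alpha l(xi) + beta l(eta)^*, or its adjoint when b = true *)
Definition gcirc_op (alpha beta : R) (xi eta : 'cV[R[i]]_d) (b : bool)
    (f : fock) : fock :=
  fun w =>
    if b then alpha%:C * annihilation xi f w + beta%:C * creation eta f w
    else alpha%:C * creation xi f w + beta%:C * annihilation eta f w.

(* The vacuum state evaluated at the product of the operators gcirc_op b over
   the letters b of the word w. *)
Definition gcirc_moment (alpha beta : R) (xi eta : 'cV[R[i]]_d)
    (w : seq bool) : R[i] :=
  foldr (gcirc_op alpha beta xi eta) vacuum w [::].

End FullFock.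

Definition generalized_circular (R : realType) (A : cstarType R)
    (phi : A -> R[i]) (alpha beta : R) (x : A) :=
  [/\ 0 < alpha, 0 < beta &
      exists (d : nat) (xi eta : 'cV[R[i]]_d),
        orthonormal2 xi eta /\
        forall w : seq bool,
          phi (\prod_(b <- w) star_if b x) = gcirc_moment alpha beta xi eta w].

Section Deformation.
Variables (R : realType) (k : nat) (rho : 'rV[R]_k).

Definition Dk : 'M[R[i]]_k := diag_mx (map_mx (real_complex R) rho).

Definition Fgamma (gamma : R) : 'M[R[i]]_(k + k + (1 + 1)) :=
  block_mx (block_mx 0 Dk (invmx Dk) 0) 0
           0 (block_mx 0 (gamma%:C)%:M ((gamma^-1)%:C)%:M 0).

(* The subset S_F of rescaled generators: rows 1..k, columns 1..2k. *)
Definition rescaled_generators (gamma : R) (A : cstarType R)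
    (U : 'M[A]_(k + k + (1 + 1))) (p : 'I_k * 'I_(k + k)) : A :=
  sqrtC (NF (Fgamma gamma)) *:
    U (lshift (1 + 1) (lshift k p.1)) (lshift (1 + 1) p.2).

End Deformation.

(* Main.v *)
(** F(gamma) is a monomial matrix, with entries f_i at (i, i'), where i' is the dual
   index.  The L2-space of the quantum group is the sum over n of
   H_n (x) H_n, where H_n is the range of the Jones-Wenzl projection P_n in the
   n-th tensor power of C^N, and u_ij acts on it as f_i times a creation operator of
   e_i (x) e_j plus 1/f_j times the adjoint of a creation operator of e_i' (x) e_j'.
   These operators satisfy the defining relations, so the universal property and
   the equivariance of the model identify the Haar state with the vacuum state.

   As gamma tends to 0 the dimension N stays fixed, the quotients c_n in the Wenzl
   recursion satisfy N_F c_n -> 1, and P_n converges to a projection that fixes all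
   words avoiding the last two letters.  Therefore the rescaled generators turn into
   f_i l(e_ij) + f_j^-1 l(e_i'j')^* on the full Fock space over C^N (x) C^N, and the
   pairs {e_ij, e_i'j'} are disjoint for distinct i <= k, j <= 2k, whence freeness.

   The C*-algebras needed (target and model) are norm completions of algebras of
   bounded adjointable operators on pre-Hilbert spaces. *)

From HB Require Import structures.
Require Import Defs.
From mathcomp Require Import all_boot all_order all_algebra.
From mathcomp Require Import all_classical all_reals all_analysis.
From mathcomp Require Import complex.
From mathcomp Require Import ring lra.

Import Order.TTheory GRing.Theory Num.Theory numFieldNormedType.Exports.

Local Open Scope classical_set_scope.
Local Open Scope ring_scope.
Local Open Scope complex_scope.

Set Implicit Arguments.
Unset Strict Implicit.
Unset Printing Implicit Defensive.

(** * Bounded adjointable operators on a pre-Hilbert space *)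

(** The obstacle is that the form, the projections and the weights of the model all vary with gamma,
    while F(gamma) has the unbounded entry 1/gamma. The cup, with coefficients 1/f_a, has no limit.
    Only its products c_n / (f_a f_b) with the Wenzl coefficient converge, because N_F is of order
    gamma^-2. Their limit is nonzero exactly when a and b both equal the letter of entry gamma, so
    it does not touch words in the first 2k letters, and the chosen generators and their adjoints
    produce no others.

    The comparison of states is a convolution argument. For the pullback g of the vacuum state, g(1)
    = 1 and the left invariance of h give h = (h (x) g) Delta, while equivariance of the model gives
    (h (x) g) Delta = g. Adjoints never enter: F is monomial, so the adjoint of u_ij is a multiple
    of u_i'j', and star moments are multiples of moments of star-free words.

    The same proportionality explains the restriction to rows i <= k: with all rows up to 2k the
    family would contain both u_ij and u_i'j', which are not free. *)

Section ComplexNorm.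
Variable R : realType.
Implicit Types (x y z : R[i]) (r : R).

Lemma normc_normr z : (Normc.normc z)%:C = `|z|.
Proof. by case: z => a b; rewrite normc_def. Qed.

Lemma normc_ge0 z : 0 <= Normc.normc z.
Proof. by case: z => a b; rewrite /= sqrtr_ge0. Qed.

Lemma sqr_normc z : Normc.normc z ^+ 2 = complex.Re (z * Num.conj z).
Proof.
case: z => a b /=; rewrite sqr_sqrtr ?addr_ge0 ?sqr_ge0 //; ring.
Qed.

Lemma mul_conjc z : z * Num.conj z = (Normc.normc z ^+ 2)%:C.
Proof.
rewrite sqr_normc; case: z => a b; apply/eqP; rewrite eq_complex /= eqxx /=.
apply/eqP; ring.
Qed.

Lemma normc_real r : Normc.normc r%:C = `|r|.
Proof. by rewrite /= expr0n addr0 sqrtr_sqr. Qed.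

Lemma Re_le_normc z : complex.Re z <= Normc.normc z.
Proof.
case: z => a b /=; apply: (le_trans (ler_norm a)).
by rewrite -sqrtr_sqr ler_wsqrtr // lerDl sqr_ge0.
Qed.

Lemma Re_abs_le_normc z : `|complex.Re z| <= Normc.normc z.
Proof.
case: z => a b /=; by rewrite -sqrtr_sqr ler_wsqrtr // lerDl sqr_ge0.
Qed.

Lemma Im_abs_le_normc z : `|complex.Im z| <= Normc.normc z.
Proof.
case: z => a b /=; by rewrite -sqrtr_sqr ler_wsqrtr // lerDr sqr_ge0.
Qed.

Lemma ReD x y : complex.Re (x + y) = complex.Re x + complex.Re y.
Proof. by case: x y => [a b] [c d]. Qed.

Lemma ReN x : complex.Re (- x) = - complex.Re x.
Proof. by case: x. Qed.

Lemma ReM_real r x : complex.Re (r%:C * x) = r * complex.Re x.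
Proof. by case: x => a b /=; rewrite mul0r subr0. Qed.

Lemma Re_conj x : complex.Re (Num.conj x) = complex.Re x.
Proof. by case: x. Qed.

Lemma conj_real r : Num.conj r%:C = r%:C.
Proof. exact: conjc_real. Qed.

Lemma conjM x y : Num.conj (x * y) = Num.conj x * Num.conj y.
Proof. exact: rmorphM. Qed.

Lemma conjD x y : Num.conj (x + y) = Num.conj x + Num.conj y.
Proof. exact: rmorphD. Qed.

Lemma ge0_ReE z : 0 <= z -> z = (complex.Re z)%:C.
Proof. by case: z => a b; rewrite lecE /= => /andP[/eqP -> _]. Qed.

Lemma ge0_Re z : 0 <= z -> 0 <= complex.Re z.
Proof. by rewrite lecE => /andP[_]. Qed.

End ComplexNorm.

(* The form may be degenerate and the space incomplete: null vectors are only
   divided out, together with the completion, at the level of operators. *)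
Record prehilbert (R : realType) := PreHilbert {
  ph_space :> lmodType R[i];
  ip : ph_space -> ph_space -> R[i];
  ip_linearr : forall x c y z, ip x (c *: y + z) = c * ip x y + ip x z;
  ip_conj : forall x y, ip y x = Num.conj (ip x y);
  ip_ge0 : forall x, 0 <= ip x x;
  vac : ph_space;
  ip_vac : ip vac vac = 1
}.
Arguments ip {R} {p}.
Arguments vac {R p}.

Section Seminorm.
Variables (R : realType) (E : prehilbert R).
Implicit Types (x y z : E) (c : R[i]).

Lemma ipDr x y z : ip x (y + z) = ip x y + ip x z.
Proof. by rewrite -[y]scale1r ip_linearr mul1r scale1r. Qed.

Lemma ip0r x : ip x 0 = 0.
Proof. by apply: (addrI (ip x 0)); rewrite -ipDr !addr0. Qed.

Lemma ipZr x c y : ip x (c *: y) = c * ip x y.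
Proof. by rewrite -[c *: y]addr0 ip_linearr ip0r addr0. Qed.

Lemma ipNr x y : ip x (- y) = - ip x y.
Proof. by rewrite -scaleN1r ipZr mulN1r. Qed.

Lemma ipDl x y z : ip (y + z) x = ip y x + ip z x.
Proof. by rewrite ip_conj ipDr conjD -!ip_conj. Qed.

Lemma ipZl x c y : ip (c *: y) x = Num.conj c * ip y x.
Proof. by rewrite ip_conj ipZr conjM -!ip_conj. Qed.

Lemma ipNl x y : ip (- y) x = - ip y x.
Proof. by rewrite -scaleN1r ipZl rmorphN rmorph1 mulN1r. Qed.

Definition hn x : R := Num.sqrt (complex.Re (ip x x)).

Lemma hn_ge0 x : 0 <= hn x. Proof. exact: sqrtr_ge0. Qed.

Lemma sqr_hn x : hn x ^+ 2 = complex.Re (ip x x).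
Proof. by rewrite sqr_sqrtr // ge0_Re // ip_ge0. Qed.

Lemma ip_hn x : ip x x = (hn x ^+ 2)%:C.
Proof. by rewrite sqr_hn -ge0_ReE // ip_ge0. Qed.

(** Positivity of the form at [x - t <y,x> y] for all real t. A nonzero vector may have norm zero,
    so [hn y = 0] is a separate case: the quadratic in t degenerates to an affine function bounded
    below. *)
Lemma cauchy_schwarz x y : Normc.normc (ip x y) <= hn x * hn y.
Proof.
rewrite -ler_sqr ?nnegrE ?mulr_ge0 ?hn_ge0 ?normc_ge0 // exprMn.
set n : R := Normc.normc _ ^+ 2.
have key (t : R) : 0 <= hn x ^+ 2 - 2 * t * n + t ^+ 2 * n * hn y ^+ 2.
  have e : ip (x - (t%:C * ip y x) *: y) (x - (t%:C * ip y x) *: y)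
      = (hn x ^+ 2 - 2 * t * n + t ^+ 2 * n * hn y ^+ 2)%:C.
    rewrite ipDr !ipDl ipNr !ipNl ipNr !ipZr !ipZl conjM conj_real -ip_conj.
    transitivity (ip x x - 2%:R * t%:C * (ip x y * ip y x)
       + t%:C * t%:C * (ip x y * ip y x) * ip y y); first by ring.
    rewrite [ip y x]ip_conj mul_conjc -/n !ip_hn.
    by rewrite rmorphD rmorphB !rmorphM rmorph_nat.
  by have := ge0_Re (ip_ge0 (x - (t%:C * ip y x) *: y)); rewrite e.
have n_ge0 : 0 <= n by exact: sqr_ge0.
have := hn_ge0 y; rewrite le_eqVlt => /predU1P[y0|y0].
  move: (key); rewrite -y0 expr0n /= mulr0 => k.
  case: (eqVneq n 0) => [->//|nn0].
  (* For this t the lower bound would read [0 <= -1]. *)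
  have := k ((hn x ^+ 2 + 1) / (2 * n)); rewrite mulr0 addr0.
  have -> : 2 * ((hn x ^+ 2 + 1) / (2 * n)) * n = hn x ^+ 2 + 1.
    by field; rewrite nn0.
  lra.
have := key (hn y ^+ 2)^-1.
have yy : hn y ^+ 2 != 0 by rewrite expf_neq0 // gt_eqF.
have -> : hn x ^+ 2 - 2 * (hn y ^+ 2)^-1 * n + (hn y ^+ 2)^-1 ^+ 2 * n * hn y ^+ 2
  = hn x ^+ 2 - n / hn y ^+ 2 by field; rewrite gt_eqF.
by rewrite subr_ge0 ler_pdivrMr // exprn_gt0.
Qed.

Lemma hnD x y : hn (x + y) <= hn x + hn y.
Proof.
rewrite -ler_sqr ?nnegrE ?addr_ge0 ?hn_ge0 // sqr_hn ipDr !ipDl !ReD.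
have h1 := le_trans (Re_le_normc _) (cauchy_schwarz x y).
have h2 : complex.Re (ip y x) = complex.Re (ip x y) by rewrite ip_conj Re_conj.
rewrite h2 -!sqr_hn sqrrD; lra.
Qed.

Lemma hnZ c x : hn (c *: x) = Normc.normc c * hn x.
Proof.
apply/eqP; rewrite -(@eqrXn2 _ 2) ?mulr_ge0 ?hn_ge0 ?normc_ge0 //.
by rewrite sqr_hn ipZr ipZl mulrA mul_conjc ReM_real exprMn sqr_hn.
Qed.

Lemma hnN x : hn (- x) = hn x.
Proof. by rewrite /hn ipNr ipNl opprK. Qed.

Lemma hn0 : hn 0 = 0. Proof. by rewrite /hn ip0r sqrtr0. Qed.

Lemma hn_vac : hn vac = 1. Proof. by rewrite /hn ip_vac sqrtr1. Qed.

Definition hbounded (f : E -> E) := exists M : R, forall x, hn (f x) <= M * hn x.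

(** Since [hn (g y) ^+ 2] is the form of [f (g y)] and [y], it is at most [M * hn (g y) * hn y];
    then one factor [hn (g y)] is cancelled. *)
Lemma hbounded_adjoint (f g : E -> E) :
  (forall x y, ip (f x) y = ip x (g y)) -> hbounded f -> hbounded g.
Proof.
move=> adj [M hM]; exists M => y.
have h : hn (g y) ^+ 2 <= M * hn y * hn (g y).
  rewrite sqr_hn -adj (le_trans (Re_le_normc _)) //.
  rewrite (le_trans (cauchy_schwarz _ _)) // mulrAC ler_wpM2r ?hn_ge0 //.
have := hn_ge0 (g y); rewrite le_eqVlt => /predU1P[g0|g0].
  (* Testing the bound on the unit vector [vac] shows that M is nonnegative. *)
  rewrite -g0; have := hM vac; rewrite hn_vac mulr1 => M0.
  by rewrite mulr_ge0 ?hn_ge0 // (le_trans (hn_ge0 _) M0).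
by rewrite -(ler_pM2r g0) -expr2.
Qed.

(** The adjoint is stored as data: on an incomplete space with a degenerate form it need neither
    exist nor be unique. Its boundedness follows from that of [opf]. *)
Record op := Op {
  opf : E -> E;
  opg : E -> E;
  opf_lin : forall c x y, opf (c *: x + y) = c *: opf x + opf y;
  opg_lin : forall c x y, opg (c *: x + y) = c *: opg x + opg y;
  op_adj : forall x y, ip (opf x) y = ip x (opg y);
  opf_bdd : hbounded opf
}.

HB.instance Definition _ := gen_eqMixin op.
HB.instance Definition _ := gen_choiceMixin op.

Lemma op_eq (a b : op) : opf a =1 opf b -> opg a =1 opg b -> a = b.
Proof.
case: a b => [f g h1 h2 h3 h4] [f' g' k1 k2 k3 k4] /= /funext e1 /funext e2.
by subst f' g'; congr Op; exact: Prop_irrelevance.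
Qed.

Lemma op_adj2 (a : op) x y : ip (opg a x) y = ip x (opf a y).
Proof. by rewrite ip_conj -op_adj -ip_conj. Qed.

Lemma opg_bdd (a : op) : hbounded (opg a).
Proof. exact: hbounded_adjoint (op_adj a) (opf_bdd a). Qed.

Lemma opfD (a : op) x y : opf a (x + y) = opf a x + opf a y.
Proof. by have := opf_lin a 1 x y; rewrite !scale1r. Qed.

Lemma opf0 (a : op) : opf a 0 = 0.
Proof. by apply: (addrI (opf a 0)); rewrite -opfD !addr0. Qed.

Lemma opfZ (a : op) c x : opf a (c *: x) = c *: opf a x.
Proof. by rewrite -[c *: x]addr0 opf_lin opf0 addr0. Qed.

Definition op_star (a : op) : op :=
  @Op (opg a) (opf a) (opg_lin a) (opf_lin a) (op_adj2 a) (opg_bdd a).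

Lemma opgD (a : op) x y : opg a (x + y) = opg a x + opg a y.
Proof. exact: (opfD (op_star a)). Qed.

Lemma opgZ (a : op) c x : opg a (c *: x) = c *: opg a x.
Proof. exact: (opfZ (op_star a)). Qed.

Definition op_zero : op.
Proof.
refine (@Op (fun=> 0) (fun=> 0) _ _ _ _).
- by move=> * /=; rewrite scaler0 addr0.
- by move=> * /=; rewrite scaler0 addr0.
- by move=> * /=; rewrite ip0r ip_conj ip0r rmorph0.
- by exists 0 => x /=; rewrite hn0 mul0r.
Defined.

Definition op_one : op.
Proof.
refine (@Op id id _ _ _ _) => //.
- by exists 1 => x; rewrite mul1r.
Defined.

Definition op_opp (a : op) : op.
Proof.
refine (@Op (fun x => - opf a x) (fun x => - opg a x) _ _ _ _).
- by move=> * /=; rewrite opf_lin opprD scalerN.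
- by move=> * /=; rewrite opg_lin opprD scalerN.
- by move=> * /=; rewrite ipNl op_adj ipNr.
- by case: (opf_bdd a) => M h; exists M => x; rewrite hnN.
Defined.

Definition op_add (a b : op) : op.
Proof.
refine (@Op (fun x => opf a x + opf b x) (fun x => opg a x + opg b x) _ _ _ _).
- by move=> * /=; rewrite !opf_lin scalerDr addrACA.
- by move=> * /=; rewrite !opg_lin scalerDr addrACA.
- by move=> * /=; rewrite ipDl !op_adj ipDr.
- case: (opf_bdd a) (opf_bdd b) => M h [M' h']; exists (M + M') => x.
by rewrite (le_trans (hnD _ _)) // mulrDl lerD.
Defined.

Definition op_mul (a b : op) : op.
Proof.
refine (@Op (fun x => opf a (opf b x)) (fun x => opg b (opg a x)) _ _ _ _).
- by move=> * /=; rewrite !opf_lin.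
- by move=> * /=; rewrite !opg_lin.
- by move=> * /=; rewrite !op_adj.
- case: (opf_bdd a) (opf_bdd b) => M h [M' h']; exists (`|M| * M') => x.
rewrite (le_trans (h _)) // -mulrA (@le_trans _ _ (`|M| * hn (opf b x))) //.
  by rewrite ler_wpM2r ?hn_ge0 ?ler_norm.
by rewrite ler_wpM2l.
Defined.

Definition op_scale c (a : op) : op.
Proof.
refine (@Op (fun x => c *: opf a x) (fun x => Num.conj c *: opg a x) _ _ _ _).
- by move=> * /=; rewrite opf_lin scalerDr !scalerA mulrC.
- by move=> * /=; rewrite opg_lin scalerDr !scalerA mulrC.
- by move=> * /=; rewrite ipZl op_adj ipZr.
- case: (opf_bdd a) => M h; exists (Normc.normc c * M) => x.
by rewrite hnZ -mulrA ler_wpM2l ?normc_ge0.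
Defined.

Lemma op_addA : associative op_add.
Proof. by move=> a b c; apply: op_eq => x /=; rewrite addrA. Qed.
Lemma op_addC : commutative op_add.
Proof. by move=> a b; apply: op_eq => x /=; rewrite addrC. Qed.
Lemma op_add0 : left_id op_zero op_add.
Proof. by move=> a; apply: op_eq => x /=; rewrite add0r. Qed.
Lemma op_addN : left_inverse op_zero op_opp op_add.
Proof. by move=> a; apply: op_eq => x /=; rewrite addNr. Qed.

HB.instance Definition _ := GRing.isZmodule.Build op op_addA op_addC op_add0 op_addN.

Lemma op_mulA : associative op_mul. Proof. by move=> a b c; apply: op_eq. Qed.
Lemma op_mul1 : left_id op_one op_mul. Proof. by move=> a; apply: op_eq. Qed.
Lemma op_mulr1 : right_id op_one op_mul. Proof. by move=> a; apply: op_eq. Qed.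
Lemma op_mulDl : left_distributive op_mul op_add.
Proof. by move=> a b c; apply: op_eq => x //=; rewrite opgD. Qed.
Lemma op_mulDr : right_distributive op_mul op_add.
Proof. by move=> a b c; apply: op_eq => x //=; rewrite opfD. Qed.
Lemma op_one_neq0 : op_one != op_zero.
Proof.
apply/eqP => /(congr1 (fun a => hn (opf a vac))) /=.
by rewrite hn_vac hn0 => /eqP; rewrite oner_eq0.
Qed.

HB.instance Definition _ := GRing.Zmodule_isNzRing.Build op
  op_mulA op_mul1 op_mulr1 op_mulDl op_mulDr op_one_neq0.

Lemma op_scaleA a b (u : op) : op_scale a (op_scale b u) = op_scale (a * b) u.
Proof. by apply: op_eq => x /=; rewrite ?rmorphM /= scalerA. Qed.
Lemma op_scale1 : left_id 1 op_scale.
Proof. by move=> a; apply: op_eq => x /=; rewrite ?rmorph1 scale1r. Qed.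
Lemma op_scaleDr : right_distributive op_scale +%R.
Proof. by move=> c a b; apply: op_eq => x /=; rewrite scalerDr. Qed.
Lemma op_scaleDl u : {morph op_scale^~ u : a b / a + b}.
Proof. by move=> a b; apply: op_eq => x /=; rewrite ?rmorphD /= scalerDl. Qed.

HB.instance Definition _ := GRing.Zmodule_isLmodule.Build R[i] op
  op_scaleA op_scale1 op_scaleDr op_scaleDl.

Lemma op_scaleAl c (a b : op) : c *: (a * b) = (c *: a) * b.
Proof. by apply: op_eq => x //=; rewrite opgZ. Qed.
HB.instance Definition _ := GRing.Lmodule_isLalgebra.Build R[i] op op_scaleAl.

Lemma op_scaleAr c (a b : op) : c *: (a * b) = a * (c *: b).
Proof. by apply: op_eq => x //=; rewrite opfZ. Qed.
HB.instance Definition _ := GRing.Lalgebra_isAlgebra.Build R[i] op op_scaleAr.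

Lemma op_starK : involutive op_star. Proof. by move=> a; apply: op_eq. Qed.
Lemma op_starD (a b : op) : op_star (a + b) = op_star a + op_star b.
Proof. exact: op_eq. Qed.
Lemma op_starZ c (a : op) : op_star (c *: a) = Num.conj c *: op_star a.
Proof. by apply: op_eq => x //=; rewrite conjCK. Qed.
Lemma op_starM (a b : op) : op_star (a * b) = op_star b * op_star a.
Proof. exact: op_eq. Qed.
Lemma op_starB (a b : op) : op_star (a - b) = op_star a - op_star b.
Proof. exact: op_eq. Qed.
Lemma op_star1 : op_star 1 = 1. Proof. exact: op_eq. Qed.

(** The operator seminorm as a least bound; a supremum of quotients would have to exclude the null
    vectors. *)
Definition nu (a : op) : R :=
  inf [set M | 0 <= M /\ forall x, hn (opf a x) <= M * hn x].

Lemma nu_has_inf (a : op) :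
  has_inf [set M | 0 <= M /\ forall x, hn (opf a x) <= M * hn x].
Proof.
split; last by exists 0 => M [].
case: (opf_bdd a) => M h; exists `|M|; split=> // x.
by rewrite (le_trans (h x)) // ler_wpM2r ?hn_ge0 ?ler_norm.
Qed.

Lemma nu_ge0 a : 0 <= nu a.
Proof. by apply: lb_le_inf; [case: (nu_has_inf a)|move=> M []]. Qed.

Lemma nu_min a M : 0 <= M -> (forall x, hn (opf a x) <= M * hn x) -> nu a <= M.
Proof. by move=> M0 h; apply: ge_inf => //; case: (nu_has_inf a). Qed.

Lemma nu_le a x : hn (opf a x) <= nu a * hn x.
Proof.
have := hn_ge0 x; rewrite le_eqVlt => /predU1P[x0|x0].
  by case: (nu_has_inf a) => -[M [_ /(_ x)]]; rewrite -x0 !mulr0.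
rewrite -ler_pdivrMr //; apply: lb_le_inf; first by case: (nu_has_inf a).
by move=> M [_ h]; rewrite ler_pdivrMr.
Qed.

Lemma nuD a b : nu (a + b) <= nu a + nu b.
Proof.
apply: nu_min => [|x /=]; first by rewrite addr_ge0 ?nu_ge0.
by rewrite (le_trans (hnD _ _)) // mulrDl lerD // nu_le.
Qed.

Lemma nuM a b : nu (a * b) <= nu a * nu b.
Proof.
apply: nu_min => [|x /=]; first by rewrite mulr_ge0 ?nu_ge0.
by rewrite (le_trans (nu_le _ _)) // -mulrA ler_wpM2l ?nu_ge0 // nu_le.
Qed.

Lemma nuZ_le c a : nu (c *: a) <= Normc.normc c * nu a.
Proof.
apply: nu_min => [|x /=]; first by rewrite mulr_ge0 ?nu_ge0 ?normc_ge0.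
by rewrite hnZ -mulrA ler_wpM2l ?normc_ge0 // nu_le.
Qed.

Lemma nu0 : nu 0 = 0.
Proof.
apply/eqP; rewrite eq_le nu_ge0 andbT.
by apply: nu_min => // x /=; rewrite hn0 mul0r.
Qed.

Lemma nuZ c a : nu (c *: a) = Normc.normc c * nu a.
Proof.
have [->|c0] := eqVneq c 0; first by rewrite scale0r Normc.normc0 mul0r nu0.
apply/eqP; rewrite eq_le nuZ_le /=.
have := nuZ_le c^-1 (c *: a); rewrite scalerA mulVf // scale1r Normc.normcV.
rewrite ler_pdivlMl // lt_neqAle normc_ge0 andbT eq_sym.
by apply: contra_neq c0; exact: Normc.eq0_normc.
Qed.

Lemma nuN a : nu (- a) = nu a.
Proof.
rewrite -scaleN1r nuZ.
have -> : -1 = (-1)%:C :> R[i] by rewrite rmorphN rmorph1.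
by rewrite normc_real normrN1 mul1r.
Qed.

Lemma nu_distC a b : nu (a - b) = nu (b - a).
Proof. by rewrite -nuN opprB. Qed.

Lemma nu_dist a b : `|nu a - nu b| <= nu (a - b).
Proof.
rewrite ler_norml; apply/andP; split.
  by rewrite lerNl opprB lerBlDr nu_distC -[X in nu X <= _](subrK a) nuD.
by rewrite lerBlDr -[X in nu X <= _](subrK b) nuD.
Qed.

(** The square of [hn (opf a x)] is the form of [x] and its image under [op_star a * a];
    Cauchy-Schwarz does the rest. *)
Lemma nu_sqr_le a : nu a ^+ 2 <= nu (op_star a * a).
Proof.
have h : nu a <= Num.sqrt (nu (op_star a * a)).
  apply: nu_min => [|x]; first exact: sqrtr_ge0.
  rewrite -ler_sqr ?nnegrE ?mulr_ge0 ?hn_ge0 ?sqrtr_ge0 // exprMn.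
  rewrite (sqr_sqrtr (nu_ge0 _)) sqr_hn op_adj.
  rewrite (le_trans (Re_le_normc _)) // (le_trans (cauchy_schwarz _ _)) //.
  rewrite expr2 mulrA mulrC ler_wpM2r ?hn_ge0 //.
  exact: (nu_le (op_star a * a)).
by rewrite -[X in _ <= X](sqr_sqrtr (nu_ge0 _)) ler_sqr ?nnegrE ?nu_ge0 ?sqrtr_ge0.
Qed.

(** Divide [nu a ^+ 2 <= nu (op_star a) * nu a] by [nu a]. Applied to the adjoint too, this gives
    equality. *)
Lemma nu_star_le a : nu a <= nu (op_star a).
Proof.
have := nu_ge0 a; rewrite le_eqVlt => /predU1P[<-|a0]; first exact: nu_ge0.
by rewrite -(ler_pM2r a0) -expr2 (le_trans (nu_sqr_le a)) // nuM.
Qed.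

Lemma nu_star a : nu (op_star a) = nu a.
Proof.
apply/eqP; rewrite eq_le; apply/andP; split; last exact: nu_star_le.
by have := nu_star_le (op_star a); rewrite op_starK.
Qed.

Lemma nu_cstar a : nu (op_star a * a) = nu a ^+ 2.
Proof.
apply/eqP; rewrite eq_le nu_sqr_le andbT expr2.
by rewrite -[X in _ <= X * _]nu_star nuM.
Qed.

Definition vexp (a : op) : R[i] := ip vac (opf a vac).

Lemma vexp_le a : Normc.normc (vexp a) <= nu a.
Proof.
rewrite (le_trans (cauchy_schwarz _ _)) // hn_vac mul1r.
by rewrite (le_trans (nu_le _ _)) // hn_vac mulr1.
Qed.

Lemma vexp_pos a : 0 <= vexp (op_star a * a).
Proof. by rewrite /vexp /= -op_adj ip_ge0. Qed.

End Seminorm.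

(** * The C*-completion and its vacuum state *)

Section RealCauchy.
Variable R : realType.
Implicit Types (u : nat -> R) (l : R).

Lemma cvg_real_seqP u l : u @ \oo --> l <->
  forall e, 0 < e -> exists n0, forall n, (n0 <= n)%N -> `|u n - l| < e.
Proof.
split=> [/cvgrPdist_lt h e e0|h].
  by case: (h _ e0) => n0 _ h0; exists n0 => n nn; rewrite distrC; exact: h0.
apply/cvgrPdist_lt => e e0; case: (h _ e0) => n0 h0.
by exists n0 => // n nn; rewrite distrC; exact: h0.
Qed.

Lemma cvg_real_seq_unique u l l' : u @ \oo --> l -> u @ \oo --> l' -> l = l'.
Proof.
by move=> h h'; rewrite -(cvg_lim (@Rhausdorff R) h) (cvg_lim (@Rhausdorff R) h').
Qed.

Lemma cvg_real_cauchy u :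
  (forall e, 0 < e -> exists n0, forall m n, (n0 <= m)%N -> (n0 <= n)%N ->
     `|u m - u n| < e) -> u @ \oo --> lim (u @ \oo).
Proof.
move=> h; suff : cvg (u @ \oo) by [].
apply/cauchy_cvgP/cauchy_exP => e e0; case: (h _ e0) => n0 h0.
exists (u n0), n0 => // n nn /=.
by rewrite -ball_normE /=; exact: h0.
Qed.

End RealCauchy.

Section Completion.
Variables (R : realType) (E : prehilbert R).
Local Notation op := (op E).

Definition ocauchy (u : nat -> op) := forall e : R, 0 < e ->
  exists n0, forall m n, (n0 <= m)%N -> (n0 <= n)%N -> nu (u m - u n) < e.

Definition onull (u : nat -> op) := forall e : R, 0 < e ->
  exists n0, forall n, (n0 <= n)%N -> nu (u n) < e.

Record cseq := CSeq { cs :> nat -> op; csP : ocauchy cs }.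

HB.instance Definition _ := gen_eqMixin cseq.
HB.instance Definition _ := gen_choiceMixin cseq.

Lemma onullD (u v : nat -> op) : onull u -> onull v -> onull (fun n => u n + v n).
Proof.
move=> hu hv e e0; have e2 : 0 < e / 2 by rewrite divr_gt0.
case: (hu _ e2) (hv _ e2) => n h [n' h']; exists (maxn n n') => m.
rewrite geq_max => /andP[/h l1 /h' l2].
by rewrite (le_lt_trans (nuD _ _)) // [e]splitr ltrD.
Qed.

Lemma onullN (u : nat -> op) : onull u -> onull (fun n => - u n).
Proof. by move=> h e /h[n0 k]; exists n0 => n /k; rewrite nuN. Qed.

Lemma onull_eq0 (u : nat -> op) : (forall n, u n = 0) -> onull u.
Proof. by move=> u0 e e0; exists 0%N => n _; rewrite u0 nu0. Qed.

Lemma ocauchy_bounded u : ocauchy u -> exists2 M : R, 0 < M & forall n, nu (u n) <= M.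
Proof.
move=> /(_ 1 ltr01)[n0 h].
exists (1 + nu (u n0) + \sum_(i < n0) nu (u i)) => [|n].
  by rewrite ltr_pwDl ?sumr_ge0 ?ltr_pwDl ?nu_ge0 // => i _; exact: nu_ge0.
have [nn|nn] := leqP n0 n.
  rewrite -[u n](subrK (u n0)) (le_trans (nuD _ _)) // ler_wpDr //.
    by rewrite sumr_ge0 // => i _; exact: nu_ge0.
  by rewrite lerD2r ltW // h.
rewrite (bigD1 (Ordinal nn)) //= addrCA ler_wpDr // addr_ge0 ?addr_ge0 ?nu_ge0 //.
by rewrite sumr_ge0 // => i _; exact: nu_ge0.
Qed.

Lemma onullMl (u v : nat -> op) :
  (exists2 M : R, 0 < M & forall n, nu (u n) <= M) ->
  onull v -> onull (fun n => u n * v n).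
Proof.
move=> [M M0 hM] hv e e0; case: (hv (e / M)); first by rewrite divr_gt0.
move=> n0 h; exists n0 => n /h; rewrite ltr_pdivlMr // => k.
rewrite (le_lt_trans (nuM _ _)) // (le_lt_trans _ k) // mulrC.
by rewrite ler_wpM2l ?nu_ge0.
Qed.

Lemma onullMr (u v : nat -> op) :
  (exists2 M : R, 0 < M & forall n, nu (u n) <= M) ->
  onull v -> onull (fun n => v n * u n).
Proof.
move=> [M M0 hM] hv e e0; case: (hv (e / M)); first by rewrite divr_gt0.
move=> n0 h; exists n0 => n /h; rewrite ltr_pdivlMr // => k.
rewrite (le_lt_trans (nuM _ _)) // (le_lt_trans _ k) //.
by rewrite ler_wpM2l ?nu_ge0.
Qed.

Lemma onullZ c (u : nat -> op) : onull u -> onull (fun n => c *: u n).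
Proof.
move=> hu; have -> : (fun n => c *: u n) = (fun n => (c *: (1 : op)) * u n).
  by apply/funext => n; rewrite -scalerAl mul1r.
by apply: onullMl => //; exists (nu (c *: (1 : op)) + 1) => [|_];
  rewrite ?ltr_wpDl ?nu_ge0 // lerDl.
Qed.

Lemma onull_star (u : nat -> op) : onull u -> onull (fun n => op_star (u n)).
Proof. by move=> h e /h[n0 k]; exists n0 => n /k; rewrite nu_star. Qed.

Lemma cauchy_const a : ocauchy (fun=> a).
Proof. by move=> e e0; exists 0%N => m n _ _; rewrite subrr nu0. Qed.

Lemma cauchy_add (u v : cseq) : ocauchy (fun n => u n + v n).
Proof.
move=> e e0; have e2 : 0 < e / 2 by rewrite divr_gt0.
case: (csP u e2) (csP v e2) => n h [n' h']; exists (maxn n n') => p q.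
rewrite !geq_max => /andP[p1 p2] /andP[q1 q2].
rewrite opprD addrACA [e]splitr; apply: (le_lt_trans (nuD _ _)).
by apply: ltrD; [exact: h|exact: h'].
Qed.

Lemma cauchy_opp (u : cseq) : ocauchy (fun n => - u n).
Proof.
by move=> e /(csP u)[n h]; exists n => p q k l; rewrite -opprD nuN h.
Qed.

Lemma cauchy_mul (u v : cseq) : ocauchy (fun n => u n * v n).
Proof.
move=> e e0; case: (ocauchy_bounded (csP u)) (ocauchy_bounded (csP v)) => M M0 hM.
move=> [K K0 hK].
have e1 : 0 < e / 2 / M by rewrite !divr_gt0.
have e2 : 0 < e / 2 / K by rewrite !divr_gt0.
case: (csP v e1) (csP u e2) => n h [n' h']; exists (maxn n n') => p q.
rewrite !geq_max => /andP[p1 p2] /andP[q1 q2].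
have -> : u p * v p - u q * v q = u p * (v p - v q) + (u p - u q) * v q.
  by rewrite mulrBr mulrBl addrA subrK.
rewrite (le_lt_trans (nuD _ _)) // [e]splitr ltrD //.
  rewrite (le_lt_trans (nuM _ _)) //.
  rewrite (@le_lt_trans _ _ (M * nu (v p - v q))) ?ler_wpM2r ?nu_ge0 //.
  by rewrite mulrC -ltr_pdivlMr // h.
rewrite (le_lt_trans (nuM _ _)) //.
rewrite (@le_lt_trans _ _ (nu (u p - u q) * K)) ?ler_wpM2l ?nu_ge0 //.
by rewrite -ltr_pdivlMr // h'.
Qed.

Lemma cauchy_scale c (u : cseq) : ocauchy (fun n => c *: u n).
Proof.
have := cauchy_mul (CSeq (cauchy_const (c *: (1 : op)))) u.
by congr ocauchy; apply/funext => n /=; rewrite -scalerAl mul1r.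
Qed.

Lemma cauchy_star (u : cseq) : ocauchy (fun n => op_star (u n)).
Proof.
by move=> e /(csP u)[n h]; exists n => p q k l; rewrite -op_starB nu_star h.
Qed.

(** Constant sequences of seminorm zero are null, so relations in the model have to be checked only
    up to operators of seminorm zero. *)
Definition ceq (u v : cseq) := `[< onull (fun n => u n - v n) >].

Lemma ceq_equiv : equiv_class_of ceq.
Proof.
split=> [u|u v|v u w].
- by apply/asboolP/onull_eq0 => n; rewrite subrr.
- by apply/asboolP/asboolP => /onullN; congr onull; apply/funext => n; rewrite opprB.
- move=> /asboolP h /asboolP /(onullD h) k; apply/asboolP; move: k.
  by congr onull; apply/funext => n; rewrite addrA subrK.
Qed.

Canonical ceq_rel := EquivRelPack ceq_equiv.

Definition compl := {eq_quot ceq}%qT.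
HB.instance Definition _ := Choice.on compl.
HB.instance Definition _ := EqQuotient.on compl.

Definition qpi (u : cseq) : compl := (\pi_compl u)%qT.

Definition qrep (x : compl) : cseq := repr x.

Lemma qpiP u v : qpi u = qpi v <-> onull (fun n => u n - v n).
Proof.
split=> [/eqquotP /asboolP//|h]; by apply/eqquotP/asboolP.
Qed.

Lemma qpi_surj (x : compl) : exists u, x = qpi u.
Proof. by exists (qrep x); rewrite /qpi reprK. Qed.

Lemma qpi_eq (u v : cseq) : (forall n, u n = v n) -> qpi u = qpi v.
Proof. by move=> h; apply/qpiP/onull_eq0 => n; rewrite h subrr. Qed.

Lemma repr_qpi u : onull (fun n => qrep (qpi u) n - u n).
Proof. by apply/qpiP; rewrite /qpi reprK. Qed.

Definition embed a := qpi (CSeq (cauchy_const a)).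
Definition qadd (x y : compl) := qpi (CSeq (cauchy_add (qrep x) (qrep y))).
Definition qopp (x : compl) := qpi (CSeq (cauchy_opp (qrep x))).
Definition qmul (x y : compl) := qpi (CSeq (cauchy_mul (qrep x) (qrep y))).
Definition qscale c (x : compl) := qpi (CSeq (cauchy_scale c (qrep x))).
Definition qstar (x : compl) := qpi (CSeq (cauchy_star (qrep x))).

Lemma qaddE u v : qadd (qpi u) (qpi v) = qpi (CSeq (cauchy_add u v)).
Proof.
apply/qpiP => /=; have := onullD (repr_qpi u) (repr_qpi v).
by congr onull; apply/funext => n; rewrite opprD addrACA.
Qed.

Lemma qoppE u : qopp (qpi u) = qpi (CSeq (cauchy_opp u)).
Proof.
apply/qpiP => /=; have := onullN (repr_qpi u).
by congr onull; apply/funext => n; rewrite opprD.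
Qed.

Lemma qmulE u v : qmul (qpi u) (qpi v) = qpi (CSeq (cauchy_mul u v)).
Proof.
apply/qpiP => /=.
have := onullD (onullMl (ocauchy_bounded (csP (qrep (qpi u)))) (repr_qpi v))
               (onullMr (ocauchy_bounded (csP v)) (repr_qpi u)).
by congr onull; apply/funext => n; rewrite mulrBr mulrBl addrA subrK.
Qed.

Lemma qscaleE c u : qscale c (qpi u) = qpi (CSeq (cauchy_scale c u)).
Proof.
apply/qpiP => /=; have := onullZ c (repr_qpi u).
by congr onull; apply/funext => n; rewrite scalerBr.
Qed.

Lemma qstarE u : qstar (qpi u) = qpi (CSeq (cauchy_star u)).
Proof.
apply/qpiP => /=; have := onull_star (repr_qpi u).
by congr onull; apply/funext => n; rewrite op_starB.
Qed.

Let qE := (qaddE, qoppE, qmulE, qscaleE, qstarE).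

Lemma qaddA : associative qadd.
Proof.
move=> x y z; have [u ->] := qpi_surj x; have [v ->] := qpi_surj y; have [w ->] := qpi_surj z.
by rewrite !qE; apply: qpi_eq => n /=; rewrite addrA.
Qed.
Lemma qaddC : commutative qadd.
Proof.
move=> x y; have [[u ->] [v ->]] := (qpi_surj x, qpi_surj y).
by rewrite !qE; apply: qpi_eq => n /=; rewrite addrC.
Qed.
Lemma qadd0 : left_id (embed 0) qadd.
Proof.
by move=> x; have [u ->] := qpi_surj x; rewrite !qE; apply: qpi_eq => n /=; rewrite add0r.
Qed.
Lemma qaddN : left_inverse (embed 0) qopp qadd.
Proof.
by move=> x; have [u ->] := qpi_surj x; rewrite !qE; apply: qpi_eq => n /=; rewrite addNr.
Qed.

HB.instance Definition _ := GRing.isZmodule.Build compl qaddA qaddC qadd0 qaddN.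

Lemma qmulA : associative qmul.
Proof.
move=> x y z; have [u ->] := qpi_surj x; have [v ->] := qpi_surj y; have [w ->] := qpi_surj z.
by rewrite !qE; apply: qpi_eq => n /=; rewrite mulrA.
Qed.
Lemma qmul1 : left_id (embed 1) qmul.
Proof.
by move=> x; have [u ->] := qpi_surj x; rewrite !qE; apply: qpi_eq => n /=; rewrite mul1r.
Qed.
Lemma qmulr1 : right_id (embed 1) qmul.
Proof.
by move=> x; have [u ->] := qpi_surj x; rewrite !qE; apply: qpi_eq => n /=; rewrite mulr1.
Qed.
Lemma qmulDl : left_distributive qmul qadd.
Proof.
move=> x y z; have [u ->] := qpi_surj x; have [v ->] := qpi_surj y; have [w ->] := qpi_surj z.
by rewrite !qE; apply: qpi_eq => n /=; rewrite mulrDl.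
Qed.
Lemma qmulDr : right_distributive qmul qadd.
Proof.
move=> x y z; have [u ->] := qpi_surj x; have [v ->] := qpi_surj y; have [w ->] := qpi_surj z.
by rewrite !qE; apply: qpi_eq => n /=; rewrite mulrDr.
Qed.
Lemma qone_neq0 : embed 1 != embed 0.
Proof.
apply/eqP => /qpiP /(_ 1 ltr01)[n /(_ n (leqnn n))] /=; rewrite subr0 ltNge.
by have /= := nu_le (1 : op) (@vac R E); rewrite hn_vac mulr1 => ->.
Qed.

HB.instance Definition _ := GRing.Zmodule_isNzRing.Build compl
  qmulA qmul1 qmulr1 qmulDl qmulDr qone_neq0.

Lemma qscaleA a b u : qscale a (qscale b u) = qscale (a * b) u.
Proof.
by have [v ->] := qpi_surj u; rewrite !qE; apply: qpi_eq => n /=; rewrite scalerA.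
Qed.
Lemma qscale1 : left_id 1 qscale.
Proof.
by move=> x; have [u ->] := qpi_surj x; rewrite !qE; apply: qpi_eq => n /=; rewrite scale1r.
Qed.
Lemma qscaleDr : right_distributive qscale +%R.
Proof.
move=> c x y; have [[u ->] [v ->]] := (qpi_surj x, qpi_surj y).
by rewrite /GRing.add /= !qE; apply: qpi_eq => n /=; rewrite scalerDr.
Qed.
Lemma qscaleDl u : {morph qscale^~ u : a b / a + b}.
Proof.
move=> a b; have [v ->] := qpi_surj u; rewrite {2}/GRing.add /= !qE.
by apply: qpi_eq => n /=; rewrite scalerDl.
Qed.

HB.instance Definition _ := GRing.Zmodule_isLmodule.Build R[i] compl
  qscaleA qscale1 qscaleDr qscaleDl.

Lemma qscaleAl c (a b : compl) : c *: (a * b) = (c *: a) * b.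
Proof.
have [[u ->] [v ->]] := (qpi_surj a, qpi_surj b).
rewrite /GRing.mul /GRing.scale /= !qE.
by apply: qpi_eq => n /=; rewrite scalerAl.
Qed.
HB.instance Definition _ := GRing.Lmodule_isLalgebra.Build R[i] compl qscaleAl.

Lemma qscaleAr c (a b : compl) : c *: (a * b) = a * (c *: b).
Proof.
have [[u ->] [v ->]] := (qpi_surj a, qpi_surj b).
rewrite /GRing.mul /GRing.scale /= !qE.
by apply: qpi_eq => n /=; rewrite scalerAr.
Qed.
HB.instance Definition _ := GRing.Lalgebra_isAlgebra.Build R[i] compl qscaleAr.

Definition qnorm (x : compl) : R := lim ((fun n => nu (qrep x n)) @ \oo).

Lemma nu_cvg (u : cseq) : (fun n => nu (u n)) @ \oo --> lim ((fun n => nu (u n)) @ \oo).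
Proof.
apply: cvg_real_cauchy => e /(csP u)[n h]; exists n => p q k l.
by rewrite (le_lt_trans (nu_dist _ _)) // h.
Qed.

Arguments nu_cvg : clear implicits.

Lemma onull_cvg0 (u : nat -> op) : onull u <-> (fun n => nu (u n)) @ \oo --> (0 : R).
Proof.
split=> [h|/cvg_real_seqP h e /h[n k]].
  apply/cvg_real_seqP => e /h[n k]; exists n => m /k.
  by rewrite subr0 ger0_norm ?nu_ge0.
by exists n => m /k; rewrite subr0 ger0_norm ?nu_ge0.
Qed.

Lemma qnorm_cvg (u : cseq) : (fun n => nu (u n)) @ \oo --> qnorm (qpi u).
Proof.
have /onull_cvg0 h0 := repr_qpi u.
have h1 : (fun n => nu (qrep (qpi u) n)) @ \oo --> qnorm (qpi u).
  exact: (nu_cvg (qrep (qpi u))).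
apply/cvg_real_seqP => e e0; have e2 : 0 < e / 2 by rewrite divr_gt0.
move/cvg_real_seqP: h0 => /(_ _ e2)[n h]; move/cvg_real_seqP: h1 => /(_ _ e2)[n' h'].
exists (maxn n n') => m; rewrite geq_max => /andP[/h k /h' k'].
rewrite subr0 ger0_norm ?nu_ge0 // in k.
rewrite -(subrK (nu (qrep (qpi u) m)) (nu (u m))) -addrA.
rewrite (le_lt_trans (ler_normD _ _)) // [e]splitr ltrD //.
by rewrite distrC (le_lt_trans (nu_dist _ _)).
Qed.

Arguments qnorm_cvg : clear implicits.

Lemma qnormE (u : cseq) l : (fun n => nu (u n)) @ \oo --> l -> qnorm (qpi u) = l.
Proof. by move=> h; apply: (cvg_real_seq_unique (qnorm_cvg u) h). Qed.

Lemma qnorm_embed a : qnorm (embed a) = nu a.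
Proof. by apply: qnormE => /=; apply: cvg_cst. Qed.

Lemma qnorm_le (u : cseq) M : (exists n0, forall n, (n0 <= n)%N -> nu (u n) <= M) ->
  qnorm (qpi u) <= M.
Proof.
move=> [n0 h]; apply: (ler_cvg_to (qnorm_cvg u) (@cvg_cst _ M _ _ _)).
by exists n0.
Qed.

Lemma qnorm0_eq0 a : qnorm a = 0 -> a = 0.
Proof.
have [u ->] := qpi_surj a => h; apply/qpiP/onull_cvg0.
have := qnorm_cvg u; rewrite h.
by under eq_fun do rewrite -[u _]subr0.
Qed.

Lemma qnormD a b : qnorm (a + b) <= qnorm a + qnorm b.
Proof.
have [[u ->] [v ->]] := (qpi_surj a, qpi_surj b).
rewrite {1}/GRing.add /= qaddE.
apply: (ler_cvg_to (qnorm_cvg _) (cvgD (qnorm_cvg u) (qnorm_cvg v))).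
by exists 0%N => // n _; exact: nuD.
Qed.

Lemma qnormZ c a : qnorm (c *: a) = Normc.normc c * qnorm a.
Proof.
have [u ->] := qpi_surj a; rewrite {1}/GRing.scale /= qscaleE; apply: qnormE => /=.
under eq_fun do rewrite nuZ.
by apply: cvgM (qnorm_cvg u); exact: cvg_cst.
Qed.

Lemma qnormM a b : qnorm (a * b) <= qnorm a * qnorm b.
Proof.
have [[u ->] [v ->]] := (qpi_surj a, qpi_surj b).
rewrite {1}/GRing.mul /= qmulE.
apply: (ler_cvg_to (qnorm_cvg _) (cvgM (qnorm_cvg u) (qnorm_cvg v))).
by exists 0%N => // n _; exact: nuM.
Qed.

Lemma qnorm_cstar a : qnorm (qstar a * a) = qnorm a ^+ 2.
Proof.
have [u ->] := qpi_surj a; rewrite {1}/GRing.mul /= qstarE qmulE.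
apply: qnormE => /=; under eq_fun do rewrite nu_cstar expr2.
by rewrite expr2; exact: cvgM (qnorm_cvg u) (qnorm_cvg u).
Qed.

Lemma qstarK : involutive qstar.
Proof.
by move=> a; have [u ->] := qpi_surj a; rewrite !qE; apply: qpi_eq => n; exact: op_starK.
Qed.
Lemma qstarD a b : qstar (a + b) = qstar a + qstar b.
Proof.
have [[u ->] [v ->]] := (qpi_surj a, qpi_surj b).
by rewrite /GRing.add /= !qE; apply: qpi_eq => n; exact: op_starD.
Qed.
Lemma qstarZ c a : qstar (c *: a) = Num.conj c *: qstar a.
Proof.
have [u ->] := qpi_surj a; rewrite /GRing.scale /= !qE.
by apply: qpi_eq => n; exact: op_starZ.
Qed.
Lemma qstarM a b : qstar (a * b) = qstar b * qstar a.
Proof.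
have [[u ->] [v ->]] := (qpi_surj a, qpi_surj b).
by rewrite /GRing.mul /= !qE; apply: qpi_eq => n; exact: op_starM.
Qed.

Lemma embedB a b : embed a - embed b = embed (a - b).
Proof.
by rewrite /embed -[LHS]/(qadd _ (qopp _)) qoppE qaddE; exact: qpi_eq.
Qed.

Lemma qnorm_embed_approx (u : cseq) e : 0 < e -> exists n0, forall m, (n0 <= m)%N ->
  qnorm (qpi u - embed (u m)) <= e.
Proof.
move=> /(csP u)[n0 h]; exists n0 => m nm.
rewrite /embed -[X in qnorm X]/(qadd _ (qopp _)) qoppE qaddE.
by apply: qnorm_le; exists n0 => n nn; exact/ltW/h.
Qed.

Lemma qnormN x : qnorm (- x) = qnorm x.
Proof.
rewrite -scaleN1r qnormZ.
have -> : -1 = (-1)%:C :> R[i] by rewrite rmorphN rmorph1.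
by rewrite normc_real normrN1 mul1r.
Qed.

(** Each term is approximated by a single operator within 1/(n+1). These operators form a Cauchy
    sequence, and its class is the limit. *)
Lemma qnorm_complete (v : nat -> compl) :
  (forall e, 0 < e -> exists n0, forall m n,
     (n0 <= m)%N -> (n0 <= n)%N -> qnorm (v m - v n) < e) ->
  exists l, forall e, 0 < e -> exists n0, forall n,
     (n0 <= n)%N -> qnorm (v n - l) < e.
Proof.
move=> hv.
have app n : exists a, qnorm (v n - embed a) <= n.+1%:R^-1.
  have [u ->] := qpi_surj (v n).
  have /(qnorm_embed_approx u)[n0 h] : 0 < (n.+1%:R : R)^-1 by rewrite invr_gt0.
  by exists (u n0); exact: h.
have [a ha] := choice app.
have inv_small e : 0 < e -> exists n0, forall n, (n0 <= n)%N -> (n.+1%:R : R)^-1 < e.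
  move=> e0; have := @cvg_harmonic R => /cvg_real_seqP /(_ _ e0)[n0 h].
  exists n0 => n /h; rewrite subr0 ger0_norm // /harmonic invr_ge0 //.
have ca : ocauchy a.
  move=> e e0; have e3 : 0 < e / 3 by rewrite divr_gt0.
  case: (inv_small _ e3) (hv _ e3) => n0 h [n1 h']; exists (maxn n0 n1) => p q.
  rewrite !geq_max => /andP[p1 p2] /andP[q1 q2].
  rewrite -qnorm_embed -embedB.
  have -> : embed (a p) - embed (a q)
    = - (v p - embed (a p)) + (v p - v q) + (v q - embed (a q)).
    by rewrite opprB !subrKA.
  have -> : e = e / 3 + e / 3 + e / 3 by field.
  apply: (le_lt_trans (qnormD _ _)); apply: ltrD.
    apply: (le_lt_trans (qnormD _ _)); apply: ltrD; last exact: h'.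
    by rewrite qnormN; exact: le_lt_trans (ha p) (h _ p1).
  exact: le_lt_trans (ha q) (h _ q1).
exists (qpi (CSeq ca)) => e e0; have e2 : 0 < e / 2 by rewrite divr_gt0.
case: (inv_small _ e2) (qnorm_embed_approx (CSeq ca) e2) => n0 h [n1 h'].
exists (maxn n0 n1) => n; rewrite geq_max => /andP[p1 p2].
rewrite -(subrK (embed (a n)) (v n)) -addrA; apply: (le_lt_trans (qnormD _ _)).
rewrite [e]splitr; apply: ltr_leD; first exact: le_lt_trans (ha n) (h _ p1).
by rewrite -qnormN opprB; exact: h'.
Qed.

HB.instance Definition _ := isCStarAlgebra.Build R compl
  qstarK qstarD qstarZ qstarM qnorm0_eq0 qnormD qnormZ qnormM qnorm_cstar
  qnorm_complete.

Lemma embed_zmod : zmod_morphism embed.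
Proof. by move=> a b; rewrite embedB. Qed.
HB.instance Definition _ := GRing.isZmodMorphism.Build op compl embed embed_zmod.

Lemma embed_monoid : monoid_morphism embed.
Proof.
by split=> // a b; rewrite /embed -[RHS]/(qmul _ _) qmulE; apply: qpi_eq.
Qed.
HB.instance Definition _ := GRing.isMonoidMorphism.Build op compl embed embed_monoid.

Lemma embedZ c a : embed (c *: a) = c *: embed a.
Proof. by rewrite /embed -[RHS]/(qscale _ _) qscaleE; apply: qpi_eq. Qed.

Lemma embed_star a : star (embed a) = embed (op_star a).
Proof. by rewrite /star /= /embed !qE; apply: qpi_eq. Qed.

Lemma embed_eq0 a : (forall x, hn (opf a x) = 0) -> embed a = 0.
Proof.
move=> h; apply: qnorm0_eq0; rewrite qnorm_embed; apply/eqP.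
rewrite eq_le nu_ge0 andbT; apply: nu_min => // x; by rewrite h mul0r.
Qed.

Lemma vexpD a b : vexp (a + b : op) = vexp a + vexp b.
Proof. by rewrite /vexp /= ipDr. Qed.
Lemma vexpZ c a : vexp (c *: a : op) = c * vexp a.
Proof. by rewrite /vexp /= ipZr. Qed.
Lemma vexpB a b : vexp (a - b : op) = vexp a - vexp b.
Proof. by rewrite vexpD -scaleN1r vexpZ mulN1r. Qed.

(** The extension of [vexp] by continuity along a chosen representative; [qstate_cvg] removes the
    dependence on that choice. *)
Definition qstate (x : compl) : R[i] :=
  lim ((fun n => complex.Re (vexp (qrep x n))) @ \oo) +i*
  lim ((fun n => complex.Im (vexp (qrep x n))) @ \oo).

Lemma ImD (x y : R[i]) : complex.Im (x + y) = complex.Im x + complex.Im y.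
Proof. by case: x y => [a b] [c d]. Qed.

Lemma ImN (x : R[i]) : complex.Im (- x) = - complex.Im x.
Proof. by case: x. Qed.

Lemma qstate_cvg_repr (u : cseq) :
  (fun n => complex.Re (vexp (u n))) @ \oo
    --> lim ((fun n => complex.Re (vexp (u n))) @ \oo) /\
  (fun n => complex.Im (vexp (u n))) @ \oo
    --> lim ((fun n => complex.Im (vexp (u n))) @ \oo).
Proof.
split; apply: cvg_real_cauchy => e /(csP u)[n h]; exists n => p q k l.
  rewrite -ReN -ReD -vexpB.
  by rewrite (le_lt_trans (Re_abs_le_normc _)) // (le_lt_trans (vexp_le _)) // h.
rewrite -ImN -ImD -vexpB.
by rewrite (le_lt_trans (Im_abs_le_normc _)) // (le_lt_trans (vexp_le _)) // h.
Qed.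

Arguments qstate_cvg_repr : clear implicits.

(** An additive function dominated by the seminorm does not distinguish equivalent sequences. It is
    used for the real and the imaginary part of [vexp]. *)
Lemma cvg_shift_null (f : op -> R) (u v : nat -> op) (l : R) :
  (forall a b, f (a + b) = f a + f b) -> (forall a, `|f a| <= nu a) ->
  onull (fun n => u n - v n) ->
  (fun n => f (u n)) @ \oo --> l -> (fun n => f (v n)) @ \oo --> l.
Proof.
move=> fD fle huv /cvg_real_seqP hu; apply/cvg_real_seqP => e e0.
have e2 : 0 < e / 2 by rewrite divr_gt0.
case: (huv _ e2) (hu _ e2) => n h [n' h']; exists (maxn n n') => m.
rewrite geq_max => /andP[/h k /h' k'].
have -> : f (v m) - l = f (v m - u m) + (f (u m) - l).
  by rewrite addrA -fD subrK.
rewrite (le_lt_trans (ler_normD _ _)) // [e]splitr ltrD //.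
by rewrite (le_lt_trans (fle _)) // nu_distC.
Qed.

Lemma qstate_cvg (u : cseq) :
  (fun n => complex.Re (vexp (u n))) @ \oo --> complex.Re (qstate (qpi u)) /\
  (fun n => complex.Im (vexp (u n))) @ \oo --> complex.Im (qstate (qpi u)).
Proof.
have [h1 h2] := qstate_cvg_repr (qrep (qpi u)).
split.
  apply: (@cvg_shift_null (fun a => complex.Re (vexp a)) _ _ _ _ _ (repr_qpi u) h1).
    by move=> a b; rewrite vexpD ReD.
  by move=> a; exact: le_trans (Re_abs_le_normc _) (vexp_le _).
apply: (@cvg_shift_null (fun a => complex.Im (vexp a)) _ _ _ _ _ (repr_qpi u) h2).
  by move=> a b; rewrite vexpD ImD.
by move=> a; exact: le_trans (Im_abs_le_normc _) (vexp_le _).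
Qed.

Arguments qstate_cvg : clear implicits.

Lemma qstateE (u : cseq) z :
  (fun n => complex.Re (vexp (u n))) @ \oo --> complex.Re z ->
  (fun n => complex.Im (vexp (u n))) @ \oo --> complex.Im z ->
  qstate (qpi u) = z.
Proof.
have [k1 k2] := qstate_cvg u => h1 h2; apply/eqP; rewrite eq_complex.
by rewrite (cvg_real_seq_unique k1 h1) (cvg_real_seq_unique k2 h2) !eqxx.
Qed.

Lemma qstate_embed a : qstate (embed a) = vexp a.
Proof. by apply: qstateE => /=; apply: cvg_cst. Qed.

Lemma qstate_scalar : scalar qstate.
Proof.
move=> c x y; have [[u ->] [v ->]] := (qpi_surj x, qpi_surj y).
rewrite {1}/GRing.add /= {1}/GRing.scale /= !qE.
have [[u1 u2] [v1 v2]] := (qstate_cvg u, qstate_cvg v).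
have cst (r : R) : (fun _ : nat => r) @ \oo --> r by exact: cvg_cst.
apply: qstateE => /=.
  have -> : (fun n => complex.Re (vexp (c *: u n + v n))) = (fun n =>
     complex.Re c * complex.Re (vexp (u n)) - complex.Im c * complex.Im (vexp (u n))
     + complex.Re (vexp (v n))).
    by apply/funext => n; rewrite vexpD vexpZ; case: c (vexp _) (vexp _) => ? ? [? ?] [? ?].
  have -> : complex.Re (c * qstate (qpi u) + qstate (qpi v)) =
     complex.Re c * complex.Re (qstate (qpi u)) - complex.Im c * complex.Im (qstate (qpi u))
     + complex.Re (qstate (qpi v)) by case: c (qstate _) (qstate _) => ? ? [? ?] [? ?].
  exact: cvgD (cvgB (cvgM (cst _) u1) (cvgM (cst _) u2)) v1.
have -> : (fun n => complex.Im (vexp (c *: u n + v n))) = (fun n =>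
     complex.Re c * complex.Im (vexp (u n)) + complex.Im c * complex.Re (vexp (u n))
     + complex.Im (vexp (v n))).
  by apply/funext => n; rewrite vexpD vexpZ; case: c (vexp _) (vexp _) => ? ? [? ?] [? ?].
have -> : complex.Im (c * qstate (qpi u) + qstate (qpi v)) =
     complex.Re c * complex.Im (qstate (qpi u)) + complex.Im c * complex.Re (qstate (qpi u))
     + complex.Im (qstate (qpi v)) by case: c (qstate _) (qstate _) => ? ? [? ?] [? ?].
exact: cvgD (cvgD (cvgM (cst _) u2) (cvgM (cst _) u1)) v2.
Qed.

HB.instance Definition _ := GRing.isLinear.Build R[i] compl R[i] *%R qstate qstate_scalar.

Lemma qstate_is_state : is_state (qstate : {scalar compl}).
Proof.
split=> [|a].
  by rewrite -[LHS]/(qstate (embed 1)) qstate_embed /vexp /= ip_vac.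
have [u ->] := qpi_surj a; rewrite /star /= {1}/GRing.mul /= !qE.
have [h1 h2] := qstate_cvg (CSeq (cauchy_mul (CSeq (cauchy_star u)) u)).
rewrite lecE /=; apply/andP; split.
  apply/eqP; apply: (cvg_real_seq_unique h2) => /=.
  rewrite (_ : (fun _ => _) = fun=> (0 : R)); first exact: cvg_cst.
  by apply/funext => n; have := vexp_pos (u n); rewrite lecE => /andP[/eqP].
apply: (ler_cvg_to (@cvg_cst _ (0 : R) _ _ _) h1).
by exists 0%N => // n _ /=; exact: ge0_Re (vexp_pos _).
Qed.

End Completion.

(** * Jones-Wenzl projections *)

Section Adjoint.
Variable R : realType.
Local Notation K := R[i].

Definition adjm m n (A : 'M[K]_(m, n)) : 'M[K]_(n, m) := (map_mx Num.conj A)^T.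

Lemma adjmE m n (A : 'M[K]_(m, n)) i j : adjm A i j = Num.conj (A j i).
Proof. by rewrite !mxE. Qed.

Lemma adjmK m n (A : 'M[K]_(m, n)) : adjm (adjm A) = A.
Proof. by apply/matrixP => i j; rewrite !adjmE conjCK. Qed.

Lemma adjmM m n p (A : 'M[K]_(m, n)) (B : 'M[K]_(n, p)) :
  adjm (A *m B) = adjm B *m adjm A.
Proof. by rewrite /adjm map_mxM trmx_mul. Qed.

Lemma adjmD m n (A B : 'M[K]_(m, n)) : adjm (A + B) = adjm A + adjm B.
Proof. by apply/matrixP => i j; rewrite !(adjmE, mxE) rmorphD. Qed.

Lemma adjmN m n (A : 'M[K]_(m, n)) : adjm (- A) = - adjm A.
Proof. by apply/matrixP => i j; rewrite !(adjmE, mxE) rmorphN. Qed.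

Lemma adjmB m n (A B : 'M[K]_(m, n)) : adjm (A - B) = adjm A - adjm B.
Proof. by rewrite adjmD adjmN. Qed.

Lemma adjmZ m n c (A : 'M[K]_(m, n)) : adjm (c *: A) = Num.conj c *: adjm A.
Proof. by apply/matrixP => i j; rewrite !(adjmE, mxE) rmorphM. Qed.

Lemma adjmZr m n (r : R) (A : 'M[K]_(m, n)) : adjm (r%:C *: A) = r%:C *: adjm A.
Proof. by rewrite adjmZ conj_real. Qed.

Lemma adjm0 m n : adjm (0 : 'M[K]_(m, n)) = 0.
Proof. by apply/matrixP => i j; rewrite !(adjmE, mxE) rmorph0. Qed.

Lemma adjm1 n : adjm (1%:M : 'M[K]_n) = 1%:M.
Proof. by apply/matrixP => i j; rewrite !(adjmE, mxE) rmorph_nat eq_sym. Qed.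

Lemma adjm_sum m n (I : finType) (F : I -> 'M[K]_(m, n)) :
  adjm (\sum_i F i) = \sum_i adjm (F i).
Proof. by apply: (big_morph (@adjm m n) (@adjmD m n) (@adjm0 m n)). Qed.

Lemma mxtrace_adj n (A : 'M[K]_n) : \tr (adjm A) = Num.conj (\tr A).
Proof. by rewrite rmorph_sum; apply: eq_bigr => i _; rewrite adjmE. Qed.

Definition fro2 m n (A : 'M[K]_(m, n)) : K := \tr (adjm A *m A).

Lemma fro2_ge0 m n (A : 'M[K]_(m, n)) : 0 <= fro2 A.
Proof.
apply: sumr_ge0 => i _; rewrite mxE; apply: sumr_ge0 => j _.
by rewrite adjmE mulrC mul_conjC_ge0.
Qed.

Lemma fro2_adj m n (A : 'M[K]_(m, n)) : fro2 (adjm A) = fro2 A.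
Proof. by rewrite /fro2 adjmK mxtrace_mulC. Qed.

(** Pythagoras: the difference is the squared norm of [(1 - P) A]. *)
Lemma fro2_proj_le m n (P : 'M[K]_m) (A : 'M[K]_(m, n)) :
  adjm P = P -> P *m P = P -> fro2 (P *m A) <= fro2 A.
Proof.
move=> hP iP; rewrite -subr_ge0.
have -> : fro2 A - fro2 (P *m A) = fro2 ((1%:M - P) *m A).
  rewrite /fro2 !adjmM adjmB adjm1 hP -raddfB /=; congr (\tr _).
  rewrite -!mulmxA -mulmxBr; congr (_ *m _).
  by rewrite !mulmxA iP mulmxBl mul1mx mulmxBr mulmx1 iP subrr subr0 mulmxBl mul1mx.
exact: fro2_ge0.
Qed.

Lemma fro2_isom m n p (C : 'M[K]_(p, m)) (A : 'M[K]_(m, n)) :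
  adjm C *m C = 1%:M -> fro2 (C *m A) = fro2 A.
Proof. by move=> h; rewrite /fro2 adjmM mulmxA -(mulmxA _ _ C) h mulmx1. Qed.

End Adjoint.

(** * Tensor powers and the isometries that prepend a letter *)

Section Shift.
Variables (R : realType) (N : nat).
Local Notation K := R[i].

(** The isometry x |-> e_i (x) x. Tensor powers grow by a factor on the left, with [mxvec_index]
    identifying pairs with indices. *)
Definition shift_mx {m} (i : 'I_N) : 'M[K]_(N * m, m) :=
  \matrix_(a, b) (a == mxvec_index i b)%:R.

Lemma mxvec_index_eq m (i i' : 'I_N) (j j' : 'I_m) :
  (mxvec_index i j == mxvec_index i' j') = (i == i') && (j == j').
Proof.
rewrite -xpair_eqE; apply/eqP/eqP => [|[-> ->]//].
by move=> /cast_ord_inj/enum_rank_inj.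
Qed.

Lemma adj_shift_mul m (i j : 'I_N) :
  adjm (shift_mx i) *m shift_mx j = (i == j)%:R *: (1%:M : 'M[K]_m).
Proof.
apply/matrixP => a b; rewrite !mxE (bigD1 (mxvec_index j b)) //= big1 => [|c cn].
  by rewrite adjmE !mxE eqxx mulr1 addr0 rmorph_nat mxvec_index_eq eq_sym;
     case: (i == j); rewrite ?mul1r ?mul0r //= eq_sym.
by rewrite !mxE (negPf cn) mulr0.
Qed.

Lemma adj_shiftK m (i : 'I_N) : adjm (shift_mx i) *m shift_mx i = 1%:M :> 'M[K]_m.
Proof. by rewrite adj_shift_mul eqxx scale1r. Qed.

Lemma sum_shift_adj m : \sum_i shift_mx i *m adjm (shift_mx i) = 1%:M :> 'M[K]_(N * m).
Proof.
apply/matrixP => a b; rewrite summxE.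
case/mxvec_indexP: a => i j; rewrite (bigD1 i) //= big1 => [|k ki].
  rewrite mxE (bigD1 j) //= big1 => [|l lj].
    by rewrite !(mxE, adjmE) eqxx mul1r !addr0 rmorph_nat eq_sym.
  by rewrite !(mxE, adjmE) mxvec_index_eq eqxx /= eq_sym (negPf lj) mul0r.
rewrite mxE big1 // => l _.
by rewrite !(mxE, adjmE) mxvec_index_eq eq_sym (negPf ki) mul0r.
Qed.

Fixpoint tdim n : nat := if n is m.+1 then N * tdim m else 1.

(** The operator 1 (x) M, written through the isometries so that their orthogonality relations carry
    all computations. *)
Definition lift1 m (M : 'M[K]_m) : 'M[K]_(N * m) :=
  \sum_a shift_mx a *m M *m adjm (shift_mx a).

Lemma lift1_shift m (M : 'M[K]_m) i : lift1 M *m shift_mx i = shift_mx i *m M.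
Proof.
rewrite mulmx_suml (bigD1 i) //= big1 => [|j ji].
  by rewrite addr0 -!mulmxA adj_shiftK mulmx1.
by rewrite -!mulmxA adj_shift_mul (negPf ji) scale0r !mulmx0.
Qed.

Lemma adj_lift1 m (M : 'M[K]_m) : adjm (lift1 M) = lift1 (adjm M).
Proof.
by rewrite adjm_sum; apply: eq_bigr => a _; rewrite !adjmM adjmK mulmxA.
Qed.

Lemma adj_shift_lift1 m (M : 'M[K]_m) i :
  adjm (shift_mx i) *m lift1 M = M *m adjm (shift_mx i).
Proof.
by rewrite -[M in LHS]adjmK -adj_lift1 -adjmM lift1_shift adjmM adjmK.
Qed.

Lemma lift1M m (A B : 'M[K]_m) : lift1 (A *m B) = lift1 A *m lift1 B.
Proof.
rewrite {2}/lift1 mulmx_sumr; apply: eq_bigr => a _.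
by rewrite !mulmxA lift1_shift.
Qed.

Lemma lift1_1 m : lift1 (1%:M : 'M[K]_m) = 1%:M.
Proof.
by rewrite -sum_shift_adj; apply: eq_bigr => a _; rewrite mulmx1.
Qed.

End Shift.

Arguments shift_mx {R N m} i.

(** * Wenzl's recursion *)

Section JonesWenzl.
Variables (R : realType) (N : nat) (inv : 'I_N -> 'I_N) (f : 'I_N -> R).
Variable c : nat -> R.
Local Notation K := R[i].
Local Notation d := (tdim N).
Local Notation C := (@shift_mx R N _).

Hypothesis invK : involutive inv.
Hypothesis f_gt0 : forall i, 0 < f i.
Hypothesis f_inv : forall i, f (inv i) = (f i)^-1.

Let normF : R := \sum_i (f i) ^+ 2.
Hypothesis c0 : c 0 = 0.
Hypothesis cS : forall n, c n.+1 * (normF - c n) = 1.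

(* The invariant vector of U (x) U, acting as x |-> cup (x) x. *)
Definition cup m : 'M[K]_(N * (N * m), m) := \sum_a ((f a)^-1)%:C *: (C a *m C (inv a)).

(* Wenzl's recursion; [c] is the sequence of quotients of consecutive quantum
   integers. *)
Definition jw_step n : 'M[K]_(d n.+1) -> 'M[K]_(d n.+1) :=
  match n with
  | 0 => id
  | m.+1 => fun Q => Q - (c m.+1)%:C *: ((Q *m cup (d m)) *m adjm (Q *m cup (d m)))
  end.

Fixpoint jw n : 'M[K]_(d n) :=
  match n with
  | 0 => 1%:M
  | m.+1 => jw_step (lift1 N (jw m))
  end.

Lemma jw1 : jw 1 = 1%:M.
Proof. by rewrite /= lift1_1. Qed.

(** The cup on the first two strands, compressed by 1 (x) P_(m+1). Multiplied by the square root of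
    [c m.+1] it is a partial isometry with initial projection P_m, and Wenzl's recursion removes its
    range projection. *)
Let Y m := lift1 N (jw m.+1) *m cup (d m).

Lemma jwSS m : jw m.+2 = lift1 N (jw m.+1) - (c m.+1)%:C *: (Y m *m adjm (Y m)).
Proof. by []. Qed.

Lemma jw_adj n : adjm (jw n) = jw n.
Proof.
elim: n => [|[|m] IH]; [exact: adjm1|by rewrite jw1 adjm1|].
by rewrite jwSS adjmB adjmZr adjmM adjmK adj_lift1 IH.
Qed.

Lemma adj_shift_cup m a : adjm (C a) *m cup m = ((f a)^-1)%:C *: C (inv a).
Proof.
rewrite mulmx_sumr (bigD1 a) //= big1 => [|b ba].
  by rewrite addr0 -scalemxAr mulmxA adj_shiftK mul1mx.
by rewrite -scalemxAr mulmxA adj_shift_mul eq_sym (negPf ba) scale0r mul0mx scaler0.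
Qed.

Lemma adj_cup m : adjm (cup m)
  = \sum_a ((f a)^-1)%:C *: (adjm (C (inv a)) *m adjm (C a)).
Proof. by rewrite adjm_sum; apply: eq_bigr => a _; rewrite adjmZr adjmM. Qed.

(** An operator on the strands to the right of the cup slides past it. *)
Lemma lift1_cup m (M : 'M[K]_m) :
  lift1 N (lift1 N M) *m cup m = cup m *m M.
Proof.
rewrite mulmx_sumr mulmx_suml; apply: eq_bigr => a _.
by rewrite -scalemxAr -scalemxAl mulmxA lift1_shift -!mulmxA lift1_shift.
Qed.

Lemma adj_shift_Y m a : adjm (C a) *m Y m = ((f a)^-1)%:C *: (jw m.+1 *m C (inv a)).
Proof. by rewrite mulmxA adj_shift_lift1 -mulmxA adj_shift_cup scalemxAr. Qed.

Lemma adj_Y_shift m a : adjm (Y m) *m C a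
  = ((f a)^-1)%:C *: (adjm (C (inv a)) *m jw m.+1).
Proof.
by rewrite -[C a]adjmK -adjmM adj_shift_Y adjmZr adjmM jw_adj.
Qed.

Lemma real_complexM (x y : R) : (x * y)%:C = x%:C * y%:C :> K.
Proof. exact: rmorphM. Qed.

Lemma real_complexB (x y : R) : (x - y)%:C = x%:C - y%:C :> K.
Proof. exact: rmorphB. Qed.

Lemma sum_ptrace m (M : 'M[K]_(N * m)) :
  adjm (cup m) *m lift1 N M *m cup m
  = \sum_a ((f a)^-2)%:C *: (adjm (C (inv a)) *m M *m C (inv a)).
Proof.
rewrite adj_cup mulmx_suml mulmx_suml; apply: eq_bigr => a _.
rewrite -!scalemxAl -!mulmxA (mulmxA _ (lift1 N M)) adj_shift_lift1.
rewrite -mulmxA adj_shift_cup -!scalemxAr scalerA -real_complexM.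
by rewrite -invfM -expr2 !mulmxA.
Qed.

Lemma sum_f_inv : \sum_a (f a)^-2 = normF.
Proof.
rewrite (reindex_inj (inv_inj invK)); apply: eq_bigr => a _.
by rewrite f_inv exprVn invrK.
Qed.

(* Closing the first strand with a cup and a cap. *)
Lemma ptrace_of_idem m : jw m *m jw m = jw m ->
  \sum_a ((f a)^-2)%:C *: (adjm (C (inv a)) *m jw m.+1 *m C (inv a))
  = (normF - c m)%:C *: jw m.
Proof.
case: m => [|m] idem.
  rewrite c0 subr0 jw1 -sum_f_inv rmorph_sum scaler_suml.
  by apply: eq_bigr => a _; rewrite mulmx1 adj_shiftK.
under eq_bigr => a _.
  rewrite jwSS mulmxBr mulmxBl adj_shift_lift1 -(mulmxA _ (adjm _)) adj_shiftK mulmx1.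
  rewrite -scalemxAr -scalemxAl mulmxA adj_shift_Y -mulmxA adj_Y_shift invK f_inv invrK.
  rewrite -scalemxAl -scalemxAr scalerA -!mulmxA scalerBr scalerA scalerA mulrC -real_complexM.
  rewrite -!real_complexM.
  have -> : f a * (f a ^- 2 * (c m.+1 * f a)) = c m.+1.
    by field; rewrite gt_eqF.
  over.
rewrite sumrB -scaler_suml -rmorph_sum sum_f_inv real_complexB scalerBl; congr (_ - _).
rewrite -scaler_sumr; congr (_ *: _).
rewrite -mulmx_sumr -[RHS]idem; congr (_ *m _).
under eq_bigr do rewrite mulmxA.
by rewrite -mulmx_suml sum_shift_adj mul1mx.
Qed.

(** The three claims need one another: idempotency of P_m evaluates the closed strand, absorption
    gives [Y m] P_m = [Y m], and together they make c Y Y^* a projection below 1 (x) P_(m+1). The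
    difference P_(m+2) is then a projection orthogonal to [Y m]. *)
Lemma jw_idem_absorb n :
  (jw n *m jw n = jw n) * (jw n.+1 *m jw n.+1 = jw n.+1)
  * (jw n.+1 *m lift1 N (jw n) = jw n.+1).
Proof.
elim: n => [|m [[IH0 IH1] IH2]].
  by rewrite jw1 (_ : jw 0 = 1%:M) // lift1_1 !mulmx1.
have TT : lift1 N (jw m.+1) *m lift1 N (jw m.+1) = lift1 N (jw m.+1).
  by rewrite -lift1M IH1.
have TY : lift1 N (jw m.+1) *m Y m = Y m by rewrite mulmxA TT.
have YT : adjm (Y m) *m lift1 N (jw m.+1) = adjm (Y m).
  by rewrite -[lift1 _ _]adjmK -adjmM adj_lift1 jw_adj TY.
have YP : Y m *m jw m = Y m.
  by rewrite -mulmxA -lift1_cup mulmxA -lift1M IH2.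
have YY : (c m.+1)%:C *: (adjm (Y m) *m Y m) = jw m.
  have -> : adjm (Y m) *m Y m = adjm (cup (d m)) *m lift1 N (jw m.+1) *m cup (d m).
    by rewrite adjmM adj_lift1 jw_adj -mulmxA TY mulmxA.
  (* The recursion for [c] is what normalizes the closed strand to [jw m]. *)
  rewrite sum_ptrace ptrace_of_idem // scalerA -real_complexM cS.
  by rewrite scale1r.
have J2 : jw m.+2 *m lift1 N (jw m.+1) = jw m.+2.
  by rewrite jwSS mulmxBl TT -scalemxAl -mulmxA YT.
have ZY : jw m.+2 *m Y m = 0.
  by rewrite jwSS mulmxBl TY -scalemxAl -mulmxA scalemxAr YY YP subrr.
do 2?split => //.
by rewrite {2}jwSS mulmxBr J2 -scalemxAr mulmxA ZY mul0mx scaler0 subr0.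
Qed.

Lemma jw_idem n : jw n *m jw n = jw n.
Proof. by rewrite jw_idem_absorb. Qed.

Lemma jw_absorb n : jw n.+1 *m lift1 N (jw n) = jw n.+1.
Proof. by rewrite jw_idem_absorb. Qed.

Lemma lift1_jw n : lift1 N (jw n) *m jw n.+1 = jw n.+1.
Proof. by rewrite -[jw n.+1]jw_adj -[X in adjm X]jw_absorb adjmM adj_lift1 !jw_adj mulmxA -lift1M jw_idem. Qed.

(** The range of P_(n+1) lies in H (x) range(P_n), so removing its first letter leads into the range
    of P_n. This makes annihilation the adjoint of creation for the compressed forms. *)
Lemma jw_shift_absorb n i : jw n *m (adjm (C i) *m jw n.+1) = adjm (C i) *m jw n.+1.
Proof.
by rewrite -lift1_jw (mulmxA (adjm (C i))) adj_shift_lift1 !mulmxA jw_idem.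
Qed.

(** P_(m+2) lies below 1 (x) P_(m+1), so the cup may be replaced by [Y m], and P_(m+2) Y = Y - Y P_m
    = 0. This kills the part of the defining relations with two creations and, by adjunction, the
    one with two annihilations. *)
Lemma jw_cup m : jw m.+2 *m cup (d m) = 0.
Proof.
have -> : jw m.+2 *m cup (d m) = jw m.+2 *m Y m by rewrite mulmxA jw_absorb.
have TY : lift1 N (jw m.+1) *m Y m = Y m by rewrite mulmxA -lift1M jw_idem.
have YP : Y m *m jw m = Y m.
  by rewrite -mulmxA -lift1_cup mulmxA -lift1M jw_absorb.
have YY : (c m.+1)%:C *: (adjm (Y m) *m Y m) = jw m.
  have -> : adjm (Y m) *m Y m = adjm (cup (d m)) *m lift1 N (jw m.+1) *m cup (d m).
    by rewrite adjmM adj_lift1 jw_adj -mulmxA TY mulmxA.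
  by rewrite sum_ptrace ptrace_of_idem ?jw_idem // scalerA -real_complexM cS scale1r.
by rewrite jwSS mulmxBl TY -scalemxAl -mulmxA scalemxAr YY YP subrr.
Qed.

Lemma ptrace_jw m :
  \sum_a ((f a)^-2)%:C *: (adjm (C (inv a)) *m jw m.+1 *m C (inv a))
  = (normF - c m)%:C *: jw m.
Proof. by rewrite ptrace_of_idem ?jw_idem. Qed.

(** Wenzl's recursion read block by block in the first letter. The subtracted term will cancel the
    products of a creation after an annihilation in the unitarity relations. The filler block at m =
    0 has coefficient [c 0 = 0]. *)
Lemma shift_jw_shift m i j :
  adjm (C i) *m jw m.+1 *m C j = (i == j)%:R *: jw m
  - (c m * (f i)^-1 * (f j)^-1)%:C *:
    (jw m *m (match m return 'M[K]_(d m) with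
      0 => 0 | p.+1 => C (inv i) *m adjm (C (inv j)) end) *m jw m).
Proof.
case: m => [|m].
  by rewrite jw1 c0 !mul0r scale0r subr0 mulmx1 adj_shift_mul.
rewrite jwSS mulmxBr mulmxBl adj_shift_lift1 -(mulmxA _ (adjm _)) adj_shift_mul.
rewrite -scalemxAr mulmx1; congr (_ - _).
rewrite -scalemxAr -scalemxAl mulmxA adj_shift_Y -(mulmxA _ (adjm (Y m))) adj_Y_shift.
rewrite -scalemxAl -scalemxAr !scalerA -!real_complexM ?mulrA.
by congr (_ *: _); rewrite !mulmxA.
Qed.

End JonesWenzl.

(** * Weighted two-sided Fock spaces *)

Section GradedVectors.
Variables (R : realType) (N : nat).
Local Notation K := R[i].
Local Notation d := (tdim N).

(* A vector of level n lies in H^(x)n (x) H^(x)n and is stored as a matrix: rows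
   carry the left leg and columns the right leg, so that operators on the two
   legs are multiplications on the two sides. *)
Record gvec := GVec {
  gv :> forall n, 'M[K]_(d n);
  gv_fin : exists M, forall n, (M <= n)%N -> gv n = 0
}.

HB.instance Definition _ := gen_eqMixin gvec.
HB.instance Definition _ := gen_choiceMixin gvec.

Lemma gvec_eq (x y : gvec) : (forall n, x n = y n) -> x = y.
Proof.
case: x y => [x hx] [y hy] /= h.
have e : x = y by apply: functional_extensionality_dep.
by subst y; congr GVec; exact: Prop_irrelevance.
Qed.

Lemma gvec0_fin : exists M, forall n, (M <= n)%N -> (0 : 'M[K]_(d n)) = 0.
Proof. by exists 0%N. Qed.

Lemma gvecD_fin (x y : gvec) : exists M, forall n, (M <= n)%N -> x n + y n = 0.
Proof.
have [[M h] [M' h']] := (gv_fin x, gv_fin y); exists (maxn M M') => n.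
by rewrite geq_max => /andP[/h -> /h' ->]; rewrite addr0.
Qed.

Lemma gvecZ_fin a (x : gvec) : exists M, forall n, (M <= n)%N -> a *: x n = 0.
Proof. by have [M h] := gv_fin x; exists M => n /h ->; rewrite scaler0. Qed.

Lemma gvecN_fin (x : gvec) : exists M, forall n, (M <= n)%N -> - x n = 0.
Proof. by have [M h] := gv_fin x; exists M => n /h ->; rewrite oppr0. Qed.

Definition gvec0 := @GVec (fun=> 0) gvec0_fin.
Definition gvecD x y := GVec (gvecD_fin x y).
Definition gvecN x := GVec (gvecN_fin x).
Definition gvecZ a x := GVec (gvecZ_fin a x).

Lemma gvecDA : associative gvecD.
Proof. by move=> x y z; apply: gvec_eq => n /=; rewrite addrA. Qed.
Lemma gvecDC : commutative gvecD.
Proof. by move=> x y; apply: gvec_eq => n /=; rewrite addrC. Qed.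
Lemma gvec0D : left_id gvec0 gvecD.
Proof. by move=> x; apply: gvec_eq => n /=; rewrite add0r. Qed.
Lemma gvecND : left_inverse gvec0 gvecN gvecD.
Proof. by move=> x; apply: gvec_eq => n /=; rewrite addNr. Qed.
HB.instance Definition _ := GRing.isZmodule.Build gvec gvecDA gvecDC gvec0D gvecND.

Lemma gvecZA a b x : gvecZ a (gvecZ b x) = gvecZ (a * b) x.
Proof. by apply: gvec_eq => n /=; rewrite scalerA. Qed.
Lemma gvecZ1 : left_id 1 gvecZ.
Proof. by move=> x; apply: gvec_eq => n /=; rewrite scale1r. Qed.
Lemma gvecZDr : right_distributive gvecZ +%R.
Proof. by move=> a x y; apply: gvec_eq => n /=; rewrite scalerDr. Qed.
Lemma gvecZDl x : {morph gvecZ^~ x : a b / a + b}.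
Proof. by move=> a b; apply: gvec_eq => n /=; rewrite scalerDl. Qed.
HB.instance Definition _ := GRing.Zmodule_isLmodule.Build K gvec
  gvecZA gvecZ1 gvecZDr gvecZDl.

Lemma gvDE (x y : gvec) n : (x + y) n = x n + y n. Proof. by []. Qed.
Lemma gvZE a (x : gvec) n : (a *: x) n = a *: x n. Proof. by []. Qed.
Lemma gv0E n : (0 : gvec) n = 0. Proof. by []. Qed.

Lemma gv_sumE (I : Type) (r : seq I) (F : I -> gvec) n :
  (\sum_(i <- r) F i) n = \sum_(i <- r) F i n.
Proof. by elim: r => [|i r IH]; rewrite ?big_nil ?gv0E // !big_cons gvDE IH. Qed.

Definition raise_seq (A : forall n, 'M[K]_(d n.+1, d n)) (B : forall n, 'M[K]_(d n, d n.+1))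
    (x : gvec) n : 'M[K]_(d n) :=
  if n is m.+1 then A m *m x m *m B m else 0.

Lemma raise_fin A B (x : gvec) :
  exists M, forall n, (M <= n)%N -> raise_seq A B x n = 0.
Proof.
have [M h] := gv_fin x; exists M.+1 => -[//|n] nM /=.
by rewrite h // mulmx0 mul0mx.
Qed.

Definition lower_seq (A : forall n, 'M[K]_(d n, d n.+1)) (B : forall n, 'M[K]_(d n.+1, d n))
    (x : gvec) n : 'M[K]_(d n) := A n *m x n.+1 *m B n.

Lemma lower_fin A B (x : gvec) :
  exists M, forall n, (M <= n)%N -> lower_seq A B x n = 0.
Proof.
have [M h] := gv_fin x; exists M => n nM.
by rewrite /lower_seq h ?mulmx0 ?mul0mx // leqW.
Qed.

Definition raise A B x := GVec (raise_fin A B x).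
Definition lower A B x := GVec (lower_fin A B x).

Lemma raise_lin A B a x y : raise A B (a *: x + y) = a *: raise A B x + raise A B y.
Proof.
apply: gvec_eq => -[|n]; rewrite gvDE gvZE /= ?scaler0 ?addr0 //.
by rewrite mulmxDr mulmxDl -scalemxAr -scalemxAl.
Qed.

Lemma lower_lin A B a x y : lower A B (a *: x + y) = a *: lower A B x + lower A B y.
Proof.
apply: gvec_eq => n; rewrite gvDE gvZE /= /lower_seq gvDE gvZE.
by rewrite mulmxDr mulmxDl -scalemxAr -scalemxAl.
Qed.

Definition gvac_seq n : 'M[K]_(d n) := if n is 0 then 1%:M else 0.

Lemma gvac_fin : exists M, forall n, (M <= n)%N -> gvac_seq n = 0.
Proof. by exists 1%N => -[|n]. Qed.

Definition gvac := GVec gvac_fin.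

End GradedVectors.

Section WeightedFock.
Variables (R : realType) (N : nat).
Local Notation K := R[i].
Local Notation d := (tdim N).
Local Notation C := (@shift_mx R N _).

(* Level n carries the form w_n <x, (P_n (x) P_n) y>.  Two instances are used:
   Jones-Wenzl projections give the L2-space of the quantum group, and P = 1,
   c = 1 gives the full Fock space over H (x) H. *)
Record fock_data := FockData {
  fdP : forall n, 'M[K]_(d n);
  fdw : nat -> R;
  fdc : nat -> R;
  fdP_adj : forall n, adjm (fdP n) = fdP n;
  fdP_idem : forall n, fdP n *m fdP n = fdP n;
  fdP0 : fdP 0 = 1%:M;
  fdP_shift : forall n i, fdP n *m (adjm (C i) *m fdP n.+1) = adjm (C i) *m fdP n.+1;
  fdw0 : fdw 0 = 1;
  fdwS : forall n, fdw n.+1 = fdc n.+1 * fdw n;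
  fdc_gt0 : forall n, 0 < fdc n.+1;
  fdc_le1 : forall n, fdc n.+1 <= 1
}.

Variable W : fock_data.
Local Notation P := (fdP W).
Local Notation w := (fdw W).
Local Notation c := (fdc W).
Local Notation gvec := (gvec R N).

Lemma fdw_gt0 n : 0 < w n.
Proof. by elim: n => [|n IH]; rewrite ?fdw0 // fdwS mulr_gt0 ?fdc_gt0. Qed.

Lemma P_shiftl n i : P n *m adjm (C i) *m P n.+1 = adjm (C i) *m P n.+1.
Proof. by rewrite -mulmxA fdP_shift. Qed.

Lemma P_shiftr n i : P n.+1 *m C i *m P n = P n.+1 *m C i.
Proof.
rewrite -[P n.+1]fdP_adj -[P n]fdP_adj -[C i]adjmK -!adjmM.
by rewrite fdP_shift.
Qed.

Definition gbound (x : gvec) : nat := projT1 (cid (gv_fin x)).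

Lemma gboundP (x : gvec) n : (gbound x <= n)%N -> x n = 0.
Proof. by move=> h; exact: (projT2 (cid (gv_fin x))). Qed.

Definition lip n (x y : 'M[K]_(d n)) : K := (w n)%:C * \tr (adjm x *m P n *m y *m P n).

(** The cutoff depends on [y] alone; by [gipE] any cutoff beyond which the level forms vanish gives
    the same value. *)
Definition gip (x y : gvec) : K := \sum_(n < gbound y) lip (x n) (y n).

Lemma gipE M (x y : gvec) : (forall n, (M <= n)%N -> lip (x n) (y n) = 0) ->
  gip x y = \sum_(n < M) lip (x n) (y n).
Proof.
have key A B : (A <= B)%N -> (forall n, (A <= n)%N -> lip (x n) (y n) = 0) ->
  \sum_(n < A) lip (x n) (y n) = \sum_(n < B) lip (x n) (y n).
  move=> AB h; rewrite -!(big_mkord xpredT (fun n => lip (x n) (y n))).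
  rewrite [RHS](big_cat_nat _ AB) //= [X in _ + X]big1_seq ?addr0 // => n.
  by rewrite mem_index_iota => /andP[_ /andP[/h]].
have hy n : (gbound y <= n)%N -> lip (x n) (y n) = 0.
  by move=> /gboundP ->; rewrite /lip mulmx0 mul0mx raddf0 mulr0.
move=> h; rewrite /gip; have [l|/ltnW l] := leqP (gbound y) M; first exact: key.
by rewrite -(key M).
Qed.

Lemma lip_linearr n (x : 'M[K]_(d n)) a y z :
  lip x (a *: y + z) = a * lip x y + lip x z.
Proof.
rewrite /lip mulmxDr mulmxDl mxtraceD mulrDr; congr (_ + _).
by rewrite -scalemxAr -scalemxAl mxtraceZ mulrCA.
Qed.

Lemma lip_conj n (x y : 'M[K]_(d n)) : lip y x = Num.conj (lip x y).
Proof.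
rewrite /lip conjM conj_real -mxtrace_adj !adjmM adjmK !fdP_adj; congr (_ * _).
by rewrite [LHS]mxtrace_mulC !mulmxA.
Qed.

Lemma lip_fro n (x : 'M[K]_(d n)) : lip x x = (w n)%:C * fro2 (P n *m x *m P n).
Proof.
rewrite /lip /fro2 !adjmM !fdP_adj; congr (_ * _).
rewrite !mulmxA -(mulmxA _ (P n) (P n)) fdP_idem.
by rewrite [RHS]mxtrace_mulC !mulmxA fdP_idem [LHS]mxtrace_mulC !mulmxA.
Qed.

Lemma lip_ge0 n (x : 'M[K]_(d n)) : 0 <= lip x x.
Proof. by rewrite lip_fro mulr_ge0 ?fro2_ge0 // ler0c ltW ?fdw_gt0. Qed.

Lemma gip_bound (x y z : gvec) : exists M, forall n, (M <= n)%N ->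
  [/\ x n = 0, y n = 0 & z n = 0].
Proof.
exists (maxn (gbound x) (maxn (gbound y) (gbound z))) => n.
by rewrite !geq_max => /and3P[/gboundP -> /gboundP -> /gboundP ->].
Qed.

Lemma lipr0 n (x : 'M[K]_(d n)) : lip x 0 = 0.
Proof. by rewrite /lip mulmx0 mul0mx raddf0 mulr0. Qed.

Lemma gip_linearr x a y z : gip x (a *: y + z) = a * gip x y + gip x z.
Proof.
have [M h] := gip_bound y z z.
rewrite !(@gipE M); try by move=> n /h[e1 e2 _]; rewrite ?gvDE ?gvZE ?e1 ?e2 ?scaler0 ?addr0 lipr0.
by rewrite mulr_sumr -big_split; apply: eq_bigr => n _; rewrite lip_linearr.
Qed.

Lemma gip_conj x y : gip y x = Num.conj (gip x y).
Proof.
have [M h] := gip_bound x y y.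
rewrite !(@gipE M); try by move=> n /h[e1 e2 _]; rewrite ?e1 ?e2 lipr0.
by rewrite rmorph_sum; apply: eq_bigr => n _; rewrite lip_conj.
Qed.

Lemma gip_ge0 x : 0 <= gip x x.
Proof. by apply: sumr_ge0 => n _; exact: lip_ge0. Qed.

Lemma gip_vac (x : gvec) : gip (gvac R N) x = \tr (x 0).
Proof.
rewrite (@gipE 1) => [|[//|n] _].
  by rewrite big_ord1 /lip /= fdw0 mul1r fdP0 adjm1 !mulmx1 mul1mx.
by rewrite /lip /= adjm0 !mul0mx raddf0 mulr0.
Qed.

Lemma gip_vac_vac : gip (gvac R N) (gvac R N) = 1.
Proof. by rewrite gip_vac mxtrace1. Qed.

Definition weighted_fock : prehilbert R :=
  PreHilbert gip_linearr gip_conj gip_ge0 gip_vac_vac.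

Definition create i j : gvec -> gvec :=
  raise (fun n => C i) (fun n => adjm (C j)).

(** The factor [c n.+1] is the quotient of the weights of levels n+1 and n, and the projections come
    from the form on level n+1. *)
Definition annihilate i j : gvec -> gvec :=
  lower (fun n => (c n.+1)%:C *: (adjm (C i) *m P n.+1)) (fun n => P n.+1 *m C j).

Lemma create_adj i j (x y : weighted_fock) :
  ip (create i j x : weighted_fock) y = ip x (annihilate i j y : weighted_fock).
Proof.
rewrite /= (@gipE (gbound y).+1) => [|n nM]; last first.
  by rewrite (@gboundP y) ?lipr0 // ltnW.
rewrite (@gipE (gbound y)) => [|n nM]; last first.
  by rewrite /= /lower_seq (@gboundP y) ?(leqW nM) // mulmx0 mul0mx lipr0.
rewrite big_ord_recl {1}/lip /= adjm0 !mul0mx raddf0 mulr0 add0r.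
apply: eq_bigr => n _; rewrite /lip /= /lower_seq fdwS real_complexM.
have -> : adjm (x n) *m P n *m
    ((c n.+1)%:C *: (adjm (C i) *m P n.+1) *m y n.+1 *m (P n.+1 *m C j)) *m P n
  = (c n.+1)%:C *: (adjm (x n) *m (adjm (C i) *m P n.+1 *m y n.+1 *m P n.+1 *m C j)).
  rewrite -!scalemxAl -scalemxAr -scalemxAl; congr (_ *: _).
  rewrite -(mulmxA (adjm (x n))) -(mulmxA (adjm (x n))); congr (_ *m _).
  by rewrite !mulmxA P_shiftl -!mulmxA (mulmxA _ _ (P n)) P_shiftr.
rewrite mxtraceZ mulrA [(w n)%:C * _]mulrC; congr (_ * _).
by rewrite !adjmM adjmK -!mulmxA mxtrace_mulC -!mulmxA.
Qed.

Lemma fro2_compress_le m (Q A : 'M[K]_m) :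
  adjm Q = Q -> Q *m Q = Q -> fro2 (Q *m A *m Q) <= fro2 A.
Proof.
move=> hQ iQ; rewrite -mulmxA (le_trans (fro2_proj_le _ hQ iQ)) //.
by rewrite -fro2_adj adjmM hQ (le_trans (fro2_proj_le _ hQ iQ)) // fro2_adj.
Qed.

Lemma fro2_shift m (A : 'M[K]_m) i j :
  fro2 (C i *m A *m adjm (C j)) = fro2 A.
Proof.
by rewrite -mulmxA fro2_isom ?adj_shiftK // -fro2_adj adjmM adjmK fro2_isom
  ?fro2_adj // adj_shiftK.
Qed.

(** A contraction: the weight quotient is at most 1, and compression by a projection does not
    increase the Frobenius norm. *)
Lemma create_bdd i j : hbounded (create i j : weighted_fock -> weighted_fock).
Proof.
exists 1 => x; rewrite mul1r -ler_sqr ?nnegrE ?hn_ge0 // !sqr_hn /=.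
rewrite (@gipE (gbound x).+1) => [|n nM]; last first.
  by case: n nM => [//|n] nM; rewrite /= gboundP // mulmx0 mul0mx lipr0.
rewrite big_ord_recl lipr0 add0r.
suff : \sum_(n < gbound x) lip ((create i j x) n.+1) ((create i j x) n.+1)
   <= gip x x by rewrite lecE => /andP[_].
apply: ler_sum => n _; rewrite !lip_fro fdwS real_complexM /=.
(* Under the outer compression x may be replaced by its own compression, the only part of x that its
   norm sees. *)
have -> : P n.+1 *m (C i *m x n *m adjm (C j)) *m P n.+1
  = P n.+1 *m (C i *m (P n *m x n *m P n) *m adjm (C j)) *m P n.+1.
  by rewrite !mulmxA P_shiftr -!mulmxA fdP_shift.
have w0 := ltW (fdw_gt0 n); have c0 := ltW (fdc_gt0 W n).
apply: ler_pM.
- by rewrite -real_complexM ler0c mulr_ge0.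
- exact: fro2_ge0.
- by rewrite -real_complexM lecR ler_piMl ?fdc_le1.
- apply: le_trans (fro2_compress_le _ (fdP_adj W n.+1) (fdP_idem W n.+1)) _.
  by rewrite fro2_shift.
Qed.

Definition cr i j : op weighted_fock :=
  @Op R weighted_fock (create i j) (annihilate i j)
    (raise_lin _ _) (lower_lin _ _) (create_adj i j) (create_bdd i j).

Lemma hn_eq0 (x : weighted_fock) : (forall n, P n *m x n *m P n = 0) -> hn x = 0.
Proof.
move=> h; rewrite /hn /= /gip big1 ?sqrtr0 // => n _.
by rewrite lip_fro h /fro2 mulmx0 raddf0 mulr0.
Qed.

End WeightedFock.

Section Null.
Variables (R : realType) (E : prehilbert R).

(** These operators become 0 in the completion, and the unitarity relations of the model hold modulo
    them. *)
Definition nullop (a : op E) := forall x, hn (opf a x) = 0.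

Lemma nullopP a : nullop a <-> nu a = 0.
Proof.
split=> [h|h x].
  apply/eqP; rewrite eq_le nu_ge0 andbT; apply: nu_min => // x.
  by rewrite h mul0r.
by apply/eqP; rewrite eq_le hn_ge0 andbT (le_trans (nu_le a x)) // h mul0r.
Qed.

Lemma nullopD a b : nullop a -> nullop b -> nullop (a + b).
Proof.
move=> ha hb x; apply/eqP; rewrite eq_le hn_ge0 andbT (le_trans (hnD _ _)) //.
by rewrite ha hb addr0.
Qed.

Lemma nullopZ c a : nullop a -> nullop (c *: a).
Proof. by move=> ha x; rewrite /= hnZ ha mulr0. Qed.

Lemma nullop_star a : nullop a -> nullop (op_star a).
Proof. by move=> /nullopP h; apply/nullopP; rewrite nu_star. Qed.

Lemma nullop_embed a : nullop a -> embed a = 0.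
Proof. exact: embed_eq0. Qed.

Lemma opf_sum (I : Type) (r : seq I) (F : I -> op E) x :
  opf (\sum_(i <- r) F i) x = \sum_(i <- r) opf (F i) x.
Proof. by elim: r => [|i r IH]; rewrite ?big_nil // !big_cons /= IH. Qed.

Lemma op_star_sum (I : Type) (r : seq I) (F : I -> op E) :
  op_star (\sum_(i <- r) F i) = \sum_(i <- r) op_star (F i).
Proof.
elim: r => [|i r IH]; first by rewrite !big_nil; apply: op_eq.
by rewrite !big_cons op_starD IH.
Qed.

End Null.

(** * The model of the free orthogonal quantum group *)

Lemma scale_mul_lin (K : comNzRingType) (A : algType K) (e a b c d : K) (x y z t : A) :
  e *: ((a *: x + b *: y) * (c *: z + d *: t)) =
  (e * a * c) *: (x * z) + (e * a * d) *: (x * t)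
  + ((e * b * c) *: (y * z) + (e * b * d) *: (y * t)).
Proof.
by rewrite mulrDl !mulrDr -!scalerAl -!scalerAr !scalerDr !scalerA.
Qed.

Section GeneratorProducts.
Variables (R : realType) (A : algType R[i]) (N : nat).
Variables (inv : 'I_N -> 'I_N) (f : 'I_N -> R) (X Y : 'I_N -> 'I_N -> A).
Hypothesis f_gt0 : forall i, 0 < f i.
Hypothesis f_inv : forall i, f (inv i) = (f i)^-1.
Hypothesis invK : involutive inv.

Let G i j := (f i)%:C *: X i j + ((f j)^-1)%:C *: Y (inv i) (inv j).

(** Sorted by degree, with X creating and Y annihilating: the sums of two creations and of two
    annihilations will be null, and the degree-preserving rest yields the scalar. *)
Lemma sum_gen_left i m :
  \sum_j ((f j)^-1)%:C *: (G i j * G m (inv j)) =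
   (f i * f m)%:C *: (\sum_j ((f j)^-1)%:C *: (X i j * X m (inv j)))
   + \sum_j ((f j)^-1)%:C *: (Y (inv i) (inv j) * Y (inv m) j)
   + ((f i)%:C *: (\sum_j X i j * Y (inv m) j)
     + (f m)%:C *: \sum_j ((f j)^-2)%:C *: (Y (inv i) (inv j) * X m (inv j))).
Proof.
rewrite !scaler_sumr -!big_split; apply: eq_bigr => j _ /=.
rewrite scale_mul_lin !scalerA -!real_complexM !f_inv invrK invK.
have -> : (f j)^-1 * f i * f m = f i * f m * (f j)^-1 by ring.
have -> : (f j)^-1 * f i * f j = f i by field; rewrite gt_eqF.
have -> : (f j)^-1 * (f j)^-1 * f m = f m * (f j)^-2 by field; rewrite gt_eqF.
have -> : (f j)^-1 * (f j)^-1 * f j = (f j)^-1 by field; rewrite gt_eqF.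
by rewrite [X in _ + X = _]addrC addrACA.
Qed.

Lemma sum_gen_right j l :
  \sum_i ((f i)^-1)%:C *: (G i j * G (inv i) l) =
   \sum_i ((f i)^-1)%:C *: (X i j * X (inv i) l)
   + ((f j)^-1 * (f l)^-1)%:C *: \sum_i ((f i)^-1)%:C *: (Y (inv i) (inv j) * Y i (inv l))
   + (((f l)^-1)%:C *: (\sum_i X i j * Y i (inv l))
     + ((f j)^-1)%:C *: \sum_i ((f i)^-2)%:C *: (Y (inv i) (inv j) * X (inv i) l)).
Proof.
rewrite !scaler_sumr -!big_split; apply: eq_bigr => i _ /=.
rewrite scale_mul_lin !scalerA -!real_complexM !f_inv invK.
have -> : (f i)^-1 * f i * (f i)^-1 = (f i)^-1 by field; rewrite gt_eqF.
have -> : (f i)^-1 * f i * (f l)^-1 = (f l)^-1 by field; rewrite !gt_eqF.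
have -> : (f i)^-1 * (f j)^-1 * (f i)^-1 = (f j)^-1 * (f i)^-2 by field; rewrite !gt_eqF.
have -> : (f i)^-1 * (f j)^-1 * (f l)^-1 = (f j)^-1 * (f l)^-1 * (f i)^-1 by ring.
by rewrite [X in _ + X = _]addrC addrACA.
Qed.

End GeneratorProducts.

Definition prev_level (R : realType) N n
    (g : forall m, 'M[R[i]]_(tdim N m.+1)) : 'M[R[i]]_(tdim N n) :=
  match n with 0 => 0 | m.+1 => g m end.

Section Generators.
Variables (R : realType) (N : nat) (inv : 'I_N -> 'I_N) (f : 'I_N -> R).
Variable W : fock_data R N.
Hypothesis f_gt0 : forall i, 0 < f i.
Hypothesis f_inv : forall i, f (inv i) = (f i)^-1.
Hypothesis invK : involutive inv.

(* The left leg is rescaled by f, which makes the invariant form of each level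
   the standard one; this is where the asymmetry between f i and f j comes from. *)
Definition gen i j : op (weighted_fock W) :=
  (f i)%:C *: cr W i j + ((f j)^-1)%:C *: op_star (cr W (inv i) (inv j)).

(** The relation U = F bar(U) F^-1 for the model. It holds as an exact identity of operators,
    whereas unitarity holds only up to null operators. *)
Lemma gen_star i j : op_star (gen i j) = (f i / f j)%:C *: gen (inv i) (inv j).
Proof.
rewrite /gen op_starD !op_starZ op_starK !conj_real !invK scalerDr !scalerA.
rewrite -!real_complexM !f_inv invrK addrC.
by congr (_%:C *: _ + _%:C *: _); field; rewrite !gt_eqF.
Qed.

Lemma gen_levelE k j (y : gvec R N) r :
  opf (gen k j) y r =
  (f k)%:C *: prev_level r (fun p => shift_mx k *m y p *m adjm (shift_mx j))
  + ((f j)^-1)%:C *: ((fdc W r.+1)%:C *: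
      (adjm (shift_mx (inv k)) *m fdP W r.+1 *m y r.+1 *m (fdP W r.+1 *m shift_mx (inv j)))).
Proof. by rewrite /= /lower_seq -!scalemxAl; congr (_ *: _ + _). Qed.

End Generators.

(** The first term comes from creating after annihilating, the bracket from the block formula for
    P_(n+1). Under [b * g = a * c] the two terms containing [M] cancel and the scalar [e * b]
    remains. *)
Lemma compress_cancel_left (K : comNzRingType) n (P M x : 'M[K]_n) (a b c e g : K) :
  P *m P = P -> b * g = a * c ->
  P *m (a *: (c *: (M *m P *m x *m P))
        + b *: ((e *: P - g *: (P *m M *m P)) *m x *m P) - (e * b) *: x) *m P = 0.
Proof.
move=> PP h; have PPl y : P *m (P *m y) = P *m y by rewrite mulmxA PP.
have SZ : forall (k : K) (A B : 'M[K]_n), A *m (k *: B) = k *: (A *m B).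
  by move=> k A B; rewrite scalemxAr.
have ZS : forall (k : K) (A B : 'M[K]_n), (k *: A) *m B = k *: (A *m B).
  by move=> k A B; rewrite scalemxAl.
do 3! rewrite ?(mulmxBr, mulmxBl, mulmxDr, mulmxDl, SZ, ZS, scalerBr, scalerA).
by rewrite -?mulmxA ?PPl ?PP h [b * e]mulrC addrCA subrr addr0 subrr.
Qed.

Lemma compress_cancel_right (K : comNzRingType) n (P M x : 'M[K]_n) (a b c e g : K) :
  P *m P = P -> b * g = a * c ->
  P *m (a *: (c *: (P *m x *m P *m M))
        + b *: (P *m x *m (e *: P - g *: (P *m M *m P))) - (e * b) *: x) *m P = 0.
Proof.
move=> PP h; have PPl y : P *m (P *m y) = P *m y by rewrite mulmxA PP.
have SZ : forall (k : K) (A B : 'M[K]_n), A *m (k *: B) = k *: (A *m B).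
  by move=> k A B; rewrite scalemxAr.
have ZS : forall (k : K) (A B : 'M[K]_n), (k *: A) *m B = k *: (A *m B).
  by move=> k A B; rewrite scalemxAl.
do 3! rewrite ?(mulmxBr, mulmxBl, mulmxDr, mulmxDl, SZ, ZS, scalerBr, scalerA).
by rewrite -?mulmxA ?PPl ?PP h [b * e]mulrC addrCA subrr addr0 subrr.
Qed.

(** * The defining relations in the Jones-Wenzl model *)

Section JonesWenzlModel.
Variables (R : realType) (N : nat) (inv : 'I_N -> 'I_N) (f : 'I_N -> R).
Local Notation K := R[i].
Local Notation d := (tdim N).
Local Notation C := (@shift_mx R N _).
Hypothesis invK : involutive inv.
Hypothesis f_gt0 : forall i, 0 < f i.
Hypothesis f_inv : forall i, f (inv i) = (f i)^-1.

Definition normF : R := \sum_i (f i) ^+ 2.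
Hypothesis normF_ge2 : 2 <= normF.

(** For normF = q + 1/q this is [n]_q / [n+1]_q. *)
Fixpoint jwc n : R := if n is m.+1 then (normF - jwc m)^-1 else 0.

(** The map t |-> 1 / (normF - t) preserves [0, 1] once normF is at least 2. *)
Lemma jwc_bounds n : 0 <= jwc n <= 1.
Proof.
elim: n => [|n /andP[h1 h2]] /=; first by rewrite lexx ler01.
have h : 1 <= normF - jwc n by have := normF_ge2; lra.
by rewrite invr_ge0 (le_trans ler01 h) invf_le1 // (lt_le_trans ltr01 h).
Qed.

Lemma normF_jwc_gt0 n : 0 < normF - jwc n.
Proof. by have /andP[_ h] := jwc_bounds n; have := normF_ge2; lra. Qed.

Lemma jwc_gt0 n : 0 < jwc n.+1.
Proof. by rewrite invr_gt0 normF_jwc_gt0. Qed.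

Lemma jwcS n : jwc n.+1 * (normF - jwc n) = 1.
Proof. by rewrite /= mulVf // gt_eqF // normF_jwc_gt0. Qed.

Lemma jwc_le1 n : jwc n <= 1. Proof. by have /andP[] := jwc_bounds n. Qed.

(** The product telescopes to 1 / [n+1]_q, the inverse quantum dimension of the n-th irreducible
    corepresentation, as in the orthogonality relations for its coefficients. *)
Fixpoint jww n : R := if n is m.+1 then jwc m.+1 * jww m else 1.

Definition jwp n : 'M[K]_(d n) := jw inv f jwc n.

Definition jw_data : fock_data R N :=
  @FockData R N jwp jww jwc
    (@jw_adj R N inv f jwc)
    (@jw_idem R N inv f jwc invK f_gt0 f_inv erefl jwcS)
    erefl
    (@jw_shift_absorb R N inv f jwc invK f_gt0 f_inv erefl jwcS)
    erefl (fun n => erefl) jwc_gt0 (fun n => jwc_le1 n.+1).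

Local Notation gen := (gen inv f jw_data).
Local Notation cr := (cr jw_data).
Local Notation P := jwp.

Lemma jwp_cup m : jwp m.+2 *m cup inv f (d m) = 0.
Proof. exact: (jw_cup invK f_gt0 f_inv erefl jwcS). Qed.

Lemma cup_jwp m : adjm (cup inv f (d m)) *m jwp m.+2 = 0.
Proof.
by rewrite -[jwp _](@jw_adj R N inv f jwc) -adjmM jwp_cup adjm0.
Qed.

Lemma jwp_idem n : jwp n *m jwp n = jwp n.
Proof. exact: (jw_idem invK f_gt0 f_inv erefl jwcS). Qed.

Lemma ptrace_jwp m :
  (jwc m.+1)%:C *: (\sum_a ((f a)^-2)%:C *: (adjm (C (inv a)) *m jwp m.+1 *m C (inv a)))
  = jwp m.
Proof.
rewrite (ptrace_jw invK f_gt0 f_inv erefl jwcS) scalerA -real_complexM.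
by rewrite jwcS scale1r.
Qed.

(** Summation over the column index creates a cap on the right of the matrix two levels up, where
    the projection kills it; levels 0 and 1 receive nothing. *)
Lemma cup_left_null i m :
  nullop (\sum_j ((f j)^-1)%:C *: (cr i j * cr m (inv j))).
Proof.
move=> x; rewrite opf_sum; apply: hn_eq0 => n; rewrite gv_sumE.
case: n => [|[|n]].
- by rewrite big1 ?mulmx0 ?mul0mx // => j _; rewrite /= scaler0.
- by rewrite big1 ?mulmx0 ?mul0mx // => j _; rewrite /= mulmx0 mul0mx scaler0.
rewrite (_ : \sum_j _ = C i *m C m *m x n *m adjm (cup inv f (d n))).
  by rewrite -!mulmxA cup_jwp !mulmx0.
rewrite adjm_sum mulmx_sumr; apply: eq_bigr => j _.
by rewrite /= adjmZr adjmM -scalemxAr !mulmxA.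
Qed.

Lemma cup_right_null j l :
  nullop (\sum_i ((f i)^-1)%:C *: (cr i j * cr (inv i) l)).
Proof.
move=> x; rewrite opf_sum; apply: hn_eq0 => n; rewrite gv_sumE.
case: n => [|[|n]].
- by rewrite big1 ?mulmx0 ?mul0mx // => i _; rewrite /= scaler0.
- by rewrite big1 ?mulmx0 ?mul0mx // => i _; rewrite /= mulmx0 mul0mx scaler0.
rewrite (_ : \sum_i _ = cup inv f (d n) *m (x n *m adjm (C l) *m adjm (C j))).
  by rewrite !mulmxA jwp_cup !mul0mx.
rewrite mulmx_suml; apply: eq_bigr => i _.
by rewrite /= -scalemxAl !mulmxA.
Qed.

(** The adjoint of [cup_left_null], with the two row indices dualized and exchanged. *)
Lemma cap_left_null i m :
  nullop (\sum_j ((f j)^-1)%:C *: (op_star (cr (inv i) (inv j)) * op_star (cr (inv m) j))).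
Proof.
have := nullop_star (cup_left_null (inv m) (inv i)); rewrite op_star_sum.
by congr nullop; apply: eq_bigr => j _; rewrite op_starZ conj_real op_starM.
Qed.

Lemma cap_right_null j l :
  nullop (\sum_i ((f i)^-1)%:C *: (op_star (cr (inv i) (inv j)) * op_star (cr i (inv l)))).
Proof.
have := nullop_star (cup_right_null (inv l) (inv j)); rewrite op_star_sum.
by congr nullop; apply: eq_bigr => i _; rewrite op_starZ conj_real op_starM.
Qed.

(** Completeness of the letters collapses the sum over j on the right leg. *)
Lemma sum_cr_star_left i m (x : gvec R N) n :
  opf (\sum_j cr i j * op_star (cr m j)) x n
  = (jwc n)%:C *: (prev_level n (fun p => C i *m adjm (C m)) *m P n *m x n *m P n).
Proof.
rewrite opf_sum gv_sumE; case: n => [|n].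
  by rewrite big1 ?scale0r // => j _; rewrite /=.
rewrite (_ : \sum_j _ = \sum_j (jwc n.+1)%:C *:
   (C i *m adjm (C m) *m P n.+1 *m x n.+1 *m P n.+1 *m (C j *m adjm (C j)))).
  by rewrite -scaler_sumr -mulmx_sumr sum_shift_adj mulmx1.
apply: eq_bigr => j _; rewrite /= /lower_seq.
by rewrite -!scalemxAl -scalemxAr -scalemxAl !mulmxA.
Qed.

Lemma sum_cr_star_right j l (x : gvec R N) n :
  opf (\sum_i cr i j * op_star (cr i l)) x n
  = (jwc n)%:C *: (P n *m x n *m P n *m prev_level n (fun p => C l *m adjm (C j))).
Proof.
rewrite opf_sum gv_sumE; case: n => [|n].
  by rewrite big1 ?scale0r // => i _; rewrite /=.
rewrite (_ : \sum_i _ = \sum_i (jwc n.+1)%:C *: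
   ((C i *m adjm (C i)) *m (P n.+1 *m x n.+1 *m P n.+1 *m (C l *m adjm (C j))))).
  by rewrite -scaler_sumr -mulmx_suml sum_shift_adj mul1mx.
apply: eq_bigr => i _; rewrite /= /lower_seq.
by rewrite -!scalemxAl -scalemxAr -scalemxAl !mulmxA.
Qed.

Lemma shift_jwp_shift n i j :
  adjm (C i) *m P n.+1 *m C j = (i == j)%:R *: P n
  - (jwc n * (f i)^-1 * (f j)^-1)%:C *:
    (P n *m prev_level n (fun p => C (inv i) *m adjm (C (inv j))) *m P n).
Proof.
by rewrite (@shift_jw_shift R N inv f jwc erefl); case: n.
Qed.

(** The right leg is closed by the weighted partial trace, which absorbs the factor [jwc n.+1] of
    the annihilator. *)
Lemma sum_star_cr_left i m (x : gvec R N) n :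
  opf (\sum_j ((f j)^-2)%:C *: (op_star (cr i (inv j)) * cr m (inv j))) x n
  = adjm (C i) *m P n.+1 *m C m *m x n *m P n.
Proof.
rewrite opf_sum gv_sumE -[X in _ = _ *m X]ptrace_jwp -scalemxAr mulmx_sumr scaler_sumr.
apply: eq_bigr => j _; rewrite /= /lower_seq /=.
rewrite -!scalemxAl -scalemxAr scalerA [in RHS]scalerA [X in X *: _]mulrC.
by rewrite !mulmxA.
Qed.

Lemma sum_star_cr_right j l (x : gvec R N) n :
  opf (\sum_i ((f i)^-2)%:C *: (op_star (cr (inv i) j) * cr (inv i) l)) x n
  = P n *m x n *m (adjm (C l) *m P n.+1 *m C j).
Proof.
rewrite opf_sum gv_sumE -[X in _ = X *m _ *m _]ptrace_jwp -!scalemxAl !mulmx_suml scaler_sumr.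
apply: eq_bigr => i _; rewrite /= /lower_seq /=.
rewrite -!scalemxAl scalerA [in RHS]scalerA [X in X *: _]mulrC.
by rewrite !mulmxA.
Qed.

(** The sums of degree 2 and -2 are null by the cup lemmas; in degree 0 the block formula for
    P_(n+1) cancels everything but the scalar. *)
Lemma gen_rel_left i m :
  nullop (\sum_j ((f j)^-1)%:C *: (gen i j * gen m (inv j))
          - ((i == inv m)%:R * (f m)%:C) *: 1).
Proof.
rewrite (sum_gen_left _ (fun i j => op_star (cr i j))) // -addrA.
apply: nullopD.
  by apply: nullopD; [apply: nullopZ; exact: cup_left_null|exact: cap_left_null].
move=> x; apply: hn_eq0 => n /=.
set u := opf (\sum_j cr i j * _) x; set v := opf (\sum_j _ *: (_ * cr m _)) x.
rewrite [u n]sum_cr_star_left [v n]sum_star_cr_left shift_jwp_shift invK f_inv invrK.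
have -> : (i == inv m) = (inv i == m) by rewrite -(inj_eq (inv_inj invK)) invK.
apply: compress_cancel_left; first exact: jwp_idem.
by rewrite -!real_complexM; congr (_%:C); field; rewrite gt_eqF.
Qed.

Lemma gen_rel_right j l :
  nullop (\sum_i ((f i)^-1)%:C *: (gen i j * gen (inv i) l)
          - ((l == inv j)%:R * ((f j)^-1)%:C) *: 1).
Proof.
rewrite (sum_gen_right _ (fun i j => op_star (cr i j))) // -addrA.
apply: nullopD.
  by apply: nullopD; [exact: cup_right_null|apply: nullopZ; exact: cap_right_null].
move=> x; apply: hn_eq0 => n /=.
set u := opf (\sum_i cr i j * _) x; set v := opf (\sum_i _ *: (_ * cr _ l)) x.
rewrite [u n]sum_cr_star_right [v n]sum_star_cr_right shift_jwp_shift invK f_inv invrK.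
apply: compress_cancel_right; first exact: jwp_idem.
by rewrite -!real_complexM; congr (_%:C); field; rewrite !gt_eqF.
Qed.

End JonesWenzlModel.

(** * Invariance of the vacuum moments *)

Section IndexSum.
Variable N : nat.

Fixpoint isum (V : nmodType) n (F : seq 'I_N -> V) : V :=
  if n is m.+1 then \sum_k isum m (fun K => F (k :: K)) else F [::].

Lemma eq_isum (V : nmodType) n (F G : seq 'I_N -> V) :
  (forall K, F K = G K) -> isum n F = isum n G.
Proof.
elim: n F G => [|n IH] F G h //=; apply: eq_bigr => k _.
by apply: IH => K.
Qed.

Lemma isum_morph (V V' : nmodType) (g : V -> V') n (F : seq 'I_N -> V) :
  g 0 = 0 -> {morph g : x y / x + y} -> g (isum n F) = isum n (fun K => g (F K)).
Proof.
move=> g0 gD; elim: n F => [|n IH] F //=.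
by rewrite (big_morph g gD g0); apply: eq_bigr => k _; rewrite IH.
Qed.

Lemma isum_raddf (V V' : zmodType) (g : {additive V -> V'}) n (F : seq 'I_N -> V) :
  g (isum n F) = isum n (fun K => g (F K)).
Proof. exact: isum_morph (raddf0 g) (raddfD g). Qed.

(** Row and column words are kept apart because the coproduct inserts a common middle word between
    them. *)
Fixpoint wprod (A : pzSemiRingType) (u : 'I_N -> 'I_N -> A) (I J : seq 'I_N) : A :=
  match I, J with
  | i :: I', j :: J' => u i j * wprod u I' J'
  | _, _ => 1
  end.

End IndexSum.

Lemma comm_sandwich (K : pzSemiRingType) m n (G T : 'M[K]_m) (G0 : 'M[K]_n)
    (u : 'M[K]_(m, n)) (v : 'M[K]_(n, m)) :
  G *m T = T *m G -> G *m u = u *m G0 -> v *m G = G0 *m v ->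
  G *m (T *m u *m (v *m T)) = T *m u *m (v *m T) *m G.
Proof.
move=> hT hu hv; rewrite !mulmxA hT -(mulmxA T G u) hu -(mulmxA _ T G) -hT !mulmxA.
by rewrite -(mulmxA (T *m u) v G) hv !mulmxA.
Qed.

Section Invariance.
Variables (R : realType) (N : nat) (inv : 'I_N -> 'I_N) (f : 'I_N -> R).
Local Notation K := R[i].
Local Notation d := (tdim N).
Local Notation C := (@shift_mx R N _).
Hypothesis invK : involutive inv.
Hypothesis f_gt0 : forall i, 0 < f i.
Hypothesis f_inv : forall i, f (inv i) = (f i)^-1.
Hypothesis normF_ge2 : 2 <= normF f.

Local Notation W := (jw_data invK f_gt0 f_inv normF_ge2).
Local Notation P := (jwp inv f).
Local Notation c := (jwc f).
Local Notation cup := (cup inv f).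

Variables (A : algType K) (U : 'I_N -> 'I_N -> A) (h : {scalar A}).
Hypothesis rel_left : forall i m,
  \sum_j ((f j)^-1)%:C *: (U i j * U m (inv j)) = ((i == inv m)%:R * (f m)%:C) *: 1.
Hypothesis rel_right : forall j l,
  \sum_i ((f i)^-1)%:C *: (U i j * U (inv i) l) = ((l == inv j)%:R * ((f j)^-1)%:C) *: 1.

(* (h (x) id)(a (x) 1 . U^(x)r) in the rescaled basis of the left leg. *)
Fixpoint corep (a : A) r : 'M[K]_(d r) :=
  match r with
  | 0 => (h a)%:M
  | m.+1 => \sum_i \sum_k (f k / f i)%:C *:
              (C k *m corep (a * U i k) m *m adjm (C i))
  end.

Lemma corepZD c1 a b r : corep (c1 *: a + b) r = c1 *: corep a r + corep b r.
Proof.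
elim: r a b => [|r IH] a b /=.
  by rewrite linearP raddfD /= -scale_scalar_mx.
rewrite scaler_sumr -big_split; apply: eq_bigr => i _ /=.
rewrite scaler_sumr -big_split; apply: eq_bigr => k _ /=.
rewrite mulrDl -scalerAl IH mulmxDr mulmxDl scalerDr; congr (_ + _).
by rewrite -scalemxAr -scalemxAl !scalerA mulrC.
Qed.

Lemma corep0 r : corep 0 r = 0.
Proof. by have := corepZD (-1) 0 0 r; rewrite scaler0 addr0 scaleN1r addNr. Qed.

Lemma corepZ c1 a r : corep (c1 *: a) r = c1 *: corep a r.
Proof. by have := corepZD c1 a 0 r; rewrite !addr0 corep0 addr0. Qed.

Lemma corepD a b r : corep (a + b) r = corep a r + corep b r.
Proof. by have := corepZD 1 a b r; rewrite !scale1r. Qed.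

Lemma corep_sum (I : finType) (F : I -> A) r :
  corep (\sum_i F i) r = \sum_i corep (F i) r.
Proof. exact: (big_morph (corep^~ r) (fun a b => corepD a b r) (corep0 r)). Qed.

Lemma corep_shift a r i :
  corep a r.+1 *m C i = \sum_k (f k / f i)%:C *: (C k *m corep (a * U i k) r).
Proof.
rewrite /= mulmx_suml (bigD1 i) //= [X in _ + X]big1 => [|j ji].
  rewrite addr0 mulmx_suml; apply: eq_bigr => k _.
  by rewrite -scalemxAl -!mulmxA adj_shiftK mulmx1.
rewrite mulmx_suml big1 // => k _.
by rewrite -scalemxAl -!mulmxA adj_shift_mul (negPf ji) scale0r !mulmx0 scaler0.
Qed.

Lemma shift_corep a r k :
  adjm (C k) *m corep a r.+1 = \sum_i (f k / f i)%:C *: (corep (a * U i k) r *m adjm (C i)).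
Proof.
rewrite /= mulmx_sumr; apply: eq_bigr => i _.
rewrite mulmx_sumr (bigD1 k) //= [X in _ + X]big1 => [|j jk].
  by rewrite addr0 -scalemxAr !mulmxA adj_shiftK mul1mx.
rewrite -scalemxAr !mulmxA adj_shift_mul eq_sym (negPf jk) scale0r !mul0mx.
by rewrite scaler0.
Qed.

Lemma corep_lift1 a r (M : 'M[K]_(d r)) :
  (forall b, corep b r *m M = M *m corep b r) ->
  corep a r.+1 *m lift1 N M = lift1 N M *m corep a r.+1.
Proof.
move=> hM; rewrite /= mulmx_suml mulmx_sumr; apply: eq_bigr => i _.
rewrite mulmx_suml mulmx_sumr; apply: eq_bigr => k _.
rewrite -scalemxAl -scalemxAr; congr (_ *: _).
by rewrite -!mulmxA adj_shift_lift1 (mulmxA _ M) hM !mulmxA lift1_shift.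
Qed.

(** The two leading matrix coefficients contract through [rel_right], which forces the second letter
    to be dual to the first and so reproduces the cup. *)
Lemma corep_cup a r : corep a r.+2 *m cup (d r) = cup (d r) *m corep a r.
Proof.
transitivity (\sum_k \sum_l (f k * f l)%:C *: (C k *m C l *m
    corep (a * \sum_i ((f i)^-1)%:C *: (U i k * U (inv i) l)) r)).
  rewrite mulmx_sumr.
  under eq_bigr => i _.
    rewrite -scalemxAr mulmxA corep_shift mulmx_suml scaler_sumr.
    under eq_bigr => k _.
      rewrite -scalemxAl -mulmxA corep_shift mulmx_sumr !scaler_sumr.
      over.
    over.
  rewrite exchange_big; apply: eq_bigr => k _ /=.
  rewrite exchange_big; apply: eq_bigr => l _ /=.
  rewrite mulr_sumr corep_sum mulmx_sumr scaler_sumr; apply: eq_bigr => i _.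
  rewrite -scalerAr corepZ -!scalemxAr !scalerA -!real_complexM !mulmxA (mulrA a) f_inv.
  by congr (_%:C *: _); field; rewrite !gt_eqF // invr_gt0.
rewrite mulmx_suml; apply: eq_bigr => k _.
under eq_bigr => l _ do rewrite rel_right -scalerAr mulr1 corepZ.
rewrite (bigD1 (inv k)) //= eqxx big1 => [|l lk].
  rewrite mul1r addr0 -scalemxAr -scalemxAl.
  rewrite scalerA -real_complexM f_inv; congr (_%:C *: _).
  by field; rewrite gt_eqF.
by rewrite (negPf lk) mul0r scale0r mulmx0 scaler0.
Qed.

Lemma adj_cup_corep a r :
  adjm (cup (d r)) *m corep a r.+2 = corep a r *m adjm (cup (d r)).
Proof.
transitivity (\sum_k \sum_l ((f k)^-1 * (f l)^-1)%:C *: (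
    corep (a * \sum_i ((f i)^-1)%:C *: (U k i * U l (inv i))) r
     *m adjm (C l) *m adjm (C k))).
  rewrite adj_cup mulmx_suml.
  under eq_bigr => i _.
    rewrite -scalemxAl -mulmxA (shift_corep a r.+1 i) mulmx_sumr scaler_sumr.
    under eq_bigr => k _.
      rewrite -scalemxAr mulmxA (shift_corep _ r (inv i)) mulmx_suml !scaler_sumr.
      over.
    over.
  rewrite exchange_big; apply: eq_bigr => k _ /=.
  rewrite exchange_big; apply: eq_bigr => l _ /=.
  rewrite mulr_sumr corep_sum !mulmx_suml scaler_sumr; apply: eq_bigr => i _.
  rewrite -scalerAr corepZ -!scalemxAl !scalerA -!real_complexM (mulrA a) f_inv.
  by congr (_%:C *: _); field; rewrite !gt_eqF.
rewrite adj_cup mulmx_sumr; apply: eq_bigr => k _.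
under eq_bigr => l _ do rewrite rel_left -scalerAr mulr1 corepZ.
rewrite (bigD1 (inv k)) //= invK eqxx big1 => [|l lk].
  rewrite mul1r addr0 -!scalemxAl.
  rewrite scalerA -real_complexM -scalemxAr mulmxA f_inv; congr (_%:C *: _).
  by field; rewrite gt_eqF.
rewrite -(inj_eq (inv_inj invK)) invK eq_sym (negPf lk) mul0r scale0r.
by rewrite !mul0mx scaler0.
Qed.

(** P_r is built from cups and their adjoints, which intertwine the corepresentation. The element
    [a] stays arbitrary, since each strand multiplies it by a generator. *)
Lemma corep_jwp a r : corep a r *m P r = P r *m corep a r.
Proof.
elim: r a => [|r IH] a; first by rewrite /jwp /= mulmx1 mul1mx.
case: r IH => [|r] IH; first by rewrite /jwp jw1 mulmx1 mul1mx.
have hT : corep a r.+2 *m lift1 N (P r.+1) = lift1 N (P r.+1) *m corep a r.+2.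
  by apply: corep_lift1.
rewrite [P r.+2]jwSS mulmxBr mulmxBl -hT; congr (_ - _).
rewrite -scalemxAr -scalemxAl adjmM adj_lift1 jw_adj -/(jwp inv f r.+1); congr (_ *: _).
by apply: comm_sandwich => //; [exact: corep_cup|exact: adj_cup_corep].
Qed.

Lemma gen_level k j (y : gvec R N) r :
  opf (gen inv f W k j) y r =
  (f k)%:C *: prev_level r (fun p => C k *m y p *m adjm (C j))
  + ((f j)^-1)%:C *: ((c r.+1)%:C *:
      (adjm (C (inv k)) *m P r.+1 *m y r.+1 *m (P r.+1 *m C (inv j)))).
Proof. exact: gen_levelE. Qed.

(* The left leg carries the corepresentation U^(x)r, and [gen i j] is equivariant
   for it; hence the vacuum moments are invariant under h. *)
Lemma gen_equivariant a i j (x : gvec R N) r :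
  \sum_k ((f k)%:C *: prev_level r (fun p => C k *m (corep (a * U i k) p *m x p) *m adjm (C j))
    + ((f j)^-1)%:C *: ((c r.+1)%:C *:
      (adjm (C (inv k)) *m P r.+1 *m (corep (a * U i k) r.+1 *m x r.+1)
        *m (P r.+1 *m C (inv j)))))
  = corep a r *m opf (gen inv f W i j) x r.
Proof.
rewrite gen_level big_split mulmxDr; congr (_ + _) => /=.
  case: r => [|r] /=; first by rewrite big1 ?scaler0 ?mulmx0 // => k _; rewrite scaler0.
  rewrite -scalemxAr !mulmxA corep_shift !mulmx_suml scaler_sumr.
  apply: eq_bigr => k _; rewrite -!scalemxAl scalerA -real_complexM !mulmxA.
  by congr (_%:C *: _); field; rewrite gt_eqF.
rewrite -!scaler_sumr -!scalemxAr; congr (_ *: (_ *: _)).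
transitivity ((\sum_k adjm (C (inv k)) *m corep (a * U i k) r.+1) *m
   (P r.+1 *m x r.+1 *m P r.+1 *m C (inv j))).
  rewrite mulmx_suml; apply: eq_bigr => k _.
  transitivity (adjm (C (inv k)) *m (P r.+1 *m corep (a * U i k) r.+1) *m
     (x r.+1 *m (P r.+1 *m C (inv j)))); first by rewrite !mulmxA.
  by rewrite -corep_jwp !mulmxA.
rewrite !mulmxA; do 4!congr (_ *m _).
under eq_bigr do rewrite shift_corep.
rewrite exchange_big (bigD1 (inv i)) //= [X in _ + X]big1 ?addr0 => [|l li]; last first.
  rewrite (_ : \sum_k _ = ((f l)^-1)%:C *: (corep (a * \sum_k ((f k)^-1)%:C *: (U i k * U l (inv k))) r
      *m adjm (C l))); last first.
    rewrite mulr_sumr corep_sum mulmx_suml scaler_sumr; apply: eq_bigr => k _.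
    rewrite -scalerAr corepZ -scalemxAl scalerA -real_complexM f_inv (mulrA a).
    by congr (_%:C *: _); ring.
  rewrite rel_left -(inj_eq (inv_inj invK)) invK eq_sym (negPf li).
  by rewrite mul0r scale0r mulr0 corep0 mul0mx scaler0.
rewrite (_ : \sum_k _ = (f i)%:C *: (corep (a * \sum_k ((f k)^-1)%:C *: (U i k * U (inv i) (inv k))) r
      *m adjm (C (inv i)))); last first.
  rewrite mulr_sumr corep_sum mulmx_suml scaler_sumr; apply: eq_bigr => k _.
  rewrite -scalerAr corepZ -scalemxAl scalerA -real_complexM !f_inv invrK (mulrA a).
  by congr (_%:C *: _); ring.
rewrite rel_left invK eqxx mul1r -scalerAr mulr1 corepZ -scalemxAl scalerA.
by rewrite -real_complexM f_inv divff ?scale1r // gt_eqF.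
Qed.

(** Equivariance letter by letter, the generators already used being collected in [a]. The induction
    ends at the vacuum, which lives on level 0 where [corep] is scalar. *)
Lemma isum_corep n (I J : seq 'I_N) a r : size I = n -> size J = n ->
  isum n (fun L => h (a * wprod U I L) *: (opf (wprod (gen inv f W) L J) (gvac R N) : gvec R N) r)
  = corep a r *m (opf (wprod (gen inv f W) I J) (gvac R N) : gvec R N) r.
Proof.
elim: n I J a r => [|n IH] [|i I] [|j J] // a r.
  move=> _ _ /=; rewrite mulr1; case: r => [|r] /=; last by rewrite mulmx0 scaler0.
  by rewrite mul_scalar_mx.
move=> [sI] [sJ] /=.
set X := opf (wprod (gen inv f W) I J) (gvac R N).
pose y k : gvec R N := isum n (fun L =>
  h (a * U i k * wprod U I L) *: (opf (wprod (gen inv f W) L J) (gvac R N) : gvec R N)).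
have yE k s : y k s = corep (a * U i k) s *m (X : gvec R N) s.
  rewrite -IH // /y (@isum_morph _ _ _ (fun z : gvec R N => z s)) //.
rewrite -gen_equivariant; apply: eq_bigr => k _.
under eq_isum do rewrite mulrA.
transitivity ((opf (gen inv f W k j) (y k) : gvec R N) r); last first.
  rewrite gen_level yE; congr (_ *: _ + _).
  by case: (r) => [//|p]; rewrite /= yE.
rewrite /y (@isum_morph _ _ _ (opf (gen inv f W k j))); last 2 first.
- exact: opf0.
- exact: opfD.
rewrite (@isum_morph _ _ _ (fun z : gvec R N => z r)) //.
by apply: eq_isum => L; rewrite opfZ.
Qed.

(** The case of level 0 and [a = 1], where [corep] equals h(1) = 1. *)
Lemma isum_gen_vac n (I J : seq 'I_N) : h 1 = 1 -> size I = n -> size J = n ->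
  isum n (fun L => h (wprod U I L) * vexp (wprod (gen inv f W) L J))
  = vexp (wprod (gen inv f W) I J).
Proof.
move=> h1 sI sJ; have := isum_corep 1 0 sI sJ.
move/(congr1 (fun M : 'M[K]_(d 0) => \tr M)).
rewrite /= h1 mul1mx /vexp /= gip_vac => <-.
rewrite (@isum_morph _ _ _ (@mxtrace K (d 0))); last 2 first.
- exact: mxtrace0.
- exact: mxtraceD.
by apply: eq_isum => L; rewrite mxtraceZ mul1r gip_vac.
Qed.

End Invariance.

(** * Haar moments as vacuum moments *)

Section MonomialRelations.
Variables (R : realType) (N : nat) (inv : 'I_N -> 'I_N) (f : 'I_N -> R).
Local Notation K := R[i].
Hypothesis invK : involutive inv.
Hypothesis f_gt0 : forall i, 0 < f i.
Hypothesis f_inv : forall i, f (inv i) = (f i)^-1.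

Definition monomial_mx : 'M[K]_N := \matrix_(i, j) ((j == inv i)%:R * (f i)%:C).
Local Notation F := monomial_mx.

Lemma monomial_mxK : F *m F = 1%:M.
Proof.
apply/matrixP => i j; rewrite !mxE (bigD1 (inv i)) //= big1 => [|a ai].
  rewrite !mxE eqxx mul1r invK addr0 mulrCA -real_complexM f_inv divff ?(gt_eqF (f_gt0 _)) //.
  by rewrite mulr1 eq_sym.
by rewrite !mxE (negPf ai) !mul0r.
Qed.

Lemma invmx_monomial : invmx F = F.
Proof.
have [uF _] := mulmx1_unit monomial_mxK.
by rewrite -[LHS]mulmx1 -monomial_mxK mulmxA mulVmx // mul1mx.
Qed.

Lemma NF_monomial : NF F = (normF f)%:C.
Proof.
rewrite /NF /mxtrace rmorph_sum.
under eq_bigr => j _.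
  rewrite mxE (bigD1 (inv j)) //= big1 => [|a aj]; last first.
    have -> : F a j = 0; last by rewrite mulr0.
    rewrite mxE; case: eqP => [e|_]; last by rewrite mul0r.
    by rewrite e invK eqxx in aj.
  rewrite !mxE invK eqxx mul1r addr0 conjc_real -real_complexM -expr2.
  over.
rewrite [RHS](reindex_inj (inv_inj invK)) /=.
by apply: eq_bigr => j _; rewrite rmorphXn.
Qed.

Section Relations.
Variables (A : cstarType R) (U : 'M[A]_N).

(** The relation U = F bar(U) F^-1, solved for the adjoints. Substituting it turns the two halves of
    unitarity into the star-free quadratic relations below. *)
Definition star_rel := forall i j, star (U i j) = (f i / f j)%:C *: U (inv i) (inv j).

Definition left_rel := forall i m,
  \sum_j ((f j)^-1)%:C *: (U i j * U m (inv j)) = ((i == inv m)%:R * (f m)%:C) *: 1.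

Definition right_rel := forall j l,
  \sum_i ((f i)^-1)%:C *: (U i j * U (inv i) l) = ((l == inv j)%:R * ((f j)^-1)%:C) *: 1.

Lemma conj_entry i j :
  (scalars_mx A F *m bar_mx U *m scalars_mx A (invmx F)) i j
  = (f i / f j)%:C *: star (U (inv i) (inv j)).
Proof.
rewrite invmx_monomial mxE (bigD1 (inv j)) //= big1 => [|b bj].
  rewrite addr0 mxE (bigD1 (inv i)) //= big1 => [|a ai].
    rewrite !mxE eqxx invK eqxx !mul1r addr0 f_inv /= -!scalerAl mul1r.
    by rewrite -scalerAr mulr1 scalerA -real_complexM mulrC.
  by rewrite !mxE (negPf ai) mul0r /= scale0r mul0r.
rewrite [X in _ * X]mxE [F b j]mxE.
have -> : (j == inv b) = false by rewrite -(inj_eq (inv_inj invK)) invK eq_sym (negPf bj).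
by rewrite mul0r /= scale0r mulr0.
Qed.

Lemma star_relE : star_rel <-> U = scalars_mx A F *m bar_mx U *m scalars_mx A (invmx F).
Proof.
split=> [h|h i j].
  apply/matrixP => i j; rewrite conj_entry h !invK scalerA -real_complexM !f_inv.
  by rewrite (_ : _ * _ = 1) ?scale1r //; field; rewrite !gt_eqF ?invr_gt0.
have /matrixP/(_ (inv i) (inv j)) := h; rewrite conj_entry !invK => ->.
rewrite scalerA -real_complexM !f_inv.
by rewrite (_ : _ * _ = 1) ?scale1r //; field; rewrite !gt_eqF.
Qed.

Lemma left_relE : star_rel -> left_rel <-> U *m (bar_mx U)^T = 1%:M.
Proof.
move=> hs.
have key i m : (U *m (bar_mx U)^T) i (inv m)
    = ((f m)^-1)%:C *: \sum_j ((f j)^-1)%:C *: (U i j * U m (inv j)).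
  rewrite mxE scaler_sumr; apply: eq_bigr => j _.
  by rewrite !mxE hs invK -scalerAr scalerA -real_complexM f_inv.
split=> [h|h i m].
  apply/matrixP => i m; rewrite -[m]invK key h invK scalerA mulrCA -real_complexM.
  by rewrite mulVf ?(gt_eqF (f_gt0 _)) // mulr1 mxE scaler_nat.
have := key i m; rewrite h mxE => /(congr1 (fun z => (f m)%:C *: z)).
rewrite scalerA -real_complexM divff ?(gt_eqF (f_gt0 _)) // scale1r => <-.
by rewrite mulrC -scalerA scaler_nat.
Qed.

Lemma right_relE : star_rel -> right_rel <-> (bar_mx U)^T *m U = 1%:M.
Proof.
move=> hs.
have key j l : ((bar_mx U)^T *m U) (inv j) l
    = (f j)%:C *: \sum_i ((f i)^-1)%:C *: (U i j * U (inv i) l).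
  rewrite mxE scaler_sumr (reindex_inj (inv_inj invK)); apply: eq_bigr => i _.
  rewrite !mxE hs !invK -scalerAl scalerA -real_complexM !f_inv invrK.
  by rewrite mulrC.
split=> [h|h j l].
  apply/matrixP => j l; rewrite -[j]invK key h invK scalerA mulrCA -real_complexM.
  by rewrite divff ?(gt_eqF (f_gt0 _)) // mulr1 mxE scaler_nat eq_sym.
have := key j l; rewrite h mxE => /(congr1 (fun z => ((f j)^-1)%:C *: z)).
rewrite scalerA -real_complexM mulVf ?(gt_eqF (f_gt0 _)) // scale1r => <-.
by rewrite mulrC -scalerA scaler_nat eq_sym.
Qed.

Lemma OF_relations_monomial :
  OF_relations F U <-> [/\ star_rel, left_rel & right_rel].
Proof.
split=> [[h1 h2 h3]|[h1 h2 h3]].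
  have hs : star_rel by apply/star_relE.
  by split=> //; [apply/left_relE|apply/right_relE].
by split; [apply/left_relE|apply/right_relE|apply/star_relE].
Qed.

End Relations.

End MonomialRelations.

Section HaarMoments.
Variables (R : realType) (N : nat) (inv : 'I_N -> 'I_N) (f : 'I_N -> R).
Local Notation K := R[i].
Hypothesis invK : involutive inv.
Hypothesis f_gt0 : forall i, 0 < f i.
Hypothesis f_inv : forall i, f (inv i) = (f i)^-1.
Hypothesis normF_ge2 : 2 <= normF f.
Local Notation F := (monomial_mx inv f).
Local Notation W := (jw_data invK f_gt0 f_inv normF_ge2).

Definition model_mx : 'M[compl (weighted_fock W)]_N :=
  \matrix_(i, j) embed (gen inv f W i j).

Lemma embed_sum (E : prehilbert R) (I : Type) (r : seq I) (G : I -> op E) :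
  embed (\sum_(i <- r) G i) = \sum_(i <- r) embed (G i).
Proof.
elim: r => [|i r IH]; first by rewrite !big_nil raddf0.
by rewrite !big_cons raddfD /= IH.
Qed.

Lemma model_OF : OF_relations F model_mx.
Proof.
apply/OF_relations_monomial => //; split.
- by move=> i j; rewrite !mxE embed_star gen_star // embedZ.
- move=> i m; apply/eqP; rewrite -subr_eq0; apply/eqP.
  have := nullop_embed (@gen_rel_left R N inv f invK f_gt0 f_inv normF_ge2 i m).
  rewrite raddfB /= embedZ embed_sum => e; rewrite -[RHS]e; congr (_ - _).
  by apply: eq_bigr => j _; rewrite !mxE embedZ rmorphM.
- move=> j l; apply/eqP; rewrite -subr_eq0; apply/eqP.
  have := nullop_embed (@gen_rel_right R N inv f invK f_gt0 f_inv normF_ge2 j l).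
  rewrite raddfB /= embedZ embed_sum => e; rewrite -[RHS]e; congr (_ - _).
  by apply: eq_bigr => i _; rewrite !mxE embedZ rmorphM.
Qed.

Variables (A : cstarType R) (U : 'M[A]_N) (h : {scalar A}).
Hypothesis hC : is_C_OF F U.
Hypothesis hh : is_Haar_state U h.

Let u i j := U i j.

(** The coproduct of a word is a sum over middle words [L], obtained by moving commuting legs past
    each other; the slice map is then applied termwise. *)
Lemma haar_left n (I J : seq 'I_N) : size I = n -> size J = n ->
  isum n (fun L => h (wprod u I L) *: wprod u L J) = h (wprod u I J) *: 1.
Proof.
case: hh => _ [T [i1 [i2 [Delta [hl [hr [T1 [_ hD] [_ hlE] _ hinv]]]]]]].
move=> sI sJ; case: T1 => _ comm _ _.
have DE m (I' J' : seq 'I_N) : size I' = m -> size J' = m ->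
    Delta (wprod u I' J') = isum m (fun L => i1 (wprod u I' L) * i2 (wprod u L J')).
  elim: m I' J' => [|m IH] [|i I'] [|j J'] //; first by rewrite /= !rmorph1 mulr1.
  move=> [s1] [s2] /=; rewrite rmorphM /= [X in X * _]hD IH // mulr_suml; apply: eq_bigr => k _.
  rewrite (@isum_morph _ _ _ ( *%R (i1 (U i k) * i2 (U k j)))); last 2 first.
  - exact: mulr0.
  - exact: mulrDr.
  apply: eq_isum => L; rewrite !rmorphM -!mulrA; congr (_ * _).
  by rewrite !mulrA comm.
have [<- _] := hinv (wprod u I J).
rewrite (DE n) // (isum_raddf hl); apply: eq_isum => L; exact/esym/hlE.
Qed.

(* The universal property maps U to the model, so the vacuum state defines a
   functional on A: absorbing it into h on one side and, by invariance, h into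
   it on the other identifies the two. *)
Theorem haar_moment (I J : seq 'I_N) : size I = size J ->
  h (wprod u I J) = vexp (wprod (gen inv f W) I J).
Proof.
move=> sIJ; have [hOF _ univ] := hC.
have [pi [_ piU]] := univ _ _ model_OF.
have piw L M : pi (wprod u L M) = embed (wprod (gen inv f W) L M).
  elim: L M => [|l L IH] [|m M] /=; rewrite ?rmorph1 //.
  by rewrite !rmorphM /= IH [pi _]piU mxE.
have [_ h2 h3] := (OF_relations_monomial invK f_gt0 f_inv U).1 hOF.
have h1 : h 1 = 1 by case: hh => -[].
have e := haar_left sIJ erefl.
pose g z : K := qstate (pi z).
have gZ k z : g (k *: z) = k * g z by rewrite /g linearZ /= linearZ.
have gD x y : g (x + y) = g x + g y by rewrite /g raddfD /= raddfD.
have g0 : g 0 = 0 by rewrite -(scale0r 0) gZ mul0r.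
have gw L M : g (wprod u L M) = vexp (wprod (gen inv f W) L M).
  by rewrite /g piw qstate_embed.
have g1 : g 1 = 1 by have := gw [::] [::]; rewrite [LHS]/= => ->; exact: (@ip_vac R (weighted_fock W)).
(* As [g 1 = 1], the moment h(w) is g(h(w) 1), and left invariance spreads h(w) 1 over the middle
   words. *)
rewrite -[LHS]mulr1 -g1 -gZ -e (isum_morph _ _ g0 gD).
rewrite -(isum_gen_vac invK f_gt0 f_inv normF_ge2 h2 h3 h1 sIJ erefl).
by apply: eq_isum => L; rewrite gZ gw.
Qed.

End HaarMoments.

(** * Free families of generalized circular elements *)

Section FreeCreation.
Variables (R : realType) (E : prehilbert R) (L : eqType) (a : L -> op E).
Local Notation K := R[i].

Hypothesis a_rel : forall p q x, opg (a p) (opf (a q) x) = (p == q)%:R *: x.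
Hypothesis a_vac : forall p, opg (a p) vac = 0.

Variables (I : eqType) (s t : I -> L) (al be : I -> R).
Hypothesis st_neq : forall i, s i != t i.
Hypothesis ss_neq : forall i j, i != j -> s i != s j.
Hypothesis tt_neq : forall i j, i != j -> t i != t j.
Hypothesis st_neq2 : forall i j, s i != t j.

Definition gcirc_elt i : op E := (al i)%:C *: a (s i) + (be i)%:C *: op_star (a (t i)).

Definition letter i (b : bool) : L := if b then s i else t i.

Lemma letter_eq i b b' : (letter i b == letter i b') = (b == b').
Proof. by case: b b' => -[]; rewrite ?eqxx // ?(negPf (st_neq i)) // eq_sym (negPf (st_neq i)). Qed.

Lemma letter_neq i j b b' : i != j -> (letter i b == letter j b') = false.
Proof.
move=> ij; case: b b' => -[] /=; apply: negbTE.
- exact: ss_neq.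
- exact: st_neq2.
- by rewrite eq_sym st_neq2.
- exact: tt_neq.
Qed.

Definition aword i (u : seq bool) (v : E) : E :=
  foldr (fun b => opf (a (letter i b))) v u.

(** On the Fock space: no component of v begins with a letter of [i]. *)
Definition killed i (v : E) := forall b, opg (a (letter i b)) v = 0.

Lemma killed_vac i : killed i vac. Proof. by move=> b; exact: a_vac. Qed.

Lemma opg_sum (b : op E) (J : Type) (r : seq J) (F : J -> E) :
  opg b (\sum_(j <- r) F j) = \sum_(j <- r) opg b (F j).
Proof.
apply: (big_morph _ (opgD b)); apply: (addrI (opg b 0)).
by rewrite -opgD !addr0.
Qed.

Lemma opf_vsum (b : op E) (J : Type) (r : seq J) (F : J -> E) :
  opf b (\sum_(j <- r) F j) = \sum_(j <- r) opf b (F j).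
Proof. exact: (opg_sum (op_star b)). Qed.

(* T acts on the tensor factor generated by the letters of i as on the Fock space
   over these two letters, with coefficients independent of the remainder v. *)
Definition local_op i (T : op E) := exists g : seq bool -> seq (K * seq bool),
  forall u v, killed i v -> opf T (aword i u v) = \sum_(c <- g u) c.1 *: aword i c.2 v.

Lemma local_one i : local_op i 1.
Proof. by exists (fun u => [:: (1, u)]) => u v _; rewrite big_seq1 scale1r. Qed.

Lemma local_lin i k S T : local_op i S -> local_op i T -> local_op i (k *: S + T).
Proof.
move=> [g hg] [g' hg']; exists (fun u => [seq (k * c.1, c.2) | c <- g u] ++ g' u) => u v hv.
rewrite big_cat big_map /= hg // hg' //; congr (_ + _).
by rewrite scaler_sumr; apply: eq_bigr => c _; rewrite scalerA.
Qed.

Lemma local_mul i S T : local_op i S -> local_op i T -> local_op i (S * T).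
Proof.
move=> [g hg] [g' hg'].
exists (fun u => flatten [seq [seq (c.1 * e.1, e.2) | e <- g c.2] | c <- g' u]) => u v hv.
rewrite big_flatten big_map /= hg' // opf_vsum; apply: eq_bigr => c _.
rewrite opfZ hg // big_map scaler_sumr; apply: eq_bigr => e _.
by rewrite scalerA.
Qed.

Lemma local_create i b : local_op i (a (letter i b)).
Proof. by exists (fun u => [:: (1, b :: u)]) => u v _; rewrite big_seq1 scale1r. Qed.

Lemma local_annihilate i b : local_op i (op_star (a (letter i b))).
Proof.
exists (fun u => if u is b' :: u' then [:: ((b == b')%:R, u')] else [::]) => -[|b' u] v hv.
  by rewrite big_nil /= hv.
by rewrite big_seq1 /= a_rel letter_eq.
Qed.

Lemma local_gcirc i : local_op i (gcirc_elt i).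
Proof.
apply: local_lin; first exact: (local_create i true).
rewrite -[_ *: _]addr0; apply: local_lin; first exact: (local_annihilate i false).
by exists (fun=> [::]) => u v _; rewrite big_nil.
Qed.

Lemma local_gcirc_star i : local_op i (op_star (gcirc_elt i)).
Proof.
rewrite op_starD !op_starZ op_starK.
apply: local_lin; first exact: (local_annihilate i true).
rewrite -[_ *: _]addr0; apply: local_lin; first exact: (local_create i false).
by exists (fun=> [::]) => u v _; rewrite big_nil.
Qed.

Let y i : compl E := embed (gcirc_elt i).

Lemma gen_star_local i b : gen_star_subalgebra [set y i] b ->
  exists2 T, b = embed T & local_op i T.
Proof.
(* The adjoint is required to be local as well, so that the set is closed under the star. *)
pose D : set (compl E) := [set b | exists T,
  [/\ b = embed T, local_op i T & local_op i (op_star T)]].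
move=> /(_ D) h; suff : D b by case=> T [-> hT _]; exists T.
apply: h; split; last first.
  move=> _ ->; exists (gcirc_elt i); split=> //.
  - exact: local_gcirc.
  - exact: local_gcirc_star.
split.
- by exists 1; split=> //; [exact: local_one|rewrite op_star1; exact: local_one].
- move=> k _ _ [S [-> h1 h2]] [T [-> k1 k2]]; exists (k *: S + T); split.
  + by rewrite raddfD /= embedZ.
  + exact: local_lin.
  + by rewrite op_starD op_starZ; exact: local_lin.
- move=> _ _ [S [-> h1 h2]] [T [-> k1 k2]]; exists (S * T); split.
  + by rewrite rmorphM.
  + exact: local_mul.
  + by rewrite op_starM; exact: local_mul.
- by move=> _ [S [-> h1 h2]]; exists (op_star S); rewrite embed_star op_starK.
Qed.

Lemma ip_vac_create l x : ip vac (opf (a l) x) = 0.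
Proof. by rewrite -op_adj2 a_vac ip_conj ip0r rmorph0. Qed.

(** On vectors killed by the letters of [i], a local T is a fixed multiple of the identity plus
    words beginning with such a letter. The multiple is the vacuum expectation of T, hence 0. *)
Lemma local_centered i T v : local_op i T -> vexp T = 0 -> killed i v ->
  ip vac (opf T v) = 0 /\ forall j, j != i -> killed j (opf T v).
Proof.
move=> [g hg] T0 hv; pose r := [seq c <- g [::] | c.2 != [::]].
have Tv w : killed i w -> opf T w =
    (\sum_(c <- g [::] | c.2 == [::]) c.1) *: w + \sum_(c <- r) c.1 *: aword i c.2 w.
  move=> hw; have := hg [::] w hw; rewrite {1}/aword /= => ->.
  rewrite (bigID (fun c => c.2 == [::])) /= big_filter; congr (_ + _).
  by rewrite scaler_suml; apply: eq_bigr => c /eqP ->.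
have ncons c : c \in r -> exists b u, c.2 = b :: u.
  by rewrite mem_filter; case: c => k [|b u] //= _; exists b, u.
have orth w : ip vac (\sum_(c <- r) c.1 *: aword i c.2 w) = 0.
  rewrite big_seq; elim/big_ind: _ => [|x z hx hz|c cr]; first exact: ip0r.
    by rewrite ipDr hx hz addr0.
  by have [b [u ->]] := ncons c cr; rewrite ipZr /= ip_vac_create mulr0.
(* Evaluation at the vacuum isolates the coefficient of the empty word. *)
have c0 : \sum_(c <- g [::] | c.2 == [::]) c.1 = 0.
  have := T0; rewrite /vexp (Tv _ (killed_vac i)) ipDr orth addr0 ipZr ip_vac.
  by rewrite mulr1.
rewrite Tv // c0 scale0r add0r; split=> // j ji b.
rewrite opg_sum big_seq big1 // => c cr.
have [b' [u ->]] := ncons c cr.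
by rewrite opgZ /= a_rel letter_neq // scale0r scaler0.
Qed.

(** Read from the right: each centered factor takes a vector killed by its own letters to one that
    begins with them, hence is killed by the letters of the next index. *)
Lemma alternating_product (p : I * compl E) w :
  sorted (fun p q => p.1 != q.1) (p :: w) ->
  (forall q, q \in p :: w -> gen_star_subalgebra [set y q.1] q.2 /\ qstate q.2 = 0) ->
  exists T : op E, [/\ \prod_(q <- p :: w) q.2 = embed T, ip vac (opf T vac) = 0
    & forall j, j != p.1 -> killed j (opf T vac)].
Proof.
elim: w p => [|q w IH] p hs hw.
all: have [/gen_star_local [S ep lS]] := hw p (mem_head _ _).
all: rewrite ep qstate_embed => S0.
  exists S; rewrite big_seq1 ep.
  by have [h1 h2] := local_centered lS S0 (killed_vac p.1).
have /andP[pq hs'] : (p.1 != q.1) && sorted (fun p q => p.1 != q.1) (q :: w) by [].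
have [|T [eT _ hT]] := IH q hs'.
  by move=> r rw; apply: hw; rewrite in_cons rw orbT.
exists (S * T); rewrite big_cons eT ep rmorphM.
by have [h1 h2] := local_centered lS S0 (hT _ pq).
Qed.

Lemma gcirc_free : free_family (@qstate R E) y.
Proof.
move=> [//|p w] _ sw hw.
by have [T [-> T0 _]] := alternating_product sw hw; rewrite qstate_embed.
Qed.

Lemma gcirc_elt_vac i : opf (gcirc_elt i) vac = (al i)%:C *: opf (a (s i)) vac.
Proof. by rewrite /= a_vac scaler0 addr0. Qed.

Lemma gcirc_left_variance i : qstate (star (y i) * y i) = (al i ^+ 2)%:C.
Proof.
rewrite embed_star -rmorphM qstate_embed /vexp -[opf _ _]/(opg _ (opf _ _)) -op_adj.
rewrite gcirc_elt_vac ipZl ipZr op_adj a_rel eqxx scale1r ip_vac conj_real mulr1.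
by rewrite -real_complexM expr2.
Qed.

Lemma gcirc_right_variance i : qstate (y i * star (y i)) = (be i ^+ 2)%:C.
Proof.
rewrite embed_star -rmorphM qstate_embed /vexp -[opf _ _]/(opf _ (opg _ _)) -op_adj2.
rewrite /= a_vac scaler0 add0r !conj_real ipZl ipZr op_adj a_rel eqxx scale1r ip_vac.
by rewrite conj_real mulr1 -real_complexM expr2.
Qed.

(** The component of x along the word u in the two letters of [i], found by annihilating the letters
    of u in turn. It carries E to the full Fock space over C^2, [s i] going to the first basis
    vector and [t i] to the second. *)
Definition coord i (x : E) (u : seq 'I_2) : K :=
  ip vac (foldl (fun z (b : 'I_2) => opg (a (letter i (b == ord0))) z) x u).

Let e0 : 'cV[K]_2 := delta_mx ord0 0.
Let e1 : 'cV[K]_2 := delta_mx ord_max 0.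

Lemma coord_lin i k x z u : coord i (k *: x + z) u = k * coord i x u + coord i z u.
Proof.
elim: u x z => [|b u IH] x z; first exact: ip_linearr.
by rewrite /coord /= opg_lin -/(coord i _ u) IH.
Qed.

Lemma coordD i x z u : coord i (x + z) u = coord i x u + coord i z u.
Proof. by have := coord_lin i 1 x z u; rewrite scale1r mul1r. Qed.

Lemma coord0 i u : coord i 0 u = 0.
Proof. by apply: (addrI (coord i 0 u)); rewrite -coordD !addr0. Qed.

Lemma coordZ i k x u : coord i (k *: x) u = k * coord i x u.
Proof. by have := coord_lin i k x 0 u; rewrite !addr0 coord0 addr0. Qed.

Lemma coord_create i b x :
  coord i (opf (a (letter i b)) x) = creation (if b then e0 else e1) (coord i x).
Proof.
apply/funext => -[|j u] /=; first exact: ip_vac_create.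
rewrite /coord /= a_rel letter_eq -/(coord i _ u) coordZ -/(coord i _ u).
congr (_ * _); case: b; rewrite !mxE eqxx andbT ?(eq_sym true) ?eqb_id //.
by case: j => -[|[|//]].
Qed.

Lemma coord_annihilate i b x :
  coord i (opg (a (letter i b)) x) = annihilation (if b then e0 else e1) (coord i x).
Proof.
apply/funext => u; rewrite /annihilation !big_ord_recl big_ord0 addr0.
by case: b; rewrite !mxE /= ?rmorph0 ?rmorph1 ?mul0r ?mul1r ?addr0 ?add0r.
Qed.

Lemma coord_vac i : coord i vac = @vacuum R 2.
Proof.
apply/funext => -[|j u]; first by rewrite /coord /= ip_vac.
by rewrite /coord /= a_vac -/(coord i 0 u) coord0.
Qed.

(** [coord i] intertwines the element and its adjoint with [gcirc_op], and its value at the empty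
    word is the vacuum expectation. *)
Lemma gcirc_generalized i : 0 < al i -> 0 < be i ->
  generalized_circular (@qstate R E) (al i) (be i) (y i).
Proof.
move=> al0 be0; split=> //; exists 2, e0, e1; split.
  split; rewrite /inner !big_ord_recl big_ord0 !mxE /= ?rmorph0 ?rmorph1;
  by rewrite ?mul0r ?mulr0 ?mul1r ?add0r ?addr0.
pose T b := if b then op_star (gcirc_elt i) else gcirc_elt i.
have step b x : coord i (opf (T b) x) = gcirc_op (al i) (be i) e0 e1 b (coord i x).
  rewrite /gcirc_op; apply/funext => u.
  case: b; rewrite /T /= coordD !coordZ ?conj_real.
    by rewrite -(coord_create i false) -(coord_annihilate i true).
  by rewrite -(coord_create i true) -(coord_annihilate i false).
move=> w.
have -> : \prod_(b <- w) star_if b (y i) = embed (\prod_(b <- w) T b).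
  rewrite rmorph_prod; apply: eq_bigr => -[] _ //=.
  by rewrite /y embed_star.
rewrite qstate_embed /gcirc_moment -(coord_vac i).
suff -> : foldr (gcirc_op (al i) (be i) e0 e1) (coord i vac) w
  = coord i (opf (\prod_(b <- w) T b) vac) by [].
by elim: w => [|b w IH]; rewrite ?big_nil // big_cons /= IH -step.
Qed.

End FreeCreation.

(** * Convergence of the vacuum moments *)

Section MatrixConvergence.
Variables (R : realType) (T : Type) (F : set_system T).
Context {FF : Filter F}.
Local Notation K := R[i].

Lemma cvg_real_complex (g : T -> R) (l : R) :
  g @ F --> l -> (fun x => (g x)%:C : K^o) @ F --> (l%:C : K^o).
Proof.
move=> /cvgrPdist_lt h; apply/cvgrPdist_lt => e e0.
have e1 : 0 < complex.Re e by move: e0; rewrite ltcE => /andP[_].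
have eE : e = (complex.Re e)%:C by exact: ge0_ReE (ltW e0).
have := h _ e1; apply: filterS => x hx.
by rewrite -real_complexB -normc_normr normc_real eE ltcR.
Qed.

Definition mcvg m n (A : T -> 'M[K]_(m, n)) (B : 'M[K]_(m, n)) :=
  forall i j, (fun x => A x i j : K^o) @ F --> (B i j : K^o).

Lemma cvg_finite_sum (I : finType) (g : I -> T -> K^o) (l : I -> K^o) :
  (forall i, g i @ F --> l i) ->
  (fun x => \sum_i g i x : K^o) @ F --> (\sum_i l i : K^o).
Proof.
move=> h; elim: (index_enum I) => [|i r IH].
  rewrite big_nil (_ : (fun _ => _) = (fun=> 0)); first exact: cvg_cst.
  by apply/funext => x; rewrite big_nil.
rewrite big_cons (_ : (fun _ => _) = (fun x => g i x + \sum_(j <- r) g j x)).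
  exact: cvgD (h i) IH.
by apply/funext => x; rewrite big_cons.
Qed.

Lemma mcvg_cst m n (A : 'M[K]_(m, n)) : mcvg (fun=> A) A.
Proof. by move=> i j; exact: cvg_cst. Qed.

Lemma mcvgM m n p (A : T -> 'M[K]_(m, n)) (B : T -> 'M[K]_(n, p)) A0 B0 :
  mcvg A A0 -> mcvg B B0 -> mcvg (fun x => A x *m B x) (A0 *m B0).
Proof.
move=> hA hB i j; rewrite mxE.
rewrite (_ : (fun _ => _) = (fun x => \sum_k (A x i k * B x k j : K^o) : K^o)).
  by apply: cvg_finite_sum => k; exact: cvgM (hA i k) (hB k j).
by apply/funext => x; rewrite mxE.
Qed.

Lemma mcvgD m n (A B : T -> 'M[K]_(m, n)) A0 B0 :
  mcvg A A0 -> mcvg B B0 -> mcvg (fun x => A x + B x) (A0 + B0).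
Proof.
move=> hA hB i j; rewrite mxE.
rewrite (_ : (fun _ => _) = (fun x => A x i j + B x i j : K^o)).
  exact: cvgD (hA i j) (hB i j).
by apply/funext => x; rewrite mxE.
Qed.

Lemma mcvgZ m n (c : T -> K^o) (c0 : K^o) (A : T -> 'M[K]_(m, n)) A0 :
  c @ F --> c0 -> mcvg A A0 -> mcvg (fun x => c x *: A x) (c0 *: A0).
Proof.
move=> hc hA i j; rewrite mxE.
rewrite (_ : (fun _ => _) = (fun x => c x * A x i j : K^o)).
  exact: cvgM hc (hA i j).
by apply/funext => x; rewrite mxE.
Qed.

Lemma mcvgZr m n (c : T -> R) (c0 : R) (A : T -> 'M[K]_(m, n)) A0 :
  c @ F --> c0 -> mcvg A A0 -> mcvg (fun x => (c x)%:C *: A x) (c0%:C *: A0).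
Proof. by move=> /cvg_real_complex hc hA; exact: mcvgZ. Qed.

Lemma mcvgN m n (A : T -> 'M[K]_(m, n)) A0 :
  mcvg A A0 -> mcvg (fun x => - A x) (- A0).
Proof.
move=> hA; rewrite -scaleN1r (_ : (fun _ => _) = (fun x => (-1) *: A x)).
  exact: mcvgZ (@cvg_cst _ (-1 : K^o) _ F _) hA.
by apply/funext => x; rewrite scaleN1r.
Qed.

Lemma mcvg_sum (I : finType) m n (A : I -> T -> 'M[K]_(m, n)) A0 :
  (forall i, mcvg (A i) (A0 i)) ->
  mcvg (fun x => \sum_i A i x) (\sum_i A0 i).
Proof.
move=> h; elim: (index_enum I) => [|i r IH].
  rewrite big_nil (_ : (fun _ => _) = (fun=> 0)); first exact: mcvg_cst.
  by apply/funext => x; rewrite big_nil.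
rewrite big_cons (_ : (fun _ => _) = (fun x => A i x + \sum_(j <- r) A j x)).
  exact: mcvgD (h i) IH.
by apply/funext => x; rewrite big_cons.
Qed.

End MatrixConvergence.

Section FockData.
Variables (R : realType) (N : nat).
Local Notation K := R[i].
Local Notation d := (tdim N).
Local Notation C := (@shift_mx R N _).

Lemma free_idem n : (1%:M : 'M[K]_(d n)) *m 1%:M = 1%:M.
Proof. exact: mulmx1. Qed.
Lemma free_shift n i : 1%:M *m (adjm (C i) *m (1%:M : 'M[K]_(d n.+1))) = adjm (C i) *m 1%:M.
Proof. exact: mul1mx. Qed.
Lemma free_wS (n : nat) : 1 = 1 * 1 :> R. Proof. by rewrite mulr1. Qed.

Definition free_data : fock_data R N :=
  @FockData R N (fun n => 1%:M) (fun=> 1) (fun=> 1) (fun n => adjm1 _ _)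
    free_idem erefl free_shift erefl free_wS (fun=> ltr01) (fun=> lexx 1).

Lemma free_cr_rel i j i' j' (x : weighted_fock free_data) :
  opg (cr free_data i j) (opf (cr free_data i' j') x)
  = ((i, j) == (i', j'))%:R *: x.
Proof.
apply: gvec_eq => n; rewrite gvZE /= /lower_seq /= scale1r !mulmx1 mul1mx.
rewrite !mulmxA adj_shift_mul -!scalemxAl mul1mx -mulmxA adj_shift_mul.
rewrite -scalemxAr mulmx1 scalerA xpair_eqE eq_sym [j == _]eq_sym.
by case: (i' == i); case: (j' == j); rewrite ?mulr1 ?mulr0 // ?mul0r.
Qed.

Lemma free_cr_vac i j : opg (cr free_data i j) (vac : weighted_fock free_data) = 0.
Proof.
by apply: gvec_eq => n; rewrite gv0E /= /lower_seq /= mulmx0 mul0mx.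
Qed.

End FockData.

(** * Limits of the projections and of the word vectors *)

Section Limit.
Variables (R : realType) (N : nat) (inv : 'I_N -> 'I_N).
Variables (F : set_system R) (f : R -> 'I_N -> R) (f0 : 'I_N -> R).
Variables (S : pred 'I_N) (lam : 'I_N -> 'I_N -> R).
Context {FF : ProperFilter F}.
Local Notation K := R[i].
Local Notation d := (tdim N).
Local Notation C := (@shift_mx R N _).

Hypothesis S_inv : forall i, S i -> S (inv i).
Hypothesis f_S : forall g i, S i -> f g i = f0 i.
Hypothesis f_lam : forall a b,
  (fun g => (normF (f g))^-1 * ((f g a)^-1 * (f g b)^-1)) @ F --> lam a b.
Hypothesis lam_S : forall a b, S a || S b -> lam a b = 0.
Hypothesis normF_cvg : (fun g => (normF (f g))^-1) @ F --> (0 : R).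
Hypothesis normF_near : \forall g \near F, 0 < normF (f g).

Lemma jwcE g n : 0 < normF (f g) ->
  jwc (f g) n.+1 = (normF (f g))^-1 * (1 - jwc (f g) n * (normF (f g))^-1)^-1.
Proof.
move=> h /=; rewrite -invfM mulrBr mulr1 mulrCA divff ?mulr1 //.
by rewrite gt_eqF.
Qed.

(** N_F c_(n+1) = 1 / (1 - c_n / N_F), where c_n tends to 0 by induction because 1 / N_F does. *)
Lemma normF_jwc_cvg n : (fun g => normF (f g) * jwc (f g) n.+1) @ F --> (1 : R).
Proof.
have key m : (fun g => jwc (f g) m) @ F --> (0 : R) ->
   (fun g => normF (f g) * jwc (f g) m.+1) @ F --> (1 : R).
  move=> h.
  have h2 : (fun g => (1 - jwc (f g) m * (normF (f g))^-1)^-1) @ F --> (1 : R).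
    rewrite -[X in _ --> X]invr1; apply: cvgV; first exact: oner_neq0.
    rewrite -[X in _ --> X]subr0 -[X in _ - X](mulr0 (0 : R)).
    by apply: cvgB; [exact: cvg_cst|exact: cvgM].
  apply: cvg_trans h2; apply: near_eq_cvg.
  near=> g; rewrite jwcE; last by near: g.
  by rewrite mulVKf // gt_eqF //; near: g.
apply: (key n); elim: n => [|n IH]; first exact: cvg_cst.
have h : (fun g => (normF (f g))^-1 * (normF (f g) * jwc (f g) n.+1)) @ F --> (0 : R).
  by rewrite -[X in _ --> X](mul0r (1 : R)); exact: cvgM normF_cvg (key _ IH).
apply: cvg_trans h.
apply: near_eq_cvg; near=> g.
by rewrite /= mulKf // gt_eqF //; near: g.
Unshelve. all: by end_near. Qed.

Lemma jwc_lam_cvg n a b :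
  (fun g => jwc (f g) n.+1 * ((f g a)^-1 * (f g b)^-1)) @ F --> lam a b.
Proof.
have h : (fun g => (normF (f g) * jwc (f g) n.+1)
    * ((normF (f g))^-1 * ((f g a)^-1 * (f g b)^-1))) @ F --> lam a b.
  rewrite -[lam a b]mul1r; exact: (cvgM (normF_jwc_cvg n) (f_lam (a:=a) (b:=b))).
apply: cvg_trans h.
apply: near_eq_cvg; near=> g.
by rewrite /= mulrACA mulfV ?mul1r // gt_eqF //; near: g.
Unshelve. all: by end_near. Qed.

Definition restr_step m (Q : 'M[K]_m) : 'M[K]_(N * m) :=
  \sum_(i | S i) C i *m Q *m adjm (C i).

(* Projection onto the words in restricted letters; it is fixed by the limits of
   the Jones-Wenzl projections. *)
Fixpoint restr n : 'M[K]_(d n) :=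
  if n is m.+1 then restr_step (restr m) else 1%:M.

Lemma restr_shift n i : S i -> restr n.+1 *m C i = C i *m restr n.
Proof.
move=> Si; rewrite /= mulmx_suml (bigD1 i) //= big1 => [|j /andP[_ ji]].
  by rewrite addr0 -!mulmxA adj_shiftK mulmx1.
by rewrite -!mulmxA adj_shift_mul (negPf ji) scale0r !mulmx0.
Qed.

Lemma shift_restr n i :
  adjm (C i) *m restr n.+1 = (S i)%:R *: (restr n *m adjm (C i)).
Proof.
rewrite /= mulmx_sumr; have [Si|nSi] := boolP (S i).
  rewrite (bigD1 i) //= big1 => [|j /andP[_ ji]].
    by rewrite addr0 !mulmxA adj_shiftK mul1mx scale1r.
  by rewrite !mulmxA adj_shift_mul eq_sym (negPf ji) scale0r !mul0mx.
rewrite scale0r big1 // => j Sj; rewrite !mulmxA adj_shift_mul.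
case: eqP => [e|_]; last by rewrite scale0r !mul0mx.
by rewrite e Sj in nSi.
Qed.

Lemma restr_adj n : adjm (restr n) = restr n.
Proof.
elim: n => [|n IH]; first exact: adjm1.
rewrite /= /restr_step (big_morph (@adjm R _ _) (@adjmD R _ _) (@adjm0 R _ _)).
by apply: eq_bigr => i _; rewrite !adjmM adjmK IH mulmxA.
Qed.

Lemma lift1_restr n (M : 'M[K]_(d n)) : M *m restr n = restr n ->
  lift1 N M *m restr n.+1 = restr n.+1.
Proof.
move=> h; rewrite /= mulmx_sumr; apply: eq_bigr => i _.
by rewrite !mulmxA lift1_shift -(mulmxA (C i)) h.
Qed.

Lemma restr_lift1 n (M : 'M[K]_(d n)) : restr n *m M = restr n ->
  restr n.+1 *m lift1 N M = restr n.+1.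
Proof.
move=> h; rewrite -[restr n.+1]restr_adj -[lift1 N M]adjmK -adjmM adj_lift1.
by rewrite lift1_restr // -[restr n]restr_adj -adjmM h.
Qed.

Lemma restr_shift_all n a : restr n.+1 *m C a = (S a)%:R *: (C a *m restr n).
Proof.
rewrite -[restr n.+1]restr_adj -[C a]adjmK -adjmM shift_restr adjmZ adjmM.
by rewrite adjmK restr_adj rmorph_nat.
Qed.

(** The recursion passes to the limit with coefficients [lam]. These vanish as soon as one of the
    two letters is restricted, so the subtracted term dies on restricted words from either side. *)
Lemma jwp_cvg n : exists M : 'M[K]_(d n),
  [/\ mcvg F (fun g => jwp inv (f g) n) M, M *m restr n = restr n
    & restr n *m M = restr n].
Proof.
elim: n => [|[|n] [M [hM MQ QM]]].
- by exists 1%:M; split; [exact: mcvg_cst|rewrite mul1mx|rewrite mulmx1].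
- exists 1%:M; split; [|by rewrite mul1mx|by rewrite mulmx1].
  by rewrite /jwp; under eq_fun do rewrite jw1; exact: mcvg_cst.
(* The limit of c times the cup times its adjoint. Only products of two coefficients converge, so
   both sums are expanded before the limit is taken. *)
pose L : 'M[K]_(d n.+2) := \sum_a \sum_b (lam a b)%:C *:
  (C a *m C (inv a) *m adjm (C (inv b)) *m adjm (C b)).
have hT : mcvg F (fun g => lift1 N (jwp inv (f g) n.+1)) (lift1 N M).
  apply: mcvg_sum => a; apply: mcvgM; last exact: mcvg_cst.
  by apply: mcvgM => //; exact: mcvg_cst.
have hL : mcvg F (fun g => (jwc (f g) n.+1)%:C *: (cup inv (f g) (d n) *m adjm (cup inv (f g) (d n)))) L.
  rewrite (_ : (fun _ => _) = (fun g => \sum_a \sum_b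
    (jwc (f g) n.+1 * ((f g a)^-1 * (f g b)^-1))%:C *:
    (C a *m C (inv a) *m adjm (C (inv b)) *m adjm (C b)))).
    apply: mcvg_sum => a; apply: mcvg_sum => b.
    by apply: mcvgZr; [exact: jwc_lam_cvg|exact: mcvg_cst].
  apply/funext => g; rewrite adj_cup mulmx_suml scaler_sumr; apply: eq_bigr => a _.
  rewrite mulmx_sumr scaler_sumr; apply: eq_bigr => b _.
  by rewrite -scalemxAl -scalemxAr !scalerA -!real_complexM !mulmxA mulrA.
exists (lift1 N M - lift1 N M *m L *m lift1 N M); split.
- rewrite (_ : (fun _ => _) = (fun g => lift1 N (jwp inv (f g) n.+1)
      + - (lift1 N (jwp inv (f g) n.+1)
        *m ((jwc (f g) n.+1)%:C *: (cup inv (f g) (d n) *m adjm (cup inv (f g) (d n))))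
        *m lift1 N (jwp inv (f g) n.+1)))).
    exact: mcvgD hT (mcvgN (mcvgM (mcvgM hT hL) hT)).
  apply/funext => g; rewrite /jwp jwSS adjmM adj_lift1 jw_adj.
  by rewrite -scalemxAr -scalemxAl !mulmxA.
- have e : lift1 N M *m restr n.+2 = restr n.+2 := lift1_restr MQ.
  rewrite mulmxBl e -(mulmxA _ (lift1 N M)) e -mulmxA.
  rewrite (_ : L *m _ = 0) ?mulmx0 ?subr0 //.
  rewrite mulmx_suml big1 // => a _; rewrite mulmx_suml big1 // => b _.
  rewrite -scalemxAl -(mulmxA _ (adjm (C b)) (restr n.+2)) (shift_restr n.+1 b).
  have [Sb|] := boolP (S b); last by rewrite scale0r mulmx0 scaler0.
  by rewrite lam_S ?Sb ?orbT // scale0r.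
have e' : restr n.+2 *m lift1 N M = restr n.+2 := restr_lift1 QM.
rewrite mulmxBr e' !mulmxA e'.
rewrite (_ : _ *m L = 0) ?mul0mx ?subr0 //.
rewrite mulmx_sumr big1 // => a _; rewrite mulmx_sumr big1 // => b _.
rewrite -scalemxAr !mulmxA (restr_shift_all n.+1 a).
have [Sa|] := boolP (S a); last by rewrite scale0r !mul0mx scaler0.
by rewrite lam_S ?Sa // scale0r.
Qed.

(** The vector of a word of generators with its data as bare sequences. Unlike a [fock_data], they
    make sense for every parameter, also where positivity fails, so limits can be taken
    entrywise. *)
Fixpoint wvec (h : 'I_N -> R) (P : forall n, 'M[K]_(d n)) (c : nat -> R)
    (I J : seq 'I_N) n : 'M[K]_(d n) :=
  match I, J with
  | i :: I', j :: J' =>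
    (h i)%:C *: prev_level n (fun p => C i *m wvec h P c I' J' p *m adjm (C j))
    + ((h j)^-1)%:C *: ((c n.+1)%:C *:
      (adjm (C (inv i)) *m P n.+1 *m wvec h P c I' J' n.+1 *m (P n.+1 *m C (inv j))))
  | _, _ => gvac_seq R N n
  end.

Lemma wvecE h (W : fock_data R N) I J n : 
  (opf (wprod (gen inv h W) I J) (gvac R N) : gvec R N) n
  = wvec h (fdP W) (fdc W) I J n.
Proof.
elim: I J n => [|i I IH] [|j J] n //.
rewrite [LHS](@gen_levelE R N inv h W i j) /= IH; congr (_ *: _ + _).
by case: n => [//|n]; rewrite /= IH.
Qed.

Lemma vexp_wvec h (W : fock_data R N) I J :
  vexp (wprod (gen inv h W) I J) = \tr (wvec h (fdP W) (fdc W) I J 0).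
Proof. by rewrite /vexp /= gip_vac wvecE. Qed.

Let one_c (n : nat) : R := 1.
Let one_P n : 'M[K]_(d n) := 1%:M.

Lemma wvec_restr I J n : all S I -> all S J ->
  restr n *m wvec f0 one_P one_c I J n *m restr n = wvec f0 one_P one_c I J n.
Proof.
elim: I J n => [|i I IH] [|j J] n //.
1-3: by move=> _ _ /=; case: n => [|n] /=; rewrite ?mulmx1 ?mulmx0 ?mul0mx.
move=> /andP[Si SI] /andP[Sj SJ] /=.
rewrite mulmxDr mulmxDl -!scalemxAr -!scalemxAl !mulmx1 mul1mx; congr (_ *: _ + _ *: (_ *: _)).
  case: n => [|n]; first by rewrite /= mulmx0 mul0mx.
  rewrite [prev_level _ _]/=; set w := wvec _ _ _ _ _ _.
  transitivity (C i *m (restr n *m w *m restr n) *m adjm (C j)); last by rewrite IH.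
  rewrite !mulmxA restr_shift // -(mulmxA _ (adjm (C j)) (restr n.+1)) shift_restr Sj.
  by rewrite scale1r !mulmxA.
set w := wvec _ _ _ _ _ _.
transitivity (adjm (C (inv i)) *m (restr n.+1 *m w *m restr n.+1) *m C (inv j)); last first.
  by rewrite IH.
rewrite -[LHS]mulmxA -!mulmxA -restr_shift ?S_inv // !mulmxA shift_restr S_inv //.
by rewrite scale1r.
Qed.

Lemma mcvg_near m n (A B : R -> 'M[K]_(m, n)) M :
  (\forall g \near F, A g = B g) -> mcvg F A M -> mcvg F B M.
Proof.
move=> h hA i j; apply: cvg_trans (hA i j); apply: near_eq_cvg.
by apply: filterS h => g ->.
Qed.

Let s g := Num.sqrt (normF (f g)).

Arguments jwc : simpl never.

(* Level n is divided by sqrt(normF)^n, the size of a creation operator. *)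
Definition scaled_wvec g I J n : 'M[K]_(d n) :=
  (s g ^+ size I * s g ^- n)%:C *: wvec (f g) (jwp inv (f g)) (jwc (f g)) I J n.

(** The scaling leaves the creation coefficient f_i alone; annihilation starts one level higher and
    gains N_F, which joins [jwc] in the product that tends to 1. *)
Lemma scaled_wvec_cons g i j I J n : 0 < normF (f g) -> S i -> S j ->
  scaled_wvec g (i :: I) (j :: J) n =
  (f0 i)%:C *: prev_level n (fun p => C i *m scaled_wvec g I J p *m adjm (C j))
  + ((f0 j)^-1)%:C *: ((normF (f g) * jwc (f g) n.+1)%:C *:
     (adjm (C (inv i)) *m jwp inv (f g) n.+1 *m scaled_wvec g I J n.+1
       *m (jwp inv (f g) n.+1 *m C (inv j)))).
Proof.
move=> h Si Sj; have s0 : s g != 0 by rewrite gt_eqF // sqrtr_gt0.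
have ss : normF (f g) = s g ^+ 2 by rewrite sqr_sqrtr // ltW.
rewrite /scaled_wvec /= !f_S // scalerDr !scalerA -!real_complexM; congr (_ + _).
  case: n => [|n]; first by rewrite /= !scaler0.
  rewrite /= -scalemxAr -scalemxAl scalerA -real_complexM; congr (_%:C *: _).
  by rewrite exprS exprSr invfM; field; rewrite s0 expf_neq0.
rewrite -scalemxAr -scalemxAl scalerA -real_complexM; congr (_%:C *: _).
rewrite ss !exprS expr0 !invfM; move: (f0 j)^-1 => q.
by field; rewrite s0 expf_neq0.
Qed.

Lemma scaled_wvec_cvg I J n : all S I -> all S J -> size I = size J ->
  mcvg F (fun g => scaled_wvec g I J n) (wvec f0 one_P one_c I J n).
Proof.
elim: I J n => [|i I IH] [|j J] n //.
  move=> _ _ _; case: n => [|n] /=.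
    rewrite (_ : (fun _ => _) = (fun=> 1%:M)); first exact: mcvg_cst.
    by apply/funext => g; rewrite /scaled_wvec /= expr0 invr1 mulr1 scale1r.
  rewrite (_ : (fun _ => _) = (fun=> 0)); first exact: mcvg_cst.
  by apply/funext => g; rewrite /scaled_wvec /= scaler0.
move=> /andP[Si SI] /andP[Sj SJ] [sIJ].
apply: (@mcvg_near _ _ (fun g =>
  (f0 i)%:C *: prev_level n (fun p => C i *m scaled_wvec g I J p *m adjm (C j))
  + ((f0 j)^-1)%:C *: ((normF (f g) * jwc (f g) n.+1)%:C *:
     (adjm (C (inv i)) *m jwp inv (f g) n.+1 *m scaled_wvec g I J n.+1
       *m (jwp inv (f g) n.+1 *m C (inv j)))))).
  by apply: filterS normF_near => g h; rewrite scaled_wvec_cons.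
have [M [hM MQ QM]] := jwp_cvg n.+1.
(* The limit vector is supported on restricted words, which M fixes, so M can be inserted on both
   sides. *)
have -> : wvec f0 one_P one_c (i :: I) (j :: J) n =
  (f0 i)%:C *: prev_level n (fun p => C i *m wvec f0 one_P one_c I J p *m adjm (C j))
  + ((f0 j)^-1)%:C *: (1%:C *: (adjm (C (inv i)) *m M *m
      wvec f0 one_P one_c I J n.+1 *m (M *m C (inv j)))).
  rewrite /=; congr (_ + _ *: (_ *: _)); rewrite mulmx1 mul1mx.
  rewrite -wvec_restr //; set w := wvec _ _ _ _ _ _.
  transitivity (adjm (C (inv i)) *m (M *m restr n.+1) *m w *m (restr n.+1 *m M) *m C (inv j)).
    by rewrite MQ QM !mulmxA.
  by rewrite !mulmxA.
apply: mcvgD.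
  apply: mcvgZ; first exact: cvg_cst.
  case: n {hM MQ QM M} => [|n] /=; first exact: mcvg_cst.
  apply: mcvgM; last exact: mcvg_cst.
  by apply: mcvgM; [exact: mcvg_cst|exact: IH].
apply: mcvgZ; first exact: cvg_cst.
apply: mcvgZr; first exact: normF_jwc_cvg.
apply: mcvgM; last by apply: mcvgM => //; exact: mcvg_cst.
apply: mcvgM; last exact: IH.
by apply: mcvgM => //; exact: mcvg_cst.
Qed.

Lemma moment_cvg I J (mu : R -> K) : all S I -> all S J -> size I = size J ->
  (\forall g \near F, mu g = \tr (wvec (f g) (jwp inv (f g)) (jwc (f g)) I J 0)) ->
  (fun g => (s g ^+ size I)%:C * mu g : K^o) @ F
    --> (vexp (wprod (gen inv f0 (free_data R N)) I J) : K^o).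
Proof.
move=> SI SJ sIJ hmu; rewrite vexp_wvec /mxtrace.
have h : (fun g => \sum_a scaled_wvec g I J 0 a a : K^o) @ F
    --> (\sum_a wvec f0 one_P one_c I J 0 a a : K^o).
  by apply: cvg_finite_sum => a; exact: scaled_wvec_cvg.
apply: cvg_trans h; apply: near_eq_cvg; apply: filterS hmu => g ->.
rewrite /scaled_wvec expr0 invr1 mulr1 -mxtraceZ.
by apply: eq_bigr => a _; rewrite !mxE.
Qed.

End Limit.

(** * The deformed matrix *)

Section StarWords.
Variables (R : realType) (N : nat) (inv : 'I_N -> 'I_N) (f : 'I_N -> R).
Variables (A : cstarType R) (U : 'I_N -> 'I_N -> A).
Hypothesis U_star : forall i j, star (U i j) = (f i / f j)%:C *: U (inv i) (inv j).
Variables (I J : Type) (row : I -> 'I_N) (col : J -> 'I_N).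

Definition word_rows (w : seq ((I * J) * bool)) : seq 'I_N :=
  [seq if p.2 then inv (row p.1.1) else row p.1.1 | p <- w].
Definition word_cols (w : seq ((I * J) * bool)) : seq 'I_N :=
  [seq if p.2 then inv (col p.1.2) else col p.1.2 | p <- w].
Definition word_coef (w : seq ((I * J) * bool)) : R :=
  \prod_(p <- w) if p.2 then f (row p.1.1) / f (col p.1.2) else 1.

(** Each adjoint is traded for the dual generator, and the resulting factors are collected in
    [word_coef]. *)
Lemma prod_star_word (r : R) w :
  \prod_(p <- w) star_if p.2 (r%:C *: U (row p.1.1) (col p.1.2))
  = (r ^+ size w * word_coef w)%:C *: wprod U (word_rows w) (word_cols w).
Proof.
elim: w => [|p w IH]; first by rewrite /word_coef !big_nil mulr1 scale1r.
rewrite /word_coef !big_cons IH /= -/(word_coef w).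
have -> : star_if p.2 (r%:C *: U (row p.1.1) (col p.1.2)) =
  (r * if p.2 then f (row p.1.1) / f (col p.1.2) else 1)%:C *:
    U (if p.2 then inv (row p.1.1) else row p.1.1)
      (if p.2 then inv (col p.1.2) else col p.1.2).
  case: p.2; last by rewrite /= mulr1.
  by rewrite /star_if starZ conj_real U_star scalerA -real_complexM.
rewrite -scalerAl -scalerAr scalerA -real_complexM; congr (_%:C *: _).
by rewrite exprS mulrACA.
Qed.

End StarWords.

(** * The entries of F(gamma) and their asymptotics *)

Section FgammaMonomial.
Variables (R : realType) (k : nat) (rho : 'rV[R]_k).
Hypothesis hrho : forall i, 0 < rho 0 i < 1.
Local Notation K := R[i].
Local Notation N := (k + k + (1 + 1))%N.

Definition half_swap m (i : 'I_(m + m)) : 'I_(m + m) :=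
  match fintype.split i with inl a => rshift m a | inr a => lshift m a end.

Definition dual_index (i : 'I_N) : 'I_N :=
  match fintype.split i with
  | inl a => lshift (1 + 1) (half_swap a)
  | inr a => rshift (k + k) (half_swap a)
  end.

Definition entry (g : R) (i : 'I_N) : R :=
  match fintype.split i with
  | inl a => match fintype.split a with inl b => rho 0 b | inr b => (rho 0 b)^-1 end
  | inr a => match fintype.split a with inl _ => g | inr _ => g^-1 end
  end.

Lemma split_lshift m n (a : 'I_m) : fintype.split (lshift n a) = inl a.
Proof. exact: (unsplitK (inl a)). Qed.

Lemma split_rshift m n (a : 'I_n) : fintype.split (rshift m a) = inr a.
Proof. exact: (unsplitK (inr a)). Qed.

Let splitE := (split_lshift, split_rshift).

Lemma dual_indexK : involutive dual_index.
Proof.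
move=> i; rewrite /dual_index /half_swap.
by case: (split_ordP i) => a ->; rewrite !splitE; case: (split_ordP a) => b ->; rewrite !splitE.
Qed.

Lemma entry_gt0 g i : 0 < g -> 0 < entry g i.
Proof.
move=> g0; rewrite /entry; case: (fintype.split i) => a; case: (fintype.split a) => b;
by rewrite ?invr_gt0 //; case/andP: (hrho b).
Qed.

Lemma entry_dual g i : entry g (dual_index i) = (entry g i)^-1.
Proof.
rewrite /entry /dual_index /half_swap.
by case: (fintype.split i) => a; rewrite !splitE; case: (fintype.split a) => b;
  rewrite !splitE ?invrK.
Qed.

Lemma invmx_Dk : invmx (Dk rho) = diag_mx (\row_j ((rho 0 j)^-1)%:C).
Proof.
have e : Dk rho *m diag_mx (\row_j ((rho 0 j)^-1)%:C) = 1%:M.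
  apply/matrixP => i j; rewrite mul_diag_mx !mxE.
  case: eqP => [->|_]; last by rewrite mulr0n mulr0.
  rewrite mulr1n -real_complexM divff // gt_eqF //.
  by case/andP: (hrho j).
have [u _] := mulmx1_unit e.
by rewrite -[LHS]mulmx1 -e mulmxA mulVmx // mul1mx.
Qed.

Lemma Fgamma_monomial g : Fgamma rho g = monomial_mx dual_index (entry g).
Proof.
apply/matrixP => i j; rewrite /Fgamma invmx_Dk [RHS]mxE /entry /dual_index /half_swap.
case: (split_ordP i) => a ->; case: (split_ordP j) => b ->; rewrite ?splitE
  ?(block_mxEul, block_mxEur, block_mxEdl, block_mxEdr);
  case: (split_ordP a) => a' ->; case: (split_ordP b) => b' ->; rewrite ?splitE
  ?(block_mxEul, block_mxEur, block_mxEdl, block_mxEdr) !mxE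
  ?(eq_lshift, eq_rshift, eq_lrshift, eq_rlshift) ?mul0r //.
all: by rewrite mulr_natl eq_sym.
Qed.

Let base := \sum_(i < k) (rho 0 i ^+ 2 + (rho 0 i)^-2).

Lemma normF_entry g : normF (entry g) = base + (g ^+ 2 + g^-2).
Proof.
rewrite /normF !big_split_ord !big_ord1 /=.
rewrite /base big_split /=; congr (_ + _ + (_ + _)).
- by apply: eq_bigr => i _; rewrite /entry !splitE.
- by apply: eq_bigr => i _; rewrite /entry !splitE exprVn.
- by rewrite /entry !splitE.
- by rewrite /entry !splitE exprVn.
Qed.

Lemma base_ge0 : 0 <= base.
Proof. by apply: sumr_ge0 => i _; rewrite addr_ge0 ?invr_ge0 ?sqr_ge0. Qed.

(** By g^2 + g^-2 = (g - 1/g)^2 + 2; the last block alone suffices. *)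
Lemma normF_entry_ge2 g : 0 < g -> 2 <= normF (entry g).
Proof.
move=> g0; rewrite normF_entry.
have : 0 <= (g - g^-1) ^+ 2 by exact: sqr_ge0.
rewrite sqrrB mulfV ?gt_eqF // exprVn; have := base_ge0; lra.
Qed.

Definition restricted (i : 'I_N) : bool :=
  if fintype.split i is inl _ then true else false.

Lemma restricted_dual i : restricted i -> restricted (dual_index i).
Proof.
by rewrite /restricted /dual_index; case: (fintype.split i) => a; rewrite ?splitE.
Qed.

Lemma entry_restricted g i : restricted i -> entry g i = entry 1 i.
Proof. by rewrite /restricted /entry; case: (fintype.split i). Qed.

(** The limit of g / f_i. It detects the single letter of entry g, whose inverse grows like the
    square root of N_F. *)
Definition blowup (i : 'I_N) : R :=
  match fintype.split i with
  | inl _ => 0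
  | inr a => if fintype.split a is inl _ then 1 else 0
  end.

Local Notation F0 := (at_right (0 : R)).

Lemma cvg_id_right : (fun g : R => g) @ F0 --> (0 : R).
Proof. by apply: cvg_at_right_filter; exact: cvg_id. Qed.

Lemma cvg_sqr_right : (fun g : R => g * g) @ F0 --> (0 : R).
Proof. have h := cvgM cvg_id_right cvg_id_right; rewrite mul0r in h; exact: h. Qed.

Lemma blowup_cvg i : (fun g => g / entry g i) @ F0 --> blowup i.
Proof.
have c1 (r : R) : (fun g : R => r) @ F0 --> r by exact: cvg_cst.
rewrite /blowup /entry; case: (fintype.split i) => a; case: (fintype.split a) => b.
- have h := cvgM cvg_id_right (c1 (rho 0 b)^-1); rewrite mul0r in h; exact: h.
- have h := cvgM cvg_id_right (c1 (rho 0 b)^-1^-1); rewrite mul0r in h; exact: h.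
- have h : (fun g : R => 1 : R) @ F0 --> (1 : R) by exact: cvg_cst.
  apply: cvg_trans h; apply: near_eq_cvg; near=> g.
  by rewrite divff // gt_eqF //; near: g; exact: nbhs_right_gt.
- under eq_fun do rewrite invrK.
  exact: cvg_sqr_right.
Unshelve. all: by end_near. Qed.

Lemma normF_sqr_cvg : (fun g => (normF (entry g) * g ^+ 2)^-1) @ F0 --> (1 : R).
Proof.
have h : (fun g : R => (base * (g * g) + (g * g) * (g * g) + 1)^-1) @ F0 --> (1 : R).
  have gg : (fun g : R => g * g) @ F0 --> (0 : R).
    exact: cvg_sqr_right.
  have c1 (r : R) : (fun g : R => r) @ F0 --> r by exact: cvg_cst.
  have e : base * 0 + 0 * 0 + 1 = 1 :> R by rewrite !mulr0 !add0r.
  have k1 : (fun g : R => base * (g * g) + (g * g) * (g * g) + 1) @ F0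
      --> base * 0 + 0 * 0 + 1.
    exact: cvgD (cvgD (cvgM (c1 base) gg) (cvgM gg gg)) (c1 1).
  rewrite e in k1; have h := cvgV (oner_neq0 R) k1; rewrite invr1 in h.
  exact: h.
apply: cvg_trans h; apply: near_eq_cvg; near=> g.
have g0 : 0 < g by near: g; exact: nbhs_right_gt.
rewrite normF_entry; congr (_^-1); field; by rewrite gt_eqF.
Unshelve. all: by end_near. Qed.

Lemma normF_inv_cvg : (fun g => (normF (entry g))^-1) @ F0 --> (0 : R).
Proof.
have h : (fun g => (normF (entry g) * g ^+ 2)^-1 * (g * g)) @ F0 --> (0 : R).
  have h := cvgM normF_sqr_cvg cvg_sqr_right; rewrite mulr0 in h; exact: h.
apply: cvg_trans h; apply: near_eq_cvg; near=> g.
have g0 : 0 < g by near: g; exact: nbhs_right_gt.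
have n0 : 0 < normF (entry g) by rewrite (lt_le_trans _ (normF_entry_ge2 g0)).
by field; rewrite !gt_eqF.
Unshelve. all: by end_near. Qed.

(** Inverse entries grow at most like 1/g and N_F like g^-2, so distributing g^2 over the three
    factors makes each of them converge. *)
Lemma coef_cvg a b :
  (fun g => (normF (entry g))^-1 * ((entry g a)^-1 * (entry g b)^-1)) @ F0
    --> blowup a * blowup b.
Proof.
have h : (fun g => (normF (entry g) * g ^+ 2)^-1 * ((g / entry g a) * (g / entry g b)))
    @ F0 --> blowup a * blowup b.
  have h := cvgM normF_sqr_cvg (cvgM (@blowup_cvg a) (@blowup_cvg b)); rewrite mul1r in h; exact: h.
apply: cvg_trans h; apply: near_eq_cvg; near=> g.
have g0 : 0 < g by near: g; exact: nbhs_right_gt.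
have n0 : 0 < normF (entry g) by rewrite (lt_le_trans _ (normF_entry_ge2 g0)).
by field; rewrite !gt_eqF ?entry_gt0.
Unshelve. all: by end_near. Qed.

Lemma blowup_restricted a b : restricted a || restricted b -> blowup a * blowup b = 0.
Proof.
rewrite /restricted /blowup.
by case: (fintype.split a) => [?|?]; case: (fintype.split b) => [?|?] //;
  rewrite ?mul0r ?mulr0.
Qed.

Lemma sqrtC_NF g : sqrtC (NF (Fgamma rho g)) = (Num.sqrt (normF (entry g)))%:C.
Proof.
rewrite Fgamma_monomial NF_monomial; last exact: dual_indexK.
have n0 : 0 <= normF (entry g) by apply: sumr_ge0 => i _; exact: sqr_ge0.
by rewrite -{1}(sqr_sqrtr n0) rmorphXn sqrCK // ler0c sqrtr_ge0.
Qed.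

Definition row_index (i : 'I_k) : 'I_N := lshift (1 + 1) (lshift k i).
Definition col_index (j : 'I_(k + k)) : 'I_N := lshift (1 + 1) j.

End FgammaMonomial.

Lemma embed_wprod (R : realType) (E : prehilbert R) n (u : 'I_n -> 'I_n -> op E) I J :
  wprod (fun i j => embed (u i j)) I J = embed (wprod u I J).
Proof.
by elim: I J => [|i I IH] [|j J] //=; rewrite ?rmorph1 // rmorphM /= IH.
Qed.

Lemma word_coef_ext (R : realType) n (f g : 'I_n -> R) (I J : Type)
    (row : I -> 'I_n) (col : J -> 'I_n) w :
  (forall i, f (row i) = g (row i)) -> (forall j, f (col j) = g (col j)) ->
  word_coef f row col w = word_coef g row col w.
Proof.
by move=> hr hc; apply: eq_bigr => p _; case: p.2; rewrite ?hr ?hc.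
Qed.

Unset Implicit Arguments.

Theorem theorem5p4 (R : realType) (k : nat) (rho : 'rV[R]_k)
    (hrho : forall i, 0 < rho 0 i < 1)
    (C : R -> cstarType R)
    (U : forall gamma : R, 'M[C gamma]_(k + k + (1 + 1)))
    (h : forall gamma : R, {scalar C gamma})
    (hC : forall gamma : R, 0 < gamma < 1 -> is_C_OF (Fgamma rho gamma) (U gamma))
    (hh : forall gamma : R, 0 < gamma < 1 -> is_Haar_state (U gamma) (h gamma)) :
  exists (A : cstarType R) (phi : {scalar A}) (y : 'I_k * 'I_(k + k) -> A),
    [/\ is_state phi,
        free_family phi y,
        forall p, exists alpha beta : R,
          generalized_circular phi alpha beta (y p),
        forall (i : 'I_k) (j : 'I_(k + k)),
          phi (star (y (i, j)) * y (i, j)) = (rho 0 i ^+ 2)%:C /\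
          phi (y (i, j) * star (y (i, j))) =
            (match fintype.split j with
             | inl j1 => rho 0 j1 ^- 2
             | inr j2 => rho 0 j2 ^+ 2
             end)%:C &
        forall w : seq (('I_k * 'I_(k + k)) * bool),
          (moment (h gamma) (rescaled_generators rho gamma (U gamma)) w : R[i]^o)
            @[gamma --> 0^'+] --> (moment phi y w : R[i]^o)].
Proof.
pose n := (k + k + (1 + 1))%N; pose inv : 'I_n -> 'I_n := @dual_index k.
have invK : involutive inv by exact: dual_indexK.
(* Only restricted entries survive in the limit, and they do not depend on gamma, so the parameter 1
   represents them all. *)
pose f0 := entry rho 1; pose W := free_data R n; pose E := weighted_fock W.
have f0_gt0 i : 0 < f0 i by exact: entry_gt0.
have f0_inv i : f0 (inv i) = (f0 i)^-1 by exact: entry_dual.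
pose row := @row_index k; pose col := @col_index k.
pose Y i j : compl E := embed (gen inv f0 W i j).
pose y (p : 'I_k * 'I_(k + k)) : compl E := Y (row p.1) (col p.2).
have Y_star i j : star (Y i j) = (f0 i / f0 j)%:C *: Y (inv i) (inv j).
  by rewrite /Y embed_star gen_star // embedZ.
pose a (q : 'I_n * 'I_n) : op E := cr W q.1 q.2.
have a_rel p q x : opg (a p) (opf (a q) x) = (p == q)%:R *: x.
  by case: p q => [i j] [i' j']; exact: free_cr_rel.
have a_vac p : opg (a p) vac = 0 by exact: free_cr_vac.
pose s (p : 'I_k * 'I_(k + k)) := (row p.1, col p.2).
pose t (p : 'I_k * 'I_(k + k)) := (inv (row p.1), inv (col p.2)).
(* Rows are at most k and their duals exceed k, which separates the creation letters from the
   annihilation letters of all generators. *)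
have row_dual i i' : row i != inv (row i').
  rewrite /inv /dual_index /row /row_index split_lshift /half_swap split_lshift.
  by rewrite (inj_eq (@lshift_inj _ _)) eq_lrshift.
have s_inj : injective s.
  move=> [i j] [i' j'] e; congr (_, _).
    exact: lshift_inj (lshift_inj (congr1 fst e)).
  exact: lshift_inj (congr1 snd e).
have t_inj : injective t.
  move=> p q e; apply: s_inj; congr (_, _).
    exact: (inv_inj invK) (congr1 fst e).
  exact: (inv_inj invK) (congr1 snd e).
have st_neq p q : s p != t q.
  by rewrite xpair_eqE negb_and row_dual.
have ss_neq p q : p != q -> s p != s q by rewrite (inj_eq s_inj).
have tt_neq p q : p != q -> t p != t q by rewrite (inj_eq t_inj).
pose al (p : 'I_k * 'I_(k + k)) := f0 (row p.1).
pose be (p : 'I_k * 'I_(k + k)) := (f0 (col p.2))^-1.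
exists (compl E), (@qstate R E), y; split.
- exact: qstate_is_state.
- exact: (@gcirc_free R E _ a a_rel a_vac _ s t al be).
- move=> p; exists (al p), (be p).
  apply: (@gcirc_generalized R E _ a a_rel a_vac _ s t al be) => //.
    exact: f0_gt0.
  by rewrite /be invr_gt0.
- move=> i j; split.
    rewrite [LHS](@gcirc_left_variance R E _ a a_rel a_vac _ s t al be).
    by rewrite /al /f0 /row /row_index /entry !split_lshift.
  rewrite [LHS](@gcirc_right_variance R E _ a a_rel a_vac _ s t al be).
  rewrite /be /f0 /col /col_index /entry split_lshift.
  by case: (fintype.split j) => j'; rewrite ?exprVn ?invrK.
- move=> w; pose I := word_rows inv row w; pose J := word_cols inv col w.
  have sI : size I = size w by rewrite size_map.
  have sJ : size J = size w by rewrite size_map.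
  have rI : all (@restricted k) I.
    apply/allP => _ /mapP[p _ ->]; have hr : restricted (row p.1.1).
      by rewrite /restricted split_lshift.
    by case: p.2 => //; exact: restricted_dual.
  have rJ : all (@restricted k) J.
    apply/allP => _ /mapP[p _ ->]; have hr : restricted (col p.1.2).
      by rewrite /restricted split_lshift.
    by case: p.2 => //; exact: restricted_dual.
  (* The factor contributed by the adjoints involves restricted entries only, so it is the same for
     every gamma. *)
  pose kap : R := word_coef f0 row col w.
  have -> : moment (@qstate R E) y w = kap%:C * vexp (wprod (gen inv f0 W) I J).
    rewrite /moment.
    have -> : \prod_(p <- w) star_if p.2 (y p.1)
        = \prod_(p <- w) star_if p.2 (1%:C *: Y (row p.1.1) (col p.1.2)).
      by apply: eq_bigr => p _; rewrite scale1r.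
    rewrite (prod_star_word Y_star) linearZ /= expr1n mul1r.
    by rewrite embed_wprod qstate_embed.
  have hmom : \forall g \near 0^'+,
      moment (h g) (rescaled_generators rho g (U g)) w =
      kap%:C * ((Num.sqrt (normF (entry rho g)) ^+ size I)%:C
        * h g (wprod (fun i j => U g i j) I J)).
    near=> g.
    have g0 : 0 < g by near: g; exact: nbhs_right_gt.
    have g1 : 0 < g < 1 by rewrite g0 /=; near: g; exact: nbhs_right_lt.
    have [hOF _ _] := hC g g1.
    have e := Fgamma_monomial hrho g.
    rewrite e in hOF.
    have fi i : 0 < entry rho g i by exact: entry_gt0.
    have [U_star _ _] := (OF_relations_monomial invK fi (entry_dual rho g) (U g)).1 hOF.
    rewrite /moment /rescaled_generators sqrtC_NF //.
    rewrite (@prod_star_word R n inv (entry rho g) (C g) (fun i j => U g i j) U_star _ _ row col).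
    rewrite linearZ /= sI mulrA -real_complexM mulrC.
    rewrite (@word_coef_ext R n (entry rho g) f0) //.
      by rewrite [X in X%:C]mulrC mulrC.
    + by move=> i; rewrite entry_restricted // /restricted split_lshift.
    + by move=> j; rewrite entry_restricted // /restricted split_lshift.
  have hlim : (fun g => (Num.sqrt (normF (entry rho g)) ^+ size I)%:C
        * h g (wprod (fun i j => U g i j) I J) : R[i]^o) @ 0^'+
      --> (vexp (wprod (gen inv f0 W) I J) : R[i]^o).
    apply: (@moment_cvg R n inv (0^'+) (entry rho) f0 (@restricted k)
      (fun a b => @blowup R k a * @blowup R k b)) => //.
    + exact: restricted_dual.
    + by move=> g i; exact: entry_restricted.
    + exact: coef_cvg.
    + exact: blowup_restricted.
    + exact: normF_inv_cvg.
    + near=> g; have g0 : 0 < g by near: g; exact: nbhs_right_gt.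
      by rewrite (lt_le_trans _ (normF_entry_ge2 rho g0)).
    + by rewrite sI sJ.
    + near=> g.
      have g0 : 0 < g by near: g; exact: nbhs_right_gt.
      have g1 : 0 < g < 1 by rewrite g0 /=; near: g; exact: nbhs_right_lt.
      have hCg := hC g g1; rewrite (Fgamma_monomial hrho g) in hCg.
      have fi i : 0 < entry rho g i by exact: entry_gt0.
      rewrite (haar_moment invK fi (entry_dual rho g) (normF_entry_ge2 rho g0) hCg (hh g g1)) ?sI ?sJ //.
      by rewrite vexp_wvec.
  have hk : (fun g => kap%:C * ((Num.sqrt (normF (entry rho g)) ^+ size I)%:C
        * h g (wprod (fun i j => U g i j) I J)) : R[i]^o) @ 0^'+
      --> (kap%:C * vexp (wprod (gen inv f0 W) I J) : R[i]^o).
    have kc : (fun g : R => kap%:C : R[i]^o) @ 0^'+ --> (kap%:C : R[i]^o) by exact: cvg_cst.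
    exact: cvgM kc hlim.
  apply: cvg_trans hk; apply: near_eq_cvg.
  by apply: filterS hmom => g ->.
Unshelve. all: by end_near. Qed.
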